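(* For any spatially spherically symmetric Berwald metric $L$ whose canonical connection obeys $[\delta_t,\delta_r]=0$ and $k_7=k_8=k_9=k_{10}=0$, there exists an affinely equivalent (pseudo-)Riemannian metric $\mathbf{A}$, built as $$\mathbf{A}=h_{tt}\dot t^2+2h_{tr}\dot t\dot r+h_{rr}\dot r^2\pm(\dot\theta^2+\dot\phi^2\sin^2\theta),$$ where $h=h(t,r)$ is a flat 2-dimensional (pseudo-Euclidean) metric in the variables $(t,r)$ metrizing the flat 2-dimensional connection with coefficients $k_1,\dots,k_6$. In this case, $$\dim\mathcal{V}(\mathcal{D}_{\mathcal{H}})=1.$$
   Context: $M\subset\mathbb{R}^4\setminus\{0\}$ is open, with spherical coordinates $(x^a)=(t,r,\theta,\phi)$; $(x^a,\dot x^a)$ are the induced coordinates on $TM$, $\partial_a=\partial/\partial x^a$, $\dot\partial_a=\partial/\partial\dot x^a$, $w^2=\dot\theta^2+\dot\phi^2\sin^2\theta$. A conic subbundle is an open $\mathcal{A}\subset TM\setminus0$ projecting onto $M$ and stable under positive rescaling of vectors. A (pseudo-)Finsler function is a smooth $L:\mathcal{A}\to\mathbb{R}$, positively 2-homogeneous in $\dot x$, with nonsingular Hessian $g_{ab}=\frac12\dot\partial_a\dot\partial_bL$ (any signature). It is (pseudo-)Riemannian if $L=a_{ab}(x)\dot x^a\dot x^b$. With $G^a=\frac14g^{ab}(\dot x^c\partial_c\dot\partial_bL-\partial_bL)$, $L$ is Berwald if $2G^c=\Gamma^c_{ab}(x)\dot x^a\dot x^b$ for a torsion-free affine connection $\nabla$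 on $M$ (its canonical connection). Two Berwald metrics are affinely equivalent if they have the same canonical connection (for a pseudo-Riemannian metric this is the Levi-Civita connection). $\delta_a=\partial_a-\Gamma^c_{ab}\dot x^b\dot\partial_c$; $\mathcal{D}_{\mathcal{H}}=\mathrm{Span}\{\delta_a,[\delta_a,\delta_b],[\delta_a,[\delta_b,\delta_c]],\dots\}=\mathrm{Span}\{\delta_a\}\oplus\mathcal{V}(\mathcal{D}_{\mathcal{H}})$ on $\mathcal{A}$, where $\mathcal{V}(\mathcal{D}_{\mathcal{H}})\subset\mathrm{Span}\{\dot\partial_a\}$ is the vertical part; dimension means fibre dimension. $L$ is spatially spherically symmetric if $L=L(t,r,\dot t,\dot r,w)$ (invariance under $SO(3)$ rotations fixing $t$). Its canonical connection has the coefficients, with $k_i=k_i(t,r)$: $\Gamma^t_{tt}=k_1$, $\Gamma^t_{tr}=k_2$, $\Gamma^t_{rr}=k_3$, $\Gamma^r_{tt}=k_4$, $\Gamma^r_{rr}=k_5$, $\Gamma^r_{tr}=k_6$, $\Gamma^t_{\theta\theta}=\Gamma^t_{\phi\phi}/\sin^2\theta=k_7$, $\Gamma^\phi_{\phi t}=\Gamma^\theta_{\theta t}=k_8$, $\Gamma^\phi_{\phi r}=\Gamma^\theta_{\theta r}=k_9$, $\Gamma^r_{\theta\theta}=\Gamma^r_{\phi\phi}/\sin^2\theta=k_{10}$, $\Gamma^\theta_{\phi\phi}=-\sin\theta\cos\theta$, $\Gamma^\phi_{\theta\phi}=\cot\theta$, the remaining ones (up to lower-index symmetry) being zero. The condition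 $[\delta_t,\delta_r]=0$ says in particular that the 2-dimensional connection in $(t,r)$ with coefficients $k_1,\dots,k_6$ is flat; ''$h$ metrizes it'' means that it is the Levi-Civita connection of $h$.
   Formalization: The metric A is asserted over each simply connected open subset of the (t,r)-domain (global existence can fail, e.g. over an annulus), and dim V(D_H)=1 is asserted at vectors with w≠0 (at w=0 the dimension is 0); M lies in the chart r>0, 0<θ<π. *)

(* Defs.v *)
(* The manifold is described in its spherical chart: a point is the row
   (t, r, theta, phi), and a point of the tangent bundle is the pair (x, y) of
   the rows of the x^a and of the dot x^a. *)
From HB Require Import structures.
From mathcomp Require Import all_boot all_order all_algebra.
From mathcomp Require Import all_classical all_reals all_analysis.
Set Implicit Arguments.
Unset Strict Implicit.
Unset Printing Implicit Defensive.
Import Order.TTheory GRing.Theory Num.Theory.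
Import numFieldNormedType.Exports.
Local Open Scope classical_set_scope.
Local Open Scope ring_scope.

(* C^infinity on an open set U: every iterated directional derivative (s = [::]
   being f itself) is differentiable at every point of U.  The values of f
   outside of U are irrelevant, U being open. *)
Definition smooth_on (R : realType) (V W : normedModType R) (U : set V)
    (f : V -> W) : Prop :=
  forall (s : seq V) (x : V), U x ->
    differentiable (foldr (fun v g => 'D_v g) f s) x.

Definition unit_itv (R : realType) : set R := [set s | 0 <= s <= 1].
Arguments unit_itv {R}.

Definition simply_connected (R : realType) (V : normedModType R) (W : set V)
    : Prop :=
  (forall x y, W x -> W y -> exists c : R -> V,
     [/\ {within unit_itv, continuous c}, c @` unit_itv `<=` W,
         c 0 = x & c 1 = y]) /\
  (forall c : R -> V, {within unit_itv, continuous c} ->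
     c @` unit_itv `<=` W -> c 0 = c 1 ->
     exists H : R * R -> V,
       [/\ {within unit_itv `*` unit_itv, continuous H},
           H @` (unit_itv `*` unit_itv) `<=` W,
           forall s, unit_itv s -> H (0, s) = c s /\ H (1, s) = c 0 &
           forall u, unit_itv u -> H (u, 0) = c 0 /\ H (u, 1) = c 0]).

Section Connections.
Variables (R : realType) (n : nat).
Local Notation pt := 'rV[R]_n.+1.

Definition partial (a : 'I_n.+1) (f : pt -> R) : pt -> R :=
  'D_(delta_mx ord0 a) f.

(* The upper index comes first: G x c a b is Gamma^c_{ab}(x). *)
Definition connection := pt -> 'I_n.+1 -> 'I_n.+1 -> 'I_n.+1 -> R.

Definition torsion_free_connection (M : set pt) (G : connection) : Prop :=
  (forall c a b, smooth_on M (fun x => G x c a b)) /\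
  (forall x c a b, M x -> G x c a b = G x c b a).

(* Any signature is allowed. *)
Definition pseudo_metric (U : set pt) (h : pt -> 'M[R]_n.+1) : Prop :=
  [/\ forall a b, smooth_on U (fun x => h x a b),
      forall x, U x -> (h x)^T = h x
    & forall x, U x -> h x \in unitmx].

Definition christoffel (h : pt -> 'M[R]_n.+1) : connection := fun x c a b =>
  2^-1 * \sum_d invmx (h x) c d *
    (partial a (fun z => h z b d) x + partial b (fun z => h z a d) x
     - partial d (fun z => h z a b) x).

Definition metrizes (U : set pt) (h : pt -> 'M[R]_n.+1) (G : connection) : Prop :=
  forall x c a b, U x -> G x c a b = christoffel h x c a b.

(* R^d_{cab} *)
Definition curvature (G : connection) (x : pt) (d c a b : 'I_n.+1) : R :=
  partial a (fun z => G z d b c) x - partial b (fun z => G z d a c) x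
  + \sum_e (G x d a e * G x e b c - G x d b e * G x e a c).

Definition flat_on (U : set pt) (G : connection) : Prop :=
  forall x d c a b, U x -> curvature G x d c a b = 0.

End Connections.

Section Finsler.
Variables (R : realType) (n : nat).
Local Notation pt := 'rV[R]_n.+1.
Local Notation tpt := ('rV[R]_n.+1 * 'rV[R]_n.+1)%type.

Definition base_dir (a : 'I_n.+1) : tpt := (delta_mx ord0 a, 0).
Definition fibre_dir (a : 'I_n.+1) : tpt := (0, delta_mx ord0 a).
Definition dx (a : 'I_n.+1) (f : tpt -> R) : tpt -> R := 'D_(base_dir a) f.
Definition dv (a : 'I_n.+1) (f : tpt -> R) : tpt -> R := 'D_(fibre_dir a) f.

(* TM without its zero section *)
Definition slit_tangent (M : set pt) : set tpt := [set p | M p.1 /\ p.2 != 0].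

Definition conic_subbundle (M : set pt) (A : set tpt) : Prop :=
  [/\ open A, A `<=` slit_tangent M,
      forall x, M x -> exists y, A (x, y)
    & forall x y (c : R), 0 < c -> A (x, y) -> A (x, c *: y)].

Definition fundamental_tensor (L : tpt -> R) (p : tpt) : 'M[R]_n.+1 :=
  \matrix_(a, b) (2^-1 * dv a (dv b L) p).

Definition finsler (M : set pt) (A : set tpt) (L : tpt -> R) : Prop :=
  [/\ conic_subbundle M A, smooth_on A L,
      forall x y (c : R), 0 < c -> A (x, y) -> L (x, c *: y) = c ^+ 2 * L (x, y)
    & forall p, A p -> fundamental_tensor L p \in unitmx].

Definition pseudo_riemannian (M : set pt) (A : set tpt) (L : tpt -> R) : Prop :=
  finsler M A L /\
  exists a : pt -> 'M[R]_n.+1, forall x y, A (x, y) ->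
    L (x, y) = \sum_i \sum_j a x i j * y ord0 i * y ord0 j.

(* G^a *)
Definition spray (L : tpt -> R) (p : tpt) (a : 'I_n.+1) : R :=
  4^-1 * \sum_b invmx (fundamental_tensor L p) a b *
    (\sum_c p.2 ord0 c * dx c (dv b L) p - dx b L p).

(* L is a Berwald metric on A, and G is its canonical connection. *)
Definition berwald_with (M : set pt) (A : set tpt) (L : tpt -> R)
    (G : connection R n) : Prop :=
  [/\ finsler M A L, torsion_free_connection M G
    & forall x y c, A (x, y) ->
        2 * spray L (x, y) c = \sum_a \sum_b G x c a b * y ord0 a * y ord0 b].

Definition affinely_equivalent (M : set pt) (A1 : set tpt) (L1 : tpt -> R)
    (A2 : set tpt) (L2 : tpt -> R) : Prop :=
  exists G, berwald_with M A1 L1 G /\ berwald_with M A2 L2 G.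

(* A vector field on the tangent bundle is given by its components with respect
   to the (d/dx^a, d/d dot x^a), themselves grouped in a pair. *)
Definition lie (X Y : tpt -> tpt) : tpt -> tpt := fun p =>
  'D_(X p) Y p - 'D_(Y p) X p.

Definition hor (G : connection R n) (a : 'I_n.+1) : tpt -> tpt := fun p =>
  (delta_mx ord0 a, - \row_c \sum_b G p.1 c a b * p.2 ord0 b).

(* hor_bracket G [:: a; b; ..] c is [delta_a, [delta_b, .. delta_c]]. *)
Definition hor_bracket (G : connection R n) (s : seq 'I_n.+1) (c : 'I_n.+1)
    : tpt -> tpt :=
  foldr (fun a X => lie (hor G a) X) (hor G c) s.

Definition DH (G : connection R n) (p : tpt) : set tpt := [set v |
  exists vs : seq tpt,
    (forall u, u \in vs -> exists s c, u = hor_bracket G s c p) /\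
    v \in <<vs>>%VS].

Definition VDH (G : connection R n) (p : tpt) : set tpt :=
  DH G p `&` [set v | v.1 = 0].

Definition has_dim (S : set tpt) (m : nat) : Prop :=
  exists U : {vspace tpt}, (forall v, (v \in U) <-> S v) /\ \dim U = m.

End Finsler.

Definition it : 'I_4 := @Ordinal 4 0 isT.
Definition ir : 'I_4 := @Ordinal 4 1 isT.
Definition ith : 'I_4 := @Ordinal 4 2 isT.
Definition iph : 'I_4 := @Ordinal 4 3 isT.

Section Spherical.
Variable R : realType.

(* phi is not restricted, so that every branch of the azimuth is covered. *)
Definition spherical_domain (M : set 'rV[R]_4) : Prop :=
  open M /\ forall x, M x -> 0 < x ord0 ir /\ 0 < x ord0 ith < pi.

Definition tr_proj (x : 'rV[R]_4) : 'rV[R]_2 :=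
  \row_(i < 2) x ord0 (widen_ord (isT : 2 <= 4)%N i).

Definition angular_speed (p : 'rV[R]_4 * 'rV[R]_4) : R :=
  Num.sqrt (p.2 ord0 ith ^+ 2
            + p.2 ord0 iph ^+ 2 * sin (p.1 ord0 ith) ^+ 2).

Definition spherically_symmetric (A : set ('rV[R]_4 * 'rV[R]_4))
    (L : 'rV[R]_4 * 'rV[R]_4 -> R) : Prop :=
  exists l : R -> R -> R -> R -> R -> R, forall x y, A (x, y) ->
    L (x, y) = l (x ord0 it) (x ord0 ir) (y ord0 it) (y ord0 ir)
                 (angular_speed (x, y)).

(* k i stands for k_i, 1 <= i <= 10, as a function of the row (t, r). *)
Definition spherical_connection (k : nat -> 'rV[R]_2 -> R) : connection R 3 :=
  fun x c a b =>
    let u := tr_proj x in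
    let th := x ord0 ith in
    match val c, minn a b, maxn a b with
    | 0, 0, 0 => k 1 u
    | 0, 0, 1 => k 2 u
    | 0, 1, 1 => k 3 u
    | 1, 0, 0 => k 4 u
    | 1, 1, 1 => k 5 u
    | 1, 0, 1 => k 6 u
    | 0, 2, 2 => k 7 u
    | 0, 3, 3 => (k 7 u * sin th ^+ 2)%R
    | 2, 0, 2 | 3, 0, 3 => k 8 u
    | 2, 1, 2 | 3, 1, 3 => k 9 u
    | 1, 2, 2 => k 10 u
    | 1, 3, 3 => (k 10 u * sin th ^+ 2)%R
    | 2, 3, 3 => (- (sin th * cos th))%R
    | 3, 2, 3 => (cos th / sin th)%R
    | _, _, _ => 0%R
    end%N.

Definition tr_connection (k : nat -> 'rV[R]_2 -> R) : connection R 1 :=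
  fun u c a b =>
    match val c, minn a b, maxn a b with
    | 0, 0, 0 => k 1 u
    | 0, 0, 1 => k 2 u
    | 0, 1, 1 => k 3 u
    | 1, 0, 0 => k 4 u
    | 1, 1, 1 => k 5 u
    | 1, 0, 1 => k 6 u
    | _, _, _ => 0%R
    end%N.

Definition product_metric (h : 'rV[R]_2 -> 'M[R]_2) (eps : R)
    (p : 'rV[R]_4 * 'rV[R]_4) : R :=
  let hu := h (tr_proj p.1) in
  let y a := p.2 ord0 a in
  hu 0 0 * y it ^+ 2 + 2 * hu 0 1 * y it * y ir + hu 1 1 * y ir ^+ 2
  + eps * (y ith ^+ 2 + y iph ^+ 2 * sin (p.1 ord0 ith) ^+ 2).

End Spherical.

(* Main.v *)
(* The connection is the product of the flat connection k_1, .., k_6 in (t, r) and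
   of the Levi-Civita connection of the round sphere. On a simply connected W the
   flat factor has a parallel coframe P, that is a solution of dP = P Gamma: it is
   obtained by transport along segments, flatness making transport path-independent
   in a ball, and a null homotopy, cut into small squares, shows that closed chains
   of balls have trivial holonomy. Then h = P^T P is parallel, so h plus or minus the
   round metric is compatible with the product connection, which determines it as
   the Levi-Civita connection and as the canonical connection of the associated
   quadratic Finsler function. Finally, [delta_theta, delta_phi] is a multiple of the
   right-angle rotation of the angular velocity, the other brackets of two delta_a
   vanish, and further brackets stay proportional to that rotation. *)
Require Import Defs.
From HB Require Import structures.
From mathcomp Require Import all_boot all_order all_algebra.
From mathcomp Require Import all_classical all_reals all_analysis.
From mathcomp Require Import ring lra.
Import Order.TTheory GRing.Theory Num.Theory.
Import numFieldNormedType.Exports.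
Set Implicit Arguments.
Unset Strict Implicit.
Unset Printing Implicit Defensive.
Local Open Scope classical_set_scope.
Local Open Scope ring_scope.

(** * Linear differential equations on [0, 1] *)

(** The hard points are a coframe defined on all of W, which could be multivalued, and the
    differentiation of transport in its end point. The latter avoids smooth dependence on
    parameters: transport along v + h is compared with the ansatz X (1 + s Gam(h)), whose error
    solves a linear equation with a source of order e |h| exactly because the curvature vanishes,
    and Gronwall's inequality bounds that error. Transport in a triangle is then path-independent by
    uniqueness of solutions, without integration over surfaces. Replacing paths by chains of balls
    makes the global step combinatorial, so homotopies need only be continuous. The form P^T P is
    positive definite, but any constant symmetric invertible matrix between P^T and P would give a
    parallel metric, hence every signature. The dimension count rests on the span of sin and cos
    being stable under d/dtheta: every iterated bracket is determined by two constants and is a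
    multiple of one vertical field, which is nonzero exactly where the angular speed is. *)

Section LinearODE.
Variable R : realType.

(* Composing with this retraction onto [0, 1] turns a function that is only
   controlled on [0, 1] into one that is continuous on the whole line. *)
Definition clamp (s : R) : R := Num.min 1 (Num.max 0 s).

Lemma clamp_ge0 s : 0 <= clamp s.
Proof. by rewrite /clamp le_min ler01 le_max lexx. Qed.

Lemma clamp_le1 s : clamp s <= 1.
Proof. by rewrite /clamp ge_min lexx. Qed.

Lemma clamp_id s : 0 <= s <= 1 -> clamp s = s.
Proof. by case/andP=> s0 s1; rewrite /clamp max_r// min_r. Qed.

Lemma clamp0 s : s <= 0 -> clamp s = 0.
Proof. by move=> s0; rewrite /clamp max_l// min_r// ler01. Qed.

Lemma clamp1 s : 1 <= s -> clamp s = 1.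
Proof. by move=> s1; rewrite /clamp min_l// le_max s1 orbT. Qed.

Lemma continuous_clamp : continuous clamp.
Proof.
move=> s; apply: continuous_min; first exact: cst_continuous.
by apply: continuous_max; [exact: cst_continuous|exact: cvg_id].
Qed.

Lemma continuous_comp_clamp (T : topologicalType) (f : R -> T) :
  (forall s : R, 0 <= s <= 1 -> {for s, continuous f}) -> continuous (f \o clamp).
Proof.
move=> cf s; apply: continuous_comp; first exact: continuous_clamp.
by apply: cf; rewrite clamp_ge0 clamp_le1.
Qed.

Lemma near_clamp_id (s : R) : 0 < s < 1 -> \forall t \near s, clamp t = t.
Proof.
case/andP=> s0 s1; near=> t.
apply: clamp_id; apply/andP; split.
- by near: t; exact: lt_le_nbhsr.
- by near: t; exact: lt_le_nbhsl.
Unshelve. all: by end_near. Qed.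

Lemma antiderivative (g : R -> R) : continuous g ->
  exists F : R -> R, [/\ continuous F, F 0 = 0
    & forall s : R, 0 < s < 1 -> is_derive s 1 F (g s)].
Proof.
move=> cg.
(* The base point -1, and the end point 2 below, leave a margin around [0, 1], so that [F0] is
   differentiable, hence continuous, at 0 and 1 too. *)
pose F0 x := (\int[lebesgue_measure]_(t in [set` `[(-1 : R), x]]) g t)%R.
have FD (x : R) : -1 < x < 2 -> derivable F0 x 1 /\ derive1 F0 x = g x.
  case/andP=> x1 x2; apply: (@continuous_FTC1_closed R g (-1) x 2) => //.
  - apply: continuous_compact_integrable; first exact: segment_compact.
    by apply: continuous_subspaceT.
  - exact: cg.
pose F x := F0 (clamp x) - F0 0.
have I01 (x : R) : 0 <= x <= 1 -> -1 < x < 2.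
  by case/andP=> x0 x1; apply/andP; split; lra.
have FI (x : R) : -1 < x < 2 -> is_derive x 1 F0 (g x).
  move=> x12; have [d e] := FD _ x12; rewrite -e derive1E; exact: derivableP.
exists F; split.
- have : continuous (F0 \o clamp).
    apply: continuous_comp_clamp => s s01.
    apply: differentiable_continuous; apply/derivable1_diffP.
    by have [] := FD _ (I01 _ s01).
  by move=> c x; apply: cvgB; [exact: c|exact: cvg_cst].
- by rewrite /F clamp0 ?subrr.
- move=> s s01.
  apply: (near_eq_is_derive (f := fun x => F0 x - F0 0)).
    by apply: filterS (near_clamp_id s01) => t ct; rewrite /F ct.
  have FIs := FI s (I01 s ltac:(by case/andP: s01 => s0 s1; rewrite !ltW)).
  by apply: is_derive_eq; rewrite subr0.
Qed.

Lemma is_derive_bigsum (V W : normedModType R) (I : finType) (h : I -> V -> W)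
    (x v : V) (dh : I -> W) :
  (forall i, is_derive x v (h i) (dh i)) ->
  is_derive x v (fun z => \sum_i h i z) (\sum_i dh i).
Proof.
move=> hh; elim: (index_enum I) => [|i s IH].
  have -> : (fun z => \sum_(i <- [::]) h i z) = cst 0.
    by apply/funext => z; rewrite big_nil.
  by rewrite big_nil; exact: is_derive_cst.
have -> : (fun z => \sum_(i <- i :: s) h i z)
    = h i \+ (fun z => \sum_(i <- s) h i z).
  by apply/funext => z; rewrite big_cons.
by rewrite big_cons; apply: is_deriveD.
Qed.

Lemma cvg_bigsum (T : Type) (F : set_system T) (V : normedModType R) (I : finType)
    (h : I -> T -> V) (l : I -> V) : Filter F ->
  (forall i, h i @ F --> l i) -> (fun z => \sum_i h i z) @ F --> \sum_i l i.
Proof.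
move=> FF hh; elim: (index_enum I) => [|i s IH].
  have -> : (fun z => \sum_(i <- [::]) h i z) = cst 0.
    by apply/funext => z; rewrite big_nil.
  by rewrite big_nil; exact: cvg_cst.
have -> : (fun z => \sum_(i <- i :: s) h i z)
    = h i \+ (fun z => \sum_(i <- s) h i z).
  by apply/funext => z; rewrite big_cons.
by rewrite big_cons; apply: cvgD.
Qed.

Lemma is_derive_mul (V : normedModType R) (f g : V -> R) (x v : V) (df dg : R) :
  is_derive x v f df -> is_derive x v g dg ->
  is_derive x v (fun z => f z * g z) (df * g x + f x * dg).
Proof.
move=> hf hg; have := is_deriveM hf hg.
by rewrite addrC [X in X + _]mulrC.
Qed.

(** Mean value theorem for g - f, whose derivative is nonnegative inside the interval. *)
Lemma derive_bound (f g df dg : R -> R) :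
  (forall s : R, 0 <= s <= 1 -> {for s, continuous f}) ->
  (forall s : R, 0 <= s <= 1 -> {for s, continuous g}) ->
  (forall s : R, 0 < s < 1 -> is_derive s 1 f (df s)) ->
  (forall s : R, 0 < s < 1 -> is_derive s 1 g (dg s)) ->
  (forall s : R, 0 < s < 1 -> df s <= dg s) ->
  forall s : R, 0 <= s <= 1 -> f s - f 0 <= g s - g 0.
Proof.
move=> cf cg hf hg le s /andP[s0 s1].
pose h x := g x - f x.
have D (x : R) : x \in `]0, 1[ -> is_derive x 1 h (dg x - df x).
  by rewrite in_itv /= => x01; apply: is_deriveB; [exact: hg|exact: hf].
have [->|sn0] := eqVneq s 0; first by rewrite !subrr.
have sp : 0 < s by rewrite lt_neqAle eq_sym sn0.
have dh (x : R) : x \in `]0, s[ -> is_derive x 1 h (dg x - df x).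
  move=> xs; apply: D; move: xs; rewrite !in_itv /= => /andP[x0 xs].
  by rewrite x0 (lt_le_trans xs).
have ch : {within `[0, s], continuous h}.
  apply: continuous_in_subspaceT => x; rewrite inE /= in_itv /= => /andP[x0 xs].
  have x01 : 0 <= x <= 1 by rewrite x0 (le_trans xs).
  by apply: cvgB; [apply: cg|apply: cf].
have [x] := MVT sp dh ch.
rewrite in_itv /= subr0 => /andP[x0 xs] e.
have x01 : 0 < x < 1 by rewrite x0 (lt_le_trans xs).
have : 0 <= (dg x - df x) * s by rewrite mulr_ge0// subr_ge0 le.
rewrite -e /h; lra.
Qed.

Lemma sumr_le_sum (I : finType) (F H : I -> R) :
  (forall i, F i <= H i) -> \sum_i F i <= \sum_i H i.
Proof. by move=> FH; apply: ler_sum => i _; exact: FH. Qed.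

Lemma is_derive_expR_scale (k s : R) :
  is_derive s 1 (fun t => expR (k * t)) (k * expR (k * s)).
Proof.
have e : is_derive s (1 : R) (fun t : R => k * t) k.
  have := is_derive_mul (is_derive_cst k s 1) (is_derive_id s 1).
  by rewrite mul0r add0r mulr1.
have := is_derive1_comp (is_derive_expR (k * s)) e.
by rewrite mulrC.
Qed.

Lemma is_derive_continuous (f : R -> R) (s df : R) :
  is_derive s 1 f df -> {for s, continuous f}.
Proof.
by move=> fs; apply/differentiable_continuous/derivable1_diffP; case: fs.
Qed.

(** Stability of X' = X A under a source F. The bound is linear in c: this gives first-order errors
    when the end point of a transport moves, and uniqueness when c = 0. *)
Lemma gronwall (p m : nat) (K c : R) (E F : R -> 'M[R]_(p, m))
    (A : R -> 'M[R]_m) :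
  0 <= K -> 0 <= c ->
  (forall s : R, 0 <= s <= 1 ->
     forall i j, {for s, continuous (fun t => E t i j)}) ->
  (forall s : R, 0 < s < 1 -> forall i j,
     is_derive s 1 (fun t => E t i j) ((E s *m A s + F s) i j)) ->
  (forall s : R, 0 < s < 1 -> forall i j, `|A s i j| <= K) ->
  (forall s : R, 0 < s < 1 -> forall i j, `|F s i j| <= c) ->
  E 0 = 0 ->
  forall s : R, 0 <= s <= 1 -> forall i j,
    `|E s i j| <= c * ((p * m)%:R * expR (m%:R * K *+ 2 + 1) + 1).
Proof.
move=> K0 c0 cE dE bA bF E0 s s01 i0 j0.
(* The energy N satisfies N' <= k N + const, so N expR (- k s) grows at most linearly. *)
pose N t := \sum_i \sum_j E t i j * E t i j.
(* The part 2 m K comes from the cross terms with A, the extra 1 from absorbing those with F by 2 x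
   f <= x^2 + c^2. *)
pose k := m%:R * K *+ 2 + 1.
have cN (t : R) : 0 <= t <= 1 -> {for t, continuous N}.
  move=> t01; apply: cvg_bigsum => i; apply: cvg_bigsum => j.
  by apply: cvgM; apply: cE.
pose dN t := \sum_i \sum_j ((E t *m A t + F t) i j * E t i j
                            + E t i j * (E t *m A t + F t) i j).
have NE (t : R) : 0 < t < 1 -> is_derive t 1 N (dN t).
  move=> t01; apply: is_derive_bigsum => i; apply: is_derive_bigsum => j.
  by apply: is_derive_mul; apply: dE.
have bN (t : R) : 0 < t < 1 -> dN t <= k * N t + (p * m)%:R * c ^+ 2.
  move=> t01.
  have le1 (x y a : R) : `|a| <= K -> 2 * (x * a * y) <= K * (x * x) + K * (y * y).
    move=> aK; have : `|x * a * y| <= K * (`|x| * `|y|).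
      by rewrite !normrM mulrAC mulrC ler_wpM2r// mulr_ge0.
    move/(le_trans (ler_norm _)) => h.
    have : 0 <= K * (`|x| - `|y|) ^+ 2 by rewrite mulr_ge0// sqr_ge0.
    have := real_normK (num_real x); have := real_normK (num_real y).
    rewrite !expr2 => e1 e2; rewrite -e1 -e2; nra.
  have le2 (x f : R) : `|f| <= c -> 2 * (x * f) <= x * x + c ^+ 2.
    move=> fc; have : f ^+ 2 <= c ^+ 2.
      by rewrite -(real_normK (num_real f)) ler_sqr ?nnegrE.
    by have := sqr_ge0 (x - f); nra.
  have sc (x : R) : \sum_(l < m) x = m%:R * x.
    by rewrite sumr_const card_ord mulr_natl.
  have leij i j : (E t *m A t + F t) i j * E t i j
        + E t i j * (E t *m A t + F t) i j
      <= \sum_l (K * (E t i l * E t i l) + K * (E t i j * E t i j))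
         + (E t i j * E t i j + c ^+ 2).
    rewrite [X in X + _]mulrC -mulr2n -mulr_natl !mxE mulrDr mulrDr.
    apply: lerD; last exact/le2/bF.
    rewrite !mulr_sumr; apply: ler_sum => l _.
    by rewrite [X in 2 * X]mulrC; apply/le1/bA.
  apply: (le_trans (sumr_le_sum (fun i => sumr_le_sum (leij i)))).
  have -> : \sum_i \sum_j (\sum_l (K * (E t i l * E t i l)
        + K * (E t i j * E t i j)) + (E t i j * E t i j + c ^+ 2))
      = \sum_i (m%:R * (K * \sum_j E t i j * E t i j)
               + m%:R * (K * \sum_j E t i j * E t i j)
               + \sum_j E t i j * E t i j + m%:R * c ^+ 2).
    apply: eq_bigr => i _; rewrite big_split /= [X in _ + X]big_split /= addrA.
    rewrite sc; congr (_ + _ + _).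
    under eq_bigr do rewrite big_split /= sc.
    by rewrite big_split /= sc -!mulr_sumr.
  rewrite !big_split /= sumr_const card_ord -!mulr_sumr -/(N t).
  rewrite -[X in _ + X]mulr_natl natrM /k -mulr_natl; lra.
have ek (t : R) := is_derive_expR_scale (- k) t.
have dl (t : R) : is_derive t (1 : R) (fun t : R => (p * m)%:R * c ^+ 2 * t)
    ((p * m)%:R * c ^+ 2).
  have := is_derive_mul (is_derive_cst ((p * m)%:R * c ^+ 2) t 1)
    (is_derive_id t 1).
  by rewrite mul0r add0r mulr1.
have k0 : 0 <= k by rewrite addr_ge0// mulrn_wge0// mulr_ge0.
have cc0 : 0 <= (p * m)%:R * c ^+ 2 by rewrite mulr_ge0// sqr_ge0.
have N0 : N 0 = 0.
  by rewrite /N big1// => i _; rewrite big1// => j _; rewrite E0 !mxE mul0r.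
have bound : N s * expR (- k * s) - N 0 * expR (- k * 0)
    <= (p * m)%:R * c ^+ 2 * s - (p * m)%:R * c ^+ 2 * 0.
  apply: (@derive_bound (fun t => N t * expR (- k * t))
    (fun t => (p * m)%:R * c ^+ 2 * t)
    (fun t => dN t * expR (- k * t) + N t * (- k * expR (- k * t)))
    (fun=> (p * m)%:R * c ^+ 2)) => // t t01.
  - by apply: cvgM; [exact: cN|apply: is_derive_continuous (ek t)].
  - exact: is_derive_continuous (dl t).
  - exact: is_derive_mul (NE t t01) (ek t).
  - have e0 := expR_gt0 (- k * t).
    have e1 : expR (- k * t) <= 1.
      by rewrite -expR0 ler_expR mulNr oppr_le0 mulr_ge0//; case/andP: t01 => /ltW.
    have := bN t t01; nra.
rewrite N0 mul0r mulr0 !subr0 in bound.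
case/andP: s01 => s0 s1.
have NS : N s <= (p * m)%:R * c ^+ 2 * expR k.
  have e1 : expR (k * s) <= expR k by rewrite ler_expR ler_piMr.
  have e2 : expR (- k * s) * expR (k * s) = 1.
    by rewrite -expRD mulNr addNr expR0.
  have := ler_wpM2r (expR_ge0 (k * s)) bound.
  rewrite -(mulrA (N s)) e2 mulr1 => h; apply: (le_trans h).
  apply: (@le_trans _ _ ((p * m)%:R * c ^+ 2 * expR (k * s))).
    by rewrite ler_wpM2r ?expR_ge0// ler_piMr.
  by rewrite ler_wpM2l.
have En : E s i0 j0 ^+ 2 <= N s.
  rewrite /N (bigD1 i0)//= (bigD1 j0)//= expr2 -addrA lerDl addr_ge0//.
    by apply: sumr_ge0 => j _; rewrite -expr2 sqr_ge0.
  by apply: sumr_ge0 => i _; apply: sumr_ge0 => j _; rewrite -expr2 sqr_ge0.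
(* Squares are compared: the energy is at most c^2 x with x = p m expR k, and x <= (x + 1)^2
   dispenses with a square root. This is the origin of the final + 1. *)
rewrite -(ler_sqr (normr_ge0 _)) ?nnegrE; last first.
  by rewrite mulr_ge0// addr_ge0// mulr_ge0// expR_ge0.
rewrite real_normK ?num_real// (le_trans En)// (le_trans NS)//.
have e0 : 0 <= (p * m)%:R * expR k by rewrite mulr_ge0// expR_ge0.
rewrite mulrAC [X in _ <= X]exprMn mulrC ler_wpM2l ?sqr_ge0//.
by rewrite -/k; nra.
Qed.
End LinearODE.

(** * Existence for linear systems by Picard iteration *)

Section Picard.
Variable R : realType.

Lemma geometric_le (D e : R) : 0 < e -> exists n, D / 2 ^+ n <= e.
Proof.
move=> e0; exists (Num.bound (D / e)).
have h := upper_nthrootP (leqnn (Num.bound (D / e))).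
rewrite ler_pdivrMr ?exprn_gt0// mulrC -ler_pdivrMr//.
exact: ltW.
Qed.

(** The intervals of radius 2 C / 2^n around a n are nested, so the supremum of their left ends lies
    in all of them. *)
Lemma geometric_limit (a : nat -> R) (C : R) :
  (forall n, `|a n.+1 - a n| <= C / 2 ^+ n) ->
  exists l, forall n, `|l - a n| <= 2 * C / 2 ^+ n.
Proof.
move=> ha.
pose b n := a n - 2 * C / 2 ^+ n; pose c n := a n + 2 * C / 2 ^+ n.
have half n : 2 * C / 2 ^+ n = C / 2 ^+ n + 2 * C / 2 ^+ n.+1 :> R.
  have h : 2 ^+ n != 0 :> R by rewrite expf_neq0.
  by rewrite exprS; field.
have bS n : b n <= b n.+1.
  by have := ha n; rewrite ler_distl /b (half n) => /andP[? ?]; lra.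
have cS n : c n.+1 <= c n.
  by have := ha n; rewrite ler_distl /c (half n) => /andP[? ?]; lra.
have C0 : 0 <= C by have := ha 0%N; rewrite expr0 divr1; apply: le_trans.
have bc n : b n <= c n.
  have : 0 <= 2 * C / 2 ^+ n by rewrite divr_ge0// ?exprn_ge0// mulr_ge0.
  rewrite /b /c; lra.
have bm : {homo b : n m / (n <= m)%N >-> n <= m} by apply: homo_leq => //; exact: le_trans.
have cm : {homo c : n m / (n <= m)%N >-> m <= n}.
  by apply: homo_leq => // x y z h1 h2; exact: le_trans h2 h1.
have bcm n m : b n <= c m.
  apply: (le_trans (bm _ _ (leq_maxl n m))); apply: (le_trans (bc _)).
  exact/cm/leq_maxr.
exists (sup (range b)) => n.
have ub : has_ubound (range b) by exists (c 0%N) => _ [k _ <-].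
have h1 : b n <= sup (range b) by apply: ub_le_sup => //; exists n.
have h2 : sup (range b) <= c n.
  by apply: ge_sup; [exists (b 0%N); exists 0%N|move=> _ [k _ <-]].
by rewrite ler_distl; apply/andP; move: h1 h2; rewrite /b /c => h1 h2; split; lra.
Qed.

Lemma uniform_geometric_continuous (f : R -> R) (a : nat -> R -> R) (D : R) :
  (forall n, continuous (a n)) ->
  (forall n s, `|f s - a n s| <= D / 2 ^+ n) -> continuous f.
Proof.
move=> ca hf s; apply/cvgrPdist_le => /= e e0.
have [n hn] := geometric_le D (divr_gt0 e0 (ltr0Sn R 2)).
have h1 := hf n s.
have /cvgrPdist_le/(_ _ (divr_gt0 e0 (ltr0Sn R 2))) := ca n s.
apply: filterS => t; change (`|a n s - a n t| <= e / 3 -> `|f s - f t| <= e).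
move=> h2; have h3 := hf n t.
move: h1 h2 h3; rewrite !ler_distl => /andP[? ?] /andP[? ?] /andP[? ?].
by apply/andP; split; lra.
Qed.

Lemma bounded_unit_itv (I : finType) (h : I -> R -> R) :
  (forall i (s : R), 0 <= s <= 1 -> {for s, continuous (h i)}) ->
  exists2 K : R, 0 <= K & forall i s, 0 <= s <= 1 -> `|h i s| <= K.
Proof.
move=> ch.
have bi i : exists K : R, 0 <= K /\ forall s, 0 <= s <= 1 -> `|h i s| <= K.
  have c1 : {within `[0, 1], continuous (fun s => `|h i s|)}.
    apply: continuous_in_subspaceT => x; rewrite inE /= in_itv /= => x01.
    by apply: cvg_norm; exact: ch.
  have [c c01 hc] := EVT_max ler01 c1.
  exists `|h i c|; split=> // s s01; apply: hc; by rewrite in_itv.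
have [k hk] := choice bi.
exists (\sum_i k i); first by apply: sumr_ge0 => i _; have [] := hk i.
move=> i s s01; rewrite (bigD1 i)//= (le_trans ((hk i).2 _ s01))// lerDl.
by apply: sumr_ge0 => j _; have [] := hk j.
Qed.

Lemma mulmx_entry_le (p m n : nat) (B : 'M[R]_(p, m)) (A : 'M[R]_(m, n)) (b K : R) :
  (forall i j, `|B i j| <= b) -> (forall i j, `|A i j| <= K) ->
  forall i j, `|(B *m A) i j| <= m%:R * (b * K).
Proof.
move=> hB hA i j; rewrite mxE (le_trans (ler_norm_sum _ _ _))//.
rewrite mulr_natl -[X in _ *+ X](card_ord m) -sumr_const; apply: ler_sum => l _.
by rewrite normrM ler_pM.
Qed.

Lemma linear_ode (p m : nat) (A : R -> 'M[R]_m) (X0 : 'M[R]_(p, m)) :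
  (forall s : R, 0 <= s <= 1 ->
     forall i j, {for s, continuous (fun t => A t i j)}) ->
  exists X : R -> 'M[R]_(p, m), [/\ X 0 = X0,
    forall i j, continuous (fun t => X t i j)
    & forall s : R, 0 < s < 1 -> forall i j,
        is_derive s 1 (fun t => X t i j) ((X s *m A s) i j)].
Proof.
move=> cA.
have cAc i j : continuous (fun t => A (clamp t) i j).
  by apply: (continuous_comp_clamp (f := fun t => A t i j)) => s /cA; exact.
have [K K0 bA] : exists2 K : R, 0 <= K &
    forall ij s, 0 <= s <= 1 -> `|A s ij.1 ij.2| <= K.
  by apply: bounded_unit_itv => -[i j] s /cA; exact.
(* [J] selects an antiderivative; its value at a discontinuous function is arbitrary. *)
have /choice[J hJ] : forall g : R -> R, exists F : R -> R, continuous g ->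
    [/\ continuous F, F 0 = 0
      & forall s : R, 0 < s < 1 -> is_derive s 1 F (g s)].
  move=> g; have [cg|ncg] := pselect (continuous g); last by exists g.
  by have [F hF] := antiderivative cg; exists F.
pose rhs (X : R -> 'M[R]_(p, m)) i j t := (X t *m A (clamp t)) i j.
(* Picard operator; the weight expR (k s) below makes it contract by 1/2. *)
pose step (X : R -> 'M[R]_(p, m)) t :=
  \matrix_(i, j) (X0 i j + J (rhs X i j) t).
have crhs (X : R -> 'M[R]_(p, m)) : (forall i j, continuous (fun t => X t i j)) ->
    forall i j, continuous (rhs X i j).
  move=> cX i j t.
  have -> : rhs X i j = (fun t => \sum_l X t i l * A (clamp t) l j).
    by apply/funext => u; rewrite /rhs mxE.
  apply: cvg_bigsum => l; apply: cvgM; [exact: cX|exact: cAc].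
have cstep (X : R -> 'M[R]_(p, m)) : (forall i j, continuous (fun t => X t i j)) ->
    forall i j, continuous (fun t => step X t i j).
  move=> cX i j t.
  have -> : (fun t => step X t i j) = (fun t => X0 i j + J (rhs X i j) t).
    by apply/funext => u; rewrite /step mxE.
  apply: cvgD; first exact: cvg_cst.
  by have [+ _ _] := hJ _ (crhs _ cX i j); exact.
have dstep (X : R -> 'M[R]_(p, m)) : (forall i j, continuous (fun t => X t i j)) ->
    forall i j (s : R), 0 < s < 1 ->
    is_derive s 1 (fun t => step X t i j) (rhs X i j s).
  move=> cX i j s s01.
  have -> : (fun t => step X t i j) = (fun t => X0 i j + J (rhs X i j) t).
    by apply/funext => u; rewrite /step mxE.
  have [_ _ dJ] := hJ _ (crhs _ cX i j).
  by have := is_deriveD (is_derive_cst (X0 i j) s 1) (dJ s s01); rewrite add0r.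
have step0 (X : R -> 'M[R]_(p, m)) : (forall i j, continuous (fun t => X t i j)) ->
    step X 0 = X0.
  move=> cX; apply/matrixP => i j; rewrite /step mxE.
  by have [_ -> _] := hJ _ (crhs _ cX i j); rewrite addr0.
(* A bound b on X - Y passes through [step]: any g with g 0 >= 0 and g' >= m b K bounds the new
   difference. It serves for the weighted contraction and again for the passage to the limit. *)
have compare (X Y : R -> 'M[R]_(p, m)) (b g dg : R -> R) :
    (forall i j, continuous (fun t => X t i j)) ->
    (forall i j, continuous (fun t => Y t i j)) ->
    (forall s : R, 0 < s < 1 -> forall i j, `|X s i j - Y s i j| <= b s) ->
    (forall s : R, is_derive s 1 g (dg s)) -> 0 <= g 0 ->
    (forall s : R, 0 < s < 1 -> m%:R * (b s * K) <= dg s) ->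
    forall s : R, 0 <= s <= 1 -> forall i j,
      `|step X s i j - step Y s i j| <= g s.
  move=> cX cY hXY dg' g0 hb.
  have dif i j (s : R) : 0 < s < 1 -> `|rhs X i j s - rhs Y i j s| <= dg s.
    move=> s01; apply: le_trans (hb s s01).
    have -> : rhs X i j s - rhs Y i j s = ((X s - Y s) *m A (clamp s)) i j.
      by rewrite mulmxBl [RHS]mxE [X in _ = _ + X]mxE.
    apply: mulmx_entry_le => k l; first by rewrite !mxE; exact: hXY.
    by apply: (bA (k, l)); rewrite clamp_ge0 clamp_le1.
  have main (X' Y' : R -> 'M[R]_(p, m)) :
      (forall i j, continuous (fun t => X' t i j)) ->
      (forall i j, continuous (fun t => Y' t i j)) ->
      (forall i j (s : R), 0 < s < 1 -> rhs X' i j s - rhs Y' i j s <= dg s) ->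
      forall s : R, 0 <= s <= 1 -> forall i j,
      step X' s i j - step Y' s i j <= g s.
    move=> cX' cY' hd s s01 i j.
    have : (step X' s i j - step Y' s i j) - (step X' 0 i j - step Y' 0 i j)
        <= g s - g 0.
      apply: (@derive_bound R (fun s => step X' s i j - step Y' s i j) g
        (fun s => rhs X' i j s - rhs Y' i j s) dg) => // t t01.
      - by apply: cvgB; apply: cstep.
      - exact: is_derive_continuous (dg' t).
      - by apply: is_deriveB; apply: dstep.
      - exact: hd.
    by rewrite !step0// subrr subr0; lra.
  move=> s s01 i j; rewrite ler_norml; apply/andP; split; last first.
    by apply: main => // k l t t01; apply: le_trans (ler_norm _) (dif _ _ _ t01).
  rewrite lerNl opprB; apply: main => // k l t t01.
  by apply: le_trans (ler_norm _) _; rewrite distrC; exact: dif.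
pose P := fix P n := if n is n'.+1 then step (P n') else fun=> X0.
have cP n : forall i j, continuous (fun t => P n t i j).
  elim: n => [|n IH]; last exact: cstep.
  by move=> i j t; exact: cvg_cst.
have [C C0 bC] : exists2 C : R, 0 <= C &
    forall ij s, 0 <= s <= 1 -> `|P 1%N s ij.1 ij.2 - P 0%N s ij.1 ij.2| <= C.
  apply: (bounded_unit_itv (h := fun ij s => P 1%N s ij.1 ij.2 - P 0%N s ij.1 ij.2)).
  by move=> [i j] s _; apply: cvgB; apply: cP.
(* With k = 2 m K, the function m K expR (k s) is half of the derivative of expR (k s). *)
pose k := m%:R * K *+ 2.
have k0 : 0 <= k by rewrite mulrn_wge0// mulr_ge0.
have stepP n : forall s : R, 0 <= s <= 1 -> forall i j,
    `|P n.+1 s i j - P n s i j| <= C / 2 ^+ n * expR (k * s).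
  elim: n => [s s01 i j|n IH].
    rewrite expr0 divr1 (le_trans (bC (i, j) _ s01))// ler_peMr// -expR0 ler_expR.
    by rewrite mulr_ge0//; case/andP: s01.
  apply: (compare (P n.+1) (P n) (fun s => C / 2 ^+ n * expR (k * s))
    (fun s => C / 2 ^+ n.+1 * expR (k * s))
    (fun s => C / 2 ^+ n.+1 * (k * expR (k * s)))); [exact: cP|exact: cP| | | |].
  - by move=> s /andP[s0 s1]; apply: IH; rewrite !ltW.
  - move=> s.
    have := is_derive_mul (is_derive_cst (C / 2 ^+ n.+1) s 1)
      (is_derive_expR_scale k s).
    by rewrite mul0r add0r.
  - by rewrite mulr_ge0 ?expR_ge0// divr_ge0// exprn_ge0.
  - move=> s _; rewrite le_eqVlt; apply/orP; left; apply/eqP.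
    rewrite /k -mulr_natl exprS; field.
    by rewrite expf_neq0.
pose E := C * expR k.
have stepE n (s : R) : 0 <= s <= 1 -> forall i j,
    `|P n.+1 s i j - P n s i j| <= E / 2 ^+ n.
  move=> s01 i j; rewrite (le_trans (stepP _ _ s01 _ _))// /E mulrAC.
  rewrite ler_wpM2r ?invr_ge0 ?exprn_ge0// ler_wpM2l// ler_expR ler_piMr//.
  by case/andP: s01.
have /choice[Y hY] : forall s : R, exists Ys : 'M[R]_(p, m), forall n i j,
    `|Ys i j - P n (clamp s) i j| <= 2 * E / 2 ^+ n.
  move=> s.
  have /choice[l hl] : forall ij : 'I_p * 'I_m, exists l, forall n,
      `|l - P n (clamp s) ij.1 ij.2| <= 2 * E / 2 ^+ n.
    move=> [i j]; apply: geometric_limit => n; apply: stepE.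
    by rewrite clamp_ge0 clamp_le1.
  by exists (\matrix_(i, j) l (i, j)) => n i j; rewrite mxE; exact: (hl (i, j)).
have cY i j : continuous (fun t => Y t i j).
  apply: (@uniform_geometric_continuous _ (fun n t => P n (clamp t) i j) (2 * E)).
    move=> n; apply: (continuous_comp_clamp (f := fun t => P n t i j)) => s _.
    exact: cP.
  by move=> n s; exact: hY.
(* Both sides are close to [P n.+1], which is [step (P n)], at a distance that tends to 0 with n. *)
have YE (s : R) : 0 <= s <= 1 -> step Y s = Y s.
  move=> s01; apply/matrixP => i j; apply/eqP; rewrite -subr_eq0 -normr_le0.
  apply/ler_addgt0Pl => e e0; rewrite addr0.
  have [n hn] := geometric_le (2 * E * (m%:R * K) + 2 * E) e0.
  have h1 : `|step Y s i j - P n.+1 s i j| <= 2 * E / 2 ^+ n * (m%:R * K) * s.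
    apply: (compare Y (P n) (fun=> 2 * E / 2 ^+ n)
      (fun s => 2 * E / 2 ^+ n * (m%:R * K) * s)
      (fun=> 2 * E / 2 ^+ n * (m%:R * K))) => //.
    - move=> t /andP[t0 t1] k' l.
      by have := hY t n k' l; rewrite clamp_id// ?ltW.
    - move=> t.
      have := is_derive_mul (is_derive_cst (2 * E / 2 ^+ n * (m%:R * K)) t 1)
        (is_derive_id t 1).
      by rewrite mul0r add0r mulr1.
    - by rewrite mulr0.
    - by move=> t _; rewrite mulrCA.
  have h2 : `|Y s i j - P n.+1 s i j| <= 2 * E / 2 ^+ n.+1.
    by have := hY s n.+1 i j; rewrite clamp_id.
  have E0 : 0 <= E / 2 ^+ n by rewrite divr_ge0 ?exprn_ge0// mulr_ge0// expR_ge0.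
  have mK : 0 <= m%:R * K by rewrite mulr_ge0.
  have e2 : 2 * E / 2 ^+ n.+1 = E / 2 ^+ n.
    by rewrite exprS; field; rewrite expf_neq0.
  rewrite e2 in h2.
  have h3 : 2 * E / 2 ^+ n * (m%:R * K) * s <= 2 * (E / 2 ^+ n) * (m%:R * K).
    by rewrite -(mulrA 2) ler_piMr ?mulr_ge0//; case/andP: s01.
  rewrite mulrDl in hn.
  have e3 : 2 * E * (m%:R * K) / 2 ^+ n = 2 * (E / 2 ^+ n) * (m%:R * K) by ring.
  rewrite e3 -(mulrA 2) in hn.
  rewrite (_ : _ - _ = (step Y s i j - P n.+1 s i j) - (Y s i j - P n.+1 s i j)); last by ring.
  rewrite (le_trans (ler_normB _ _))//; lra.
(* The witness is [step Y] rather than [Y]: its derivative is known, and the two agree on [0, 1]. *)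
exists (step Y); split.
- exact: step0.
- exact: cstep.
- move=> s /andP[s0 s1] i j.
  have s01 : 0 <= s <= 1 by rewrite !ltW.
  have := dstep _ cY i j s; rewrite /rhs YE// clamp_id// s0; exact.
Qed.
End Picard.

(** * Strict differentiability *)

Section Differentials.
Variable R : realType.

Lemma is_derive_line (V : normedModType R) (f : V -> R) (x v : V) (t : R) :
  derivable f (x + t *: v) v ->
  is_derive t 1 (fun s => f (x + s *: v)) ('D_v f (x + t *: v)).
Proof.
have e : (fun h : R => h^-1 *: (((fun s => f (x + s *: v)) \o shift t) (h *: 1)
            - f (x + t *: v)))
    = (fun h : R => h^-1 *: ((f \o shift (x + t *: v)) (h *: v) - f (x + t *: v))).
  apply/funext => h /=; congr (_ *: (f _ - _)).
  by rewrite [h *: (1 : R)]mulr1 scalerDl addrCA.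
by move=> d; split; rewrite ?/derivable /derive e.
Qed.

Lemma differentiable_from_le (V W : normedModType R) (f : V -> W) (x : V)
    (df : {linear V -> W}) : continuous df ->
  (forall e : R, 0 < e ->
     \forall h \near (0 : V), `|f (h + x) - (f x + df h)| <= e * `|h|) ->
  differentiable f x /\ 'd f x = df :> (V -> W).
Proof.
move=> cdf hf.
have H : f \o shift x = cst (f x) + df +o_ 0 id by apply/eqaddoP.
have e := diff_unique cdf H; split=> //.
by apply/diff_locallyP; rewrite e.
Qed.

Section RowVectors.
Variable n : nat.
Local Notation V := 'rV[R]_n.+1.

Lemma norm_entry_le (p q : nat) (h : 'M[R]_(p, q)) i j : `|h i j| <= `|h|.
Proof. by rewrite [leRHS]/Num.Def.normr /= mx_normrE; exact: (le_bigmax _ _ (i, j)). Qed.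

Definition lincomb (c : 'I_n.+1 -> R) (h : V) : R := \sum_a h ord0 a * c a.

Fact lincomb_is_linear c : linear (lincomb c).
Proof.
move=> k u v; rewrite /lincomb /= scaler_sumr -big_split /=.
by apply: eq_bigr => a _; rewrite !mxE mulrDl -mulrA.
Qed.

HB.instance Definition _ c := GRing.isLinear.Build R V R _ (lincomb c)
  (lincomb_is_linear c).

Lemma continuous_lincomb c : continuous (lincomb c).
Proof.
move=> h; apply: (@cvg_bigsum R _ (nbhs h) R) => a.
apply: (cvgM (F := nbhs h)); last exact: cvg_cst.
exact: coord_continuous.
Qed.

Lemma derive_lincomb (f : V -> R) (x v : V) : differentiable f x ->
  'D_v f x = lincomb (fun a => partial a f x) v.
Proof.
move=> df; rewrite deriveE// [v in LHS]row_sum_delta linear_sum /=.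
by apply: eq_bigr => a _; rewrite linearZ /= -deriveE.
Qed.

Lemma lincomb_le (c : 'I_n.+1 -> R) (h : V) (e : R) : (forall a, `|c a| <= e) ->
  `|lincomb c h| <= n.+1%:R * (`|h| * e).
Proof.
move=> ce; rewrite (le_trans (ler_norm_sum _ _ _))//.
rewrite mulr_natl -[X in _ *+ X](card_ord n.+1) -sumr_const.
by apply: ler_sum => l _; rewrite normrM ler_pM// norm_entry_le.
Qed.

(** By the mean value theorem on the segment from z to z + k, the remainder is a difference of
    partials at two points near z0. The estimate is thus uniform in the base point z, as needed for
    compactness along a segment. *)
Lemma strict_differentiable (f : V -> R) (z0 : V) :
  (\forall z \near z0, differentiable f z) ->
  (forall a, {for z0, continuous (partial a f)}) ->
  forall e : R, 0 < e -> \forall z \near z0 & k \near (0 : V),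
    `|f (z + k) - f z - 'D_k f z| <= e * `|k|.
Proof.
move=> df cf e e0.
(* Both points lie within [e'] of z0 in each partial, which costs the factor 2; [lincomb_le] costs n
   + 1. *)
pose e' := e / (n.+1%:R * 2).
have e'0 : 0 < e' by rewrite divr_gt0// mulr_gt0.
have ca a : \forall z \near z0, `|partial a f z0 - partial a f z| <= e'.
  by have /cvgrPdist_le := cf a; apply.
have : \forall z \near z0, differentiable f z /\
    forall a, `|partial a f z0 - partial a f z| <= e'.
  by apply: filterI => //; exact: (filter_forall _ ca).
case/nbhs_ballP => d d0 hd.
have hb (z k : V) (t : R) : ball z0 (d / 2) z -> ball 0 (d / 2) k -> 0 <= t <= 1 ->
    ball z0 d (z + t *: k).
  rewrite -ball_normE /= => hz; rewrite sub0r normrN => hk /andP[t0 t1].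
  rewrite opprD addrA [d]splitr (le_lt_trans (ler_normB _ _))// ltrD//.
  by rewrite normrZ ger0_norm// (le_lt_trans _ hk)// ler_piMl.
have : \forall p \near (z0, (0 : V)), ball z0 (d / 2) p.1 /\ ball (0 : V) (d / 2) p.2.
  exists (ball z0 (d / 2), ball 0 (d / 2)); last by move=> [].
  by split; apply: nbhsx_ballx; rewrite divr_gt0.
apply: filterS => -[z k] /= [hz hk].
have dz (t : R) : 0 <= t <= 1 -> differentiable f (z + t *: k).
  by move=> t01; have [] := hd _ (hb z k t hz hk t01).
have dphi (t : R) : t \in `]0, 1[ ->
    is_derive t 1 (fun s => f (z + s *: k)) ('D_k f (z + t *: k)).
  rewrite in_itv /= => /andP[t0 t1]; apply: is_derive_line.
  by apply: diff_derivable; apply: dz; rewrite !ltW.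
have cphi : {within `[0, 1], continuous (fun s : R => f (z + s *: k))}.
  apply: continuous_in_subspaceT => t; rewrite inE /= in_itv /= => t01.
  apply: (is_derive_continuous (df := 'D_k f (z + t *: k))).
  by apply: is_derive_line; apply: diff_derivable; exact: dz.
have [t t01] := MVT ltr01 dphi cphi.
rewrite scale1r scale0r addr0 subr0 mulr1 => ->.
have {}t01 : 0 <= t <= 1 by move: t01; rewrite in_itv /= => /andP[? ?]; rewrite !ltW.
have z01 : 0 <= (0 : R) <= 1 by rewrite lexx ler01.
have [_ h1] := hd _ (hb z k t hz hk t01).
have := hd _ (hb z k 0 hz hk z01); rewrite scale0r addr0 => -[dfz h2].
rewrite !derive_lincomb//; last exact: dz.
have -> : lincomb (fun a => partial a f (z + t *: k)) k
    - lincomb (fun a => partial a f z) k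
    = lincomb (fun a => partial a f (z + t *: k) - partial a f z) k.
  by rewrite /lincomb -sumrB; apply: eq_bigr => a _; rewrite mulrBr.
apply: le_trans (lincomb_le (e := e' * 2) _ _) _.
  move=> a; have := h1 a; have := h2 a; rewrite !ler_distl => /andP[? ?] /andP[? ?].
  by apply/andP; split; lra.
rewrite le_eqVlt; apply/orP; left; apply/eqP.
have : n.+1%:R != 0 :> R by rewrite pnatr_eq0.
by rewrite /e'; move: (n.+1%:R : R) => N N0; field.
Qed.
End RowVectors.
End Differentials.

(** * Transport in a flat potential *)

Section FlatTransport.
Variables (R : realType) (n m : nat).
Local Notation V := 'rV[R]_n.+1.
Implicit Type Gam : V -> 'I_n.+1 -> 'M[R]_m.

Lemma entryD (p q : nat) (X Y : 'M[R]_(p, q)) i j : (X + Y) i j = X i j + Y i j.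
Proof. by rewrite mxE. Qed.

Lemma entryN (p q : nat) (X : 'M[R]_(p, q)) i j : (- X) i j = - X i j.
Proof. by rewrite mxE. Qed.

Lemma entryZ (p q : nat) (k : R) (X : 'M[R]_(p, q)) i j : (k *: X) i j = k * X i j.
Proof. by rewrite mxE. Qed.

Definition entryE := (entryD, entryN, entryZ).

Definition conn_form Gam (x h : V) : 'M[R]_m :=
  \matrix_(i, j) lincomb (fun a => Gam x a i j) h.

Lemma conn_formE Gam x h : conn_form Gam x h = \sum_a h ord0 a *: Gam x a.
Proof.
apply/matrixP => i j; rewrite !mxE summxE; apply: eq_bigr => a _.
by rewrite mxE.
Qed.

Lemma conn_formD Gam x h k :
  conn_form Gam x (h + k) = conn_form Gam x h + conn_form Gam x k.
Proof. by apply/matrixP => i j; rewrite !mxE linearD. Qed.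

(* Integrability conditions of the total differential system dP = P Gam. *)
Definition flat_potential (B : set V) Gam : Prop :=
  [/\ forall x a i j, B x -> differentiable (fun z => Gam z a i j) x,
      forall x a b i j, B x ->
        {for x, continuous (partial b (fun z => Gam z a i j))}
    & forall x a b i j, B x ->
        partial a (fun z => Gam z b i j) x - partial b (fun z => Gam z a i j) x
        + (Gam x a *m Gam x b - Gam x b *m Gam x a) i j = 0].

Lemma flat_potentialW (B C : set V) Gam :
  C `<=` B -> flat_potential B Gam -> flat_potential C Gam.
Proof. by move=> CB [d c f]; split=> *; [apply: d|apply: c|apply: f]; exact: CB. Qed.

Lemma is_derive_conn_form Gam x h k i j :
  (forall a i j, differentiable (fun z => Gam z a i j) x) ->
  is_derive x k (fun z => conn_form Gam z h i j)
    (\sum_a h ord0 a * 'D_k (fun z => Gam z a i j) x).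
Proof.
move=> dG.
have -> : (fun z => conn_form Gam z h i j)
    = (fun z => \sum_a h ord0 a * Gam z a i j).
  by apply/funext => z; rewrite mxE.
apply: is_derive_bigsum => a.
have dk : derivable (fun z => Gam z a i j) x k by apply: diff_derivable.
have := is_derive_mul (is_derive_cst (h ord0 a) x k) (derivableP dk).
by rewrite mul0r add0r.
Qed.

Lemma differentiable_conn_form Gam x h i j :
  (forall a i j, differentiable (fun z => Gam z a i j) x) ->
  differentiable (fun z => conn_form Gam z h i j) x.
Proof.
move=> dG.
have -> : (fun z => conn_form Gam z h i j)
    = \sum_a (fun z => h ord0 a * Gam z a i j).
  by apply/funext => z; rewrite mxE fct_sumE.
by apply: differentiable_sum => a; apply: differentiableM.
Qed.

(** Bilinearity carries the vanishing of the curvature from pairs of basis directions to arbitrary h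
    and v. *)
Lemma flat_conn_form Gam (x h v : V) i j :
  (forall a i j, differentiable (fun z => Gam z a i j) x) ->
  (forall a b i j,
     partial a (fun z => Gam z b i j) x - partial b (fun z => Gam z a i j) x
     + (Gam x a *m Gam x b - Gam x b *m Gam x a) i j = 0) ->
  'D_h (fun z => conn_form Gam z v i j) x - 'D_v (fun z => conn_form Gam z h i j) x
  + (conn_form Gam x h *m conn_form Gam x v
     - conn_form Gam x v *m conn_form Gam x h) i j = 0.
Proof.
move=> dG flat.
have dE (u w : V) : 'D_u (fun z => conn_form Gam z w i j) x
    = \sum_a \sum_b u ord0 a * w ord0 b * partial a (fun z => Gam z b i j) x.
  have [_ ->] := is_derive_conn_form w u i j dG.
  rewrite exchange_big /=; apply: eq_bigr => b _.
  rewrite derive_lincomb// /lincomb mulr_sumr; apply: eq_bigr => a _.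
  by rewrite mulrA [X in X * _]mulrC.
have mE (u w : V) : (conn_form Gam x u *m conn_form Gam x w) i j
    = \sum_a \sum_b u ord0 a * w ord0 b * (Gam x a *m Gam x b) i j.
  rewrite !conn_formE mulmx_suml summxE; apply: eq_bigr => a _.
  rewrite mulmx_sumr summxE; apply: eq_bigr => b _.
  by rewrite -scalemxAl -scalemxAr scalerA mxE.
rewrite !entryE !dE !mE.
rewrite [X in _ - X + _]exchange_big [X in _ + (_ - X)]exchange_big /=.
rewrite -!sumrB -big_split /= big1// => a _.
rewrite -!sumrB -big_split /= big1// => b _.
have := flat a b i j; rewrite !entryE => h0.
rewrite [v ord0 b * _]mulrC -!mulrBr -mulrDr.
by rewrite h0 mulr0.
Qed.

(* If X and Y are the transports along v and v + h from the same point, then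
   Y - X (1 + s Gam(h)) solves the transport equation along v + h with source
   X *m defect; flatness cancels the terms of defect that are linear in h. *)
Definition defect Gam (z v h : V) (s : R) : 'M[R]_m :=
  conn_form Gam (z + s *: h) (v + h)
  + s *: (conn_form Gam z h *m conn_form Gam (z + s *: h) (v + h))
  - conn_form Gam z v - s *: (conn_form Gam z v *m conn_form Gam z h)
  - conn_form Gam z h
  - s *: (\matrix_(i, j) 'D_v (fun y => conn_form Gam y h i j) z).

Lemma conn_form_le Gam z h C i j : (forall a, `|Gam z a i j| <= C) ->
  `|conn_form Gam z h i j| <= n.+1%:R * (`|h| * C).
Proof. by move=> bC; rewrite mxE; exact: lincomb_le. Qed.

Lemma conn_formB_le Gam z y h C i j : (forall a, `|Gam z a i j - Gam y a i j| <= C) ->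
  `|conn_form Gam z h i j - conn_form Gam y h i j| <= n.+1%:R * (`|h| * C).
Proof.
move=> bC; have -> : conn_form Gam z h i j - conn_form Gam y h i j
   = lincomb (fun a => Gam z a i j - Gam y a i j) h.
  by rewrite !mxE -sumrB; apply: eq_bigr => a _; rewrite mulrBr.
exact: lincomb_le.
Qed.

Lemma conn_form_increment_le Gam (z y v h : V) (e C : R) i j :
  0 <= e <= 1 -> `|h| <= e ->
  (forall a i j, `|Gam z a i j| <= C) ->
  (forall a i j, `|Gam y a i j - Gam z a i j| <= e) ->
  `|conn_form Gam y (v + h) i j - conn_form Gam z v i j|
    <= e * (n.+1%:R * `|v| + n.+1%:R * (C + 1)).
Proof.
move=> /andP[e0 e1] he bC be.
have C0 : 0 <= C by apply: le_trans (bC ord0 i j).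
set N := n.+1%:R : R.
have -> : conn_form Gam y (v + h) i j - conn_form Gam z v i j
  = (conn_form Gam y v i j - conn_form Gam z v i j)
    + conn_form Gam y h i j.
  by rewrite conn_formD !entryE; ring.
rewrite (le_trans (ler_normD _ _))//.
have h1 := conn_formB_le v (C := e) (fun a => be a i j).
have h2 : `|conn_form Gam y h i j| <= N * (`|h| * (C + 1)).
  apply: conn_form_le => a; have := be a i j; have := bC a i j.
  rewrite !ler_norml => /andP[? ?] /andP[? ?]; apply/andP; split; lra.
rewrite (le_trans (lerD h1 h2))// [leRHS]mulrDr; apply: lerD.
  by rewrite le_eqVlt; apply/orP; left; apply/eqP; rewrite -/N; ring.
by rewrite mulrCA ler_wpM2r// mulr_ge0// addr_ge0.
Qed.

(** Flatness trades D_v Gam(h) + Gam(v) Gam(h) for D_h Gam(v) + Gam(h) Gam(v). Three small terms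
    remain: the first-order remainder of Gam(v) along s h, the increment of Gam(h), and s Gam(h)
    times the increment of the generator. *)
Lemma defect_le Gam (z v h : V) (s e C : R) :
  0 <= s <= 1 -> 0 <= e <= 1 -> `|h| <= e ->
  (forall a i j, differentiable (fun z => Gam z a i j) z) ->
  (forall a b i j,
     partial a (fun z => Gam z b i j) z - partial b (fun z => Gam z a i j) z
     + (Gam z a *m Gam z b - Gam z b *m Gam z a) i j = 0) ->
  (forall a i j, `|Gam z a i j| <= C) ->
  (forall a i j, `|Gam (z + s *: h) a i j - Gam z a i j| <= e) ->
  (forall a i j, `|Gam (z + s *: h) a i j - Gam z a i j
     - 'D_(s *: h) (fun y => Gam y a i j) z| <= e * `|s *: h|) ->
  forall i j, `|defect Gam z v h s i j|
    <= e * `|h| * (n.+1%:R * `|v| + n.+1%:R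
        + m%:R * n.+1%:R * C * (n.+1%:R * `|v| + n.+1%:R * (C + 1))).
Proof.
move=> /andP[s0 s1] /andP[e0 e1] he dG flat bC be bD i j.
set N := n.+1%:R : R.
pose A1 := conn_form Gam (z + s *: h) (v + h).
have N0 : 0 <= N by [].
have C0 : 0 <= C by apply: le_trans (bC ord0 i j).
have -> : defect Gam z v h s i j =
    (conn_form Gam (z + s *: h) v i j - conn_form Gam z v i j
      - s * 'D_h (fun y => conn_form Gam y v i j) z)
    + (conn_form Gam (z + s *: h) h i j - conn_form Gam z h i j)
    + s * (conn_form Gam z h *m (A1 - conn_form Gam z v)) i j.
  have := flat_conn_form h v i j dG flat.
  have mE : (\matrix_(k, l) 'D_v (fun y => conn_form Gam y h k l) z) i j
      = 'D_v (fun y => conn_form Gam y h i j) z by rewrite mxE.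
  rewrite /defect mulmxBr -/A1 !entryE {}mE => fl.
  have -> : A1 i j = conn_form Gam (z + s *: h) v i j + conn_form Gam (z + s *: h) h i j.
    by rewrite /A1 conn_formD entryD.
  apply/eqP; rewrite -subr_eq0; apply/eqP; rewrite -[RHS](mulr0 s) -[in RHS]fl. ring.
have p1 : `|conn_form Gam (z + s *: h) v i j - conn_form Gam z v i j
      - s * 'D_h (fun y => conn_form Gam y v i j) z| <= e * `|h| * (N * `|v|).
  have [_ ->] := is_derive_conn_form v h i j dG.
  have -> : conn_form Gam (z + s *: h) v i j - conn_form Gam z v i j
      - s * (\sum_a v ord0 a * 'D_h (fun z0 => Gam z0 a i j) z)
    = lincomb (fun a => Gam (z + s *: h) a i j - Gam z a i j
        - 'D_(s *: h) (fun y => Gam y a i j) z) v.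
    rewrite !mxE mulr_sumr -!sumrB; apply: eq_bigr => a _.
    have -> : 'D_(s *: h) (fun y => Gam y a i j) z = s * 'D_h (fun y => Gam y a i j) z.
      by rewrite !deriveE// linearZ.
    ring.
  rewrite (le_trans (lincomb_le (e := e * `|h|) _ _))//; last first.
    by rewrite le_eqVlt; apply/orP; left; apply/eqP; rewrite -/N; ring.
  move=> a; rewrite (le_trans (bD a i j))// ler_wpM2l// normrZ ger0_norm//.
  by rewrite ler_piMl.
have p2 : `|conn_form Gam (z + s *: h) h i j - conn_form Gam z h i j|
    <= e * `|h| * N.
  rewrite (le_trans (conn_formB_le (C := e) _ _))//.
  by rewrite le_eqVlt; apply/orP; left; apply/eqP; rewrite -/N; ring.
have p3 : `|s * (conn_form Gam z h *m (A1 - conn_form Gam z v)) i j|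
    <= e * `|h| * (m%:R * N * C * (N * `|v| + N * (C + 1))).
  rewrite normrM ger0_norm// (le_trans (ler_piMl _ s1))//.
  rewrite (le_trans (mulmx_entry_le (b := N * (`|h| * C))
    (K := e * (N * `|v| + N * (C + 1))) _ _ _ _))//.
  - by move=> k l; exact: conn_form_le.
  - move=> k l.
    rewrite !entryE; apply: conn_form_increment_le => //; first exact/andP.
  - by rewrite le_eqVlt; apply/orP; left; apply/eqP; ring.
rewrite (le_trans (ler_normD _ _))// [leRHS]mulrDr; apply: lerD p3.
by rewrite (le_trans (ler_normD _ _))// [leRHS]mulrDr; exact: lerD.
Qed.
End FlatTransport.

(** * Uniform control of the defect along a segment *)

Section Transport.
Variables (R : realType) (n m : nat).
Local Notation V := 'rV[R]_n.+1.
Implicit Type Gam : V -> 'I_n.+1 -> 'M[R]_m.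

Definition convex_open (B : set V) : Prop :=
  open B /\ forall (x y : V) (t : R), B x -> B y -> 0 <= t <= 1 -> B (x + t *: (y - x)).

Lemma finite_bound (I : finType) (f : I -> R) : exists C : R, forall i, `|f i| <= C.
Proof.
exists (\sum_i `|f i|) => i; rewrite (bigD1 i)//= lerDl.
by apply: sumr_ge0.
Qed.

Lemma continuous_increment (f : V -> R) (z0 : V) (e : R) : {for z0, continuous f} ->
  0 < e -> \forall z \near z0 & k \near (0 : V), `|f (z + k) - f z| <= e.
Proof.
move=> cf e0.
have e2 : 0 < e / 2 by rewrite divr_gt0.
have h1 : \forall p \near (z0, (0 : V)), `|f z0 - f p.1| <= e / 2.
  have /cvgrPdist_le : f (p.1) @[p --> (z0, (0 : V))] --> f z0.
    by apply: (cvg_comp fst f) cf; exact: cvg_fst.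
  exact.
have h2 : \forall p \near (z0, (0 : V)), `|f z0 - f (p.1 + p.2)| <= e / 2.
  have /cvgrPdist_le : f (p.1 + p.2) @[p --> (z0, (0 : V))] --> f z0.
    apply: (cvg_comp (fun p : V * V => p.1 + p.2) f) cf.
    by have := @add_continuous V (z0, 0); rewrite /continuous_at /= addr0.
  exact.
apply: filterS2 h1 h2 => -[z k] /=; rewrite !ler_distl => /andP[? ?] /andP[? ?].
by apply/andP; split; lra.
Qed.

(** The map from (s, h) to (x + s v, s h) is continuous at (s0, 0). In this form the local estimates
    enter the compactness argument over s. *)
Lemma near_segment_point (x v : V) (s0 : R) (Q : V * V -> Prop) :
  (\forall p \near (x + s0 *: v, (0 : V)), Q p) ->
  \forall s \near s0 & h \near (0 : V), Q (x + s *: v, s *: h).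
Proof.
move=> hQ.
have : (fun sh : R * V => (x + sh.1 *: v, sh.1 *: sh.2)) @ (s0, (0 : V))
    --> (x + s0 *: v, (0 : V)).
  apply: (@cvg_pair _ _ _ (nbhs (s0, (0 : V))) (nbhs (x + s0 *: v)) (nbhs (0 : V))).
    apply: (cvgD (F := nbhs (s0, (0 : V)))); first exact: cvg_cst.
    by apply: (cvgZr_tmp (F := nbhs (s0, (0 : V)))); exact: cvg_fst.
  rewrite -[X in _ --> nbhs X](scaler0 _ s0).
  apply: (cvgZ (F := nbhs (s0, (0 : V)))); [exact: cvg_fst|exact: cvg_snd].
by move/(_ _ hQ).
Qed.

(** Near each s0 the hypotheses of [defect_le] hold with a small constant; compactness of [0, 1]
    makes the neighbourhood of h = 0 independent of s. The second bound later controls the generator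
    along the displaced segment. *)
Lemma defect_uniform (B : set V) Gam (x y : V) (e : R) :
  convex_open B -> flat_potential B Gam -> B x -> B y -> 0 < e ->
  \forall h \near (0 : V), forall s, 0 <= s <= 1 -> forall i j,
    `|defect Gam (x + s *: (y - x)) (y - x) h s i j| <= e * `|h| /\
    `|conn_form Gam (x + s *: (y - x) + s *: h) (y - x + h) i j
      - conn_form Gam (x + s *: (y - x)) (y - x) i j| <= 1.
Proof.
move=> [oB cB] [dG cG flat] Bx By e0; set v := y - x.
have K : near_covering_within (`[0, 1] : set R).
  by apply/near_covering_withinP/compact_near_coveringP; exact: segment_compact.
have := K V (nbhs (0 : V)) (fun h s => forall i j,
    `|defect Gam (x + s *: v) v h s i j| <= e * `|h| /\
    `|conn_form Gam (x + s *: v + s *: h) (v + h) i j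
      - conn_form Gam (x + s *: v) v i j| <= 1) _.
suff H : forall s0 : R, s0 \in `[0, 1] -> \forall s \near s0 & h \near (0 : V),
    s \in `[0, 1] -> forall i j, `|defect Gam (x + s *: v) v h s i j| <= e * `|h| /\
    `|conn_form Gam (x + s *: v + s *: h) (v + h) i j
      - conn_form Gam (x + s *: v) v i j| <= 1.
  move=> /(_ (nbhs_filter _) H); apply: filterS => h hh s s01.
  by apply: hh; rewrite /= in_itv.
move=> s0; rewrite in_itv /= => s01.
set z0 := x + s0 *: v.
have Bz0 : B z0 by exact: cB.
have nB : \forall z \near z0, B z by apply: open_nbhs_nbhs.
have [C hC] := finite_bound (fun aij : 'I_n.+1 * 'I_m * 'I_m => Gam z0 aij.1.1 aij.1.2 aij.2).
(* [Q] and [Q'] are the constants of [defect_le] and [conn_form_increment_le] for the bound C + 1,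
   valid for Gam near z0. *)
pose Q := n.+1%:R * `|v| + n.+1%:R
  + m%:R * n.+1%:R * (C + 1) * (n.+1%:R * `|v| + n.+1%:R * (C + 1 + 1)).
pose Q' := n.+1%:R * `|v| + n.+1%:R * (C + 1 + 1).
(* Chosen so that d <= 1, d Q' <= 1 and d Q <= e; the absolute values and the + 1 keep the
   denominators positive. *)
pose d := Num.min (Num.min 1 (`|Q'| + 1)^-1) (e / (`|Q| + 1)).
have Q'1 : 0 < `|Q'| + 1 by rewrite ltr_wpDl.
have Q1 : 0 < `|Q| + 1 by rewrite ltr_wpDl.
have d0 : 0 < d by rewrite !lt_min ltr01 invr_gt0 Q'1 divr_gt0.
have d1 : d <= 1 by rewrite !ge_min lexx.
have dQ' : d * Q' <= 1.
  apply: (@le_trans _ _ (d * (`|Q'| + 1))).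
    by rewrite ler_wpM2l ?(ltW d0)// (le_trans (ler_norm Q'))// lerDl.
  by rewrite -ler_pdivlMr// div1r /d !ge_min lexx orbT.
have dQ : d * Q <= e.
  apply: (@le_trans _ _ (e / (`|Q| + 1) * (`|Q| + 1))); last by rewrite divfK ?gt_eqF.
  apply: (@le_trans _ _ (d * (`|Q| + 1))).
    by rewrite ler_wpM2l ?(ltW d0)// (le_trans (ler_norm Q))// lerDl.
  by rewrite ler_wpM2r ?(ltW Q1)// /d ge_min lexx orbT.
have n1 : \forall p \near (z0, (0 : V)), B p.1 /\ forall a i j, `|Gam p.1 a i j| <= C + 1.
  have n1 : \forall z \near z0, B z /\ forall aij : 'I_n.+1 * 'I_m * 'I_m,
      `|Gam z aij.1.1 aij.1.2 aij.2| <= C + 1.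
    apply: filterI => //.
    apply: (@filter_forall _ _ _ (nbhs z0) (nbhs_filter _)) => -[[a i] j] /=.
    have /cvgrPdist_le/(_ _ ltr01) := differentiable_continuous (dG z0 a i j Bz0).
    apply: filterS => z; have := hC ((a, i), j) => /=.
    rewrite ler_distl !ler_norml => /andP[? ?] /andP[? ?].
    by apply/andP; split; lra.
  have n1' : \forall p \near (z0, (0 : V)), B p.1 /\ forall aij : 'I_n.+1 * 'I_m * 'I_m,
      `|Gam p.1 aij.1.1 aij.1.2 aij.2| <= C + 1.
    exact: (cvg_fst (F := nbhs z0) (G := nbhs (0 : V)) n1).
  by apply: filterS n1' => p [h1 h2]; split=> // a i j; exact: (h2 ((a, i), j)).
have n2 : \forall p \near (z0, (0 : V)), forall aij : 'I_n.+1 * 'I_m * 'I_m,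
    `|Gam (p.1 + p.2) aij.1.1 aij.1.2 aij.2 - Gam p.1 aij.1.1 aij.1.2 aij.2| <= d.
  apply: (@filter_forall _ _ _ (nbhs (z0, (0 : V))) (nbhs_filter _)) => -[[a i] j] /=.
  apply: (continuous_increment (f := fun z => Gam z a i j)) => //.
  exact: differentiable_continuous (dG z0 a i j Bz0).
have n3 : \forall p \near (z0, (0 : V)), forall aij : 'I_n.+1 * 'I_m * 'I_m,
    `|Gam (p.1 + p.2) aij.1.1 aij.1.2 aij.2 - Gam p.1 aij.1.1 aij.1.2 aij.2
      - 'D_(p.2) (fun z => Gam z aij.1.1 aij.1.2 aij.2) p.1| <= d * `|p.2|.
  apply: (@filter_forall _ _ _ (nbhs (z0, (0 : V))) (nbhs_filter _)) => -[[a i] j] /=.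
  apply: (strict_differentiable (f := fun z => Gam z a i j)) => //.
    by apply: filterS nB => z; exact: dG.
  by move=> b; exact: cG.
have n4 : \forall s \near s0 & h \near (0 : V), `|h| <= d.
  have : \forall h \near (0 : V), `|h| <= d.
    by apply: filterS (nbhs0_le d0).
  by move=> n4; have := cvg_snd (F := nbhs s0) (G := nbhs (0 : V)) n4; exact.
have n5 := near_segment_point (@filterI _ _ (nbhs_filter _) _ _ n1
  (@filterI _ _ (nbhs_filter _) _ _ n2 n3)).
apply: (@filterS2 _ (filter_prod (nbhs s0) (nbhs (0 : V))) _ _ _ _ _ n4 n5).
move=> -[s h] /= hd [[Bz b1] [b2 b3]].
rewrite in_itv /= => hs i j.
have d01 : 0 <= d <= 1 by rewrite (ltW d0) d1.
split; last first.
  apply: le_trans (conn_form_increment_le (e := d) (C := C + 1) _ _ _ _ _ _ _) dQ' => //.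
  by move=> a k l; exact: (b2 ((a, k), l)).
apply: le_trans (defect_le (e := d) (C := C + 1) _ hs _ hd _ _ _ _ _ _ _) _ => //.
- by move=> *; exact: dG.
- by move=> *; exact: flat.
- by move=> a k l; exact: (b2 ((a, k), l)).
- by move=> a k l; exact: (b3 ((a, k), l)).
- by rewrite -/Q mulrAC ler_wpM2r.
Qed.
End Transport.

(** * Transport along segments and its dependence on the end point *)

Section TransportFun.
Variables (R : realType) (n m : nat).
Local Notation V := 'rV[R]_n.+1.
Implicit Type Gam : V -> 'I_n.+1 -> 'M[R]_m.

Lemma is_derive_mulmx (U : normedModType R) (p q r : nat) (X : U -> 'M[R]_(p, q))
    (Y : U -> 'M[R]_(q, r)) (x v : U) (dX : 'M[R]_(p, q)) (dY : 'M[R]_(q, r)) :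
  (forall i j, is_derive x v (fun t => X t i j) (dX i j)) ->
  (forall i j, is_derive x v (fun t => Y t i j) (dY i j)) ->
  forall i j, is_derive x v (fun t => (X t *m Y t) i j)
    ((dX *m Y x + X x *m dY) i j).
Proof.
move=> hX hY i j.
have -> : (fun t => (X t *m Y t) i j) = (fun t => \sum_l X t i l * Y t l j).
  by apply/funext => t; rewrite mxE.
have -> : (dX *m Y x + X x *m dY) i j
    = \sum_l (dX i l * Y x l j + X x i l * dY l j).
  by rewrite !mxE -big_split.
by apply: is_derive_bigsum => l; apply: is_derive_mul.
Qed.

(** The difference solves the same equation from 0 without source, so [gronwall] with c = 0
    annihilates it. *)
Lemma ode_unique (p : nat) (A : R -> 'M[R]_m) (X Y : R -> 'M[R]_(p, m)) :
  (forall s : R, 0 <= s <= 1 ->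
     forall i j, {for s, continuous (fun t => A t i j)}) ->
  (forall s : R, 0 <= s <= 1 ->
     forall i j, {for s, continuous (fun t => X t i j)}) ->
  (forall s : R, 0 <= s <= 1 ->
     forall i j, {for s, continuous (fun t => Y t i j)}) ->
  (forall s : R, 0 < s < 1 -> forall i j,
     is_derive s 1 (fun t => X t i j) ((X s *m A s) i j)) ->
  (forall s : R, 0 < s < 1 -> forall i j,
     is_derive s 1 (fun t => Y t i j) ((Y s *m A s) i j)) ->
  X 0 = Y 0 -> X 1 = Y 1.
Proof.
move=> cA cX cY dX dY XY0.
have [K K0 bA] := bounded_unit_itv
  (fun ij : 'I_m * 'I_m => fun s hs => cA s hs ij.1 ij.2).
have := @gronwall R p m K 0 (fun t => X t - Y t) (fun=> 0) A K0 (lexx _).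
have c1 : forall s : R, 0 <= s <= 1 ->
     forall i j, {for s, continuous (fun t => (X t - Y t) i j)}.
  move=> s s01 i j.
  have -> : (fun t => (X t - Y t) i j) = (fun t => X t i j - Y t i j).
    by apply/funext => t; rewrite !entryE.
  by apply: cvgB; [exact: cX|exact: cY].
have d1 : forall s : R, 0 < s < 1 -> forall i j,
     is_derive s 1 (fun t => (X t - Y t) i j) (((X s - Y s) *m A s + 0) i j).
  move=> s s01 i j.
  have -> : (fun t => (X t - Y t) i j) = (fun t => X t i j - Y t i j).
    by apply/funext => t; rewrite !entryE.
  by rewrite addr0 mulmxBl !entryE; apply: is_deriveB; [exact: dX|exact: dY].
move=> /(_ c1 d1); rewrite XY0 subrr => H.
have z01 : 0 <= (1 : R) <= 1 by rewrite ler01 lexx.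
apply/matrixP => i j; apply/eqP; rewrite -subr_eq0 -normr_le0.
have := H _ _ erefl 1 z01 i j; rewrite mul0r !entryE; apply.
- by move=> s /andP[s0 s1] k l; apply: (bA (k, l)); rewrite !ltW.
- by move=> s _ k l; rewrite mxE normr0.
Qed.

Definition is_transport Gam (x v : V) (X : R -> 'M[R]_m) : Prop :=
  [/\ X 0 = 1%:M, forall i j, continuous (fun t => X t i j)
    & forall s : R, 0 < s < 1 -> forall i j,
        is_derive s 1 (fun t => X t i j) ((X s *m conn_form Gam (x + s *: v) v) i j)].

(** The generator multiplies on the right, so transports compose in the order in which the path
    runs. The identity is only the default of [xget], taken when no solution exists. *)
Definition transport Gam (x y : V) : 'M[R]_m :=
  xget 1%:M [set P | exists X, is_transport Gam x (y - x) X /\ P = X 1].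

Lemma continuous_on_line (f : V -> R) (x v : V) (s : R) :
  {for x + s *: v, continuous f} -> {for s, continuous (fun t : R => f (x + t *: v))}.
Proof.
move=> cf; apply: (continuous_comp (f := fun t : R => x + t *: v)) cf.
apply: (cvgD (F := nbhs s)); first exact: cvg_cst.
exact: scalel_continuous.
Qed.

Section InConvex.
Variables (B : set V) (Gam : V -> 'I_n.+1 -> 'M[R]_m).
Hypotheses (cvxB : convex_open B) (flatB : flat_potential B Gam).

Lemma continuous_conn_form_line (x y h : V) (s : R) i j : B x -> B y -> 0 <= s <= 1 ->
  {for s, continuous (fun t : R => conn_form Gam (x + t *: (y - x)) h i j)}.
Proof.
move=> Bx By s01; apply: (continuous_on_line (f := fun z => conn_form Gam z h i j)).
apply: differentiable_continuous; apply: differentiable_conn_form => a k l.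
have [dG _ _] := flatB; have [_ cvx] := cvxB; apply: dG; exact: cvx.
Qed.

Lemma transport_exists x y : B x -> B y ->
  exists X, is_transport Gam x (y - x) X /\ transport Gam x y = X 1.
Proof.
move=> Bx By.
have [|X [X0 cX dX]] := @linear_ode R m m
  (fun s => conn_form Gam (x + s *: (y - x)) (y - x)) 1%:M.
  by move=> s s01 i j; exact: continuous_conn_form_line.
rewrite /transport; case: xgetP => [P _ [Y [hY ->]]|/(_ (X 1)) []]; first by exists Y.
by exists X.
Qed.

(** By linearity, P0 times the fundamental solution solves the same initial value problem as Y. *)
Lemma transport_unique x y (p : nat) (P0 : 'M[R]_(p, m)) (Y : R -> 'M[R]_(p, m)) :
  B x -> B y -> Y 0 = P0 ->
  (forall s : R, 0 <= s <= 1 ->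
     forall i j, {for s, continuous (fun t => Y t i j)}) ->
  (forall s : R, 0 < s < 1 -> forall i j,
        is_derive s 1 (fun t => Y t i j)
          ((Y s *m conn_form Gam (x + s *: (y - x)) (y - x)) i j)) ->
  Y 1 = P0 *m transport Gam x y.
Proof.
move=> Bx By Y0 cY dY; have [X [[X0 cX dX] ->]] := transport_exists Bx By.
have dPX (s : R) i j : is_derive s 1 (fun=> P0 i j) ((0 : 'M[R]_(p, m)) i j).
  by rewrite mxE; exact: is_derive_cst.
apply: (@ode_unique p (fun s => conn_form Gam (x + s *: (y - x)) (y - x)) Y
  (fun t => P0 *m X t)) => //.
- by move=> s s01 i j; exact: continuous_conn_form_line.
- move=> s s01 i j.
  have -> : (fun t => (P0 *m X t) i j) = (fun t => \sum_l P0 i l * X t l j).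
    by apply/funext => t; rewrite mxE.
  by apply: cvg_bigsum => l; apply: cvgM; [exact: cvg_cst|exact: cX].
- move=> s s01 i j; have := is_derive_mulmx (dPX s) (dX s s01) i j.
  by rewrite mul0mx add0r mulmxA.
- by rewrite Y0 X0 mulmx1.
Qed.

Lemma transport_refl x : B x -> transport Gam x x = 1%:M.
Proof.
move=> Bx; rewrite -[LHS]mul1mx; symmetry.
apply: (transport_unique (Y := fun=> 1%:M)) => //.
- by move=> *; exact: cvg_cst.
- move=> s _ i j; rewrite mul1mx subrr.
  have -> : conn_form Gam (x + s *: 0) 0 i j = 0 by rewrite mxE linear0.
  exact: is_derive_cst.
Qed.

(** The candidate for T x (y + h) is T x y (1 + Gam_y(h)), the ansatz at s = 1. The error E starts
    at 0 and has a source of order e' |h|, so [gronwall] makes it of order e |h|. *)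
Lemma transport_differentiable x y i j : B x -> B y ->
  differentiable (fun z => transport Gam x z i j) y /\
  'd (fun z => transport Gam x z i j) y
    = lincomb (fun a => (transport Gam x y *m Gam y a) i j) :> (V -> R).
Proof.
move=> Bx By; have [oB cvx] := cvxB; have [dG cG flat] := flatB.
apply: differentiable_from_le; first exact: continuous_lincomb.
move=> e e0; set v := y - x.
have [X [[X0 cX dX] TX]] := transport_exists Bx By.
have [K K0 bK] : exists2 K : R, 0 <= K & forall ij s, 0 <= s <= 1 ->
    `|conn_form Gam (x + s *: v) v ij.1 ij.2| <= K.
  by apply: bounded_unit_itv => -[k l] s s01; exact: continuous_conn_form_line.
have [C C0 bC] : exists2 C : R, 0 <= C & forall ij s, 0 <= s <= 1 ->
    `|X s ij.1 ij.2| <= C.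
  by apply: bounded_unit_itv => -[k l] s s01; exact: cX.
pose D := (m * m)%:R * expR (m%:R * (K + 1) *+ 2 + 1) + 1.
have D0 : 0 < D by rewrite ltr_wpDl// mulr_ge0// expR_ge0.
(* D is the constant of [gronwall] for generators bounded by K + 1, and the source is at most m C e'
   |h|; hence this choice makes the error at most e |h|. *)
pose e' := e / ((m%:R * C + 1) * D).
have mC0 : 0 < m%:R * C + 1 by rewrite ltr_wpDl// mulr_ge0.
have e'0 : 0 < e' by rewrite divr_gt0// mulr_gt0.
have nB : \forall h \near (0 : V), B (h + y).
  have /nbhs_ballP[d d0 hd] : nbhs y B by apply: open_nbhs_nbhs.
  apply/nbhs_ballP; exists d => // h; rewrite -ball_normE /= sub0r normrN => hh.
  by apply: hd; rewrite -ball_normE /= opprD addrCA subrr addr0 normrN.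
have := defect_uniform cvxB flatB Bx By e'0.
apply: filterS2 nB => h Bh hd.
have [Y [[Y0 cY dY] TY]] := transport_exists Bx Bh.
have vh : h + y - x = v + h by rewrite /v -addrA addrC.
rewrite {}vh in dY.
pose G (s : R) := conn_form Gam (x + s *: v) h.
pose E (s : R) := Y s - X s *m (1%:M + s *: G s).
pose A (s : R) := conn_form Gam (x + s *: (v + h)) (v + h).
pose F (s : R) := X s *m defect Gam (x + s *: v) v h s.
have xE (s : R) : x + s *: v + s *: h = x + s *: (v + h) by rewrite -addrA -scalerDr.
have cG' (s : R) : 0 <= s <= 1 -> forall k l, {for s, continuous (fun t => G t k l)}.
  by move=> s01 k l; exact: continuous_conn_form_line.
have cE (s : R) : 0 <= s <= 1 -> forall k l, {for s, continuous (fun t => E t k l)}.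
  move=> s01 k l.
  have -> : (fun t => E t k l) = (fun t => Y t k l
      - \sum_r X t k r * ((1%:M : 'M[R]_m) r l + t * G t r l)).
    apply/funext => t; rewrite /E !entryE [X in _ - X]mxE; congr (_ - _).
    by apply: eq_bigr => r _; rewrite !entryE.
  apply: cvgB; first exact: cY.
  apply: cvg_bigsum => r; apply: cvgM; first exact: cX.
  apply: cvgD; first exact: cvg_cst.
  by apply: cvgM; [exact: cvg_id|exact: cG'].
have dE (s : R) : 0 < s < 1 -> forall k l,
    is_derive s 1 (fun t => E t k l) ((E s *m A s + F s) k l).
  move=> s01 k l.
  have s01' : 0 <= s <= 1 by case/andP: s01 => ? ?; rewrite !ltW.
  pose H := \matrix_(p, q) 'D_v (fun z => conn_form Gam z h p q) (x + s *: v).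
  have dGs p q : is_derive s 1 (fun t => (1%:M + t *: G t) p q) ((G s + s *: H) p q).
    have -> : (fun t => (1%:M + t *: G t) p q)
        = (fun t => (1%:M : 'M[R]_m) p q + t * G t p q).
      by apply/funext => t; rewrite !entryE.
    have dl : is_derive s 1 (fun t => G t p q) (H p q).
      rewrite mxE; apply: is_derive_line; apply: diff_derivable.
      by apply: differentiable_conn_form => a i' j'; apply: dG; exact: cvx.
    have := is_deriveD (is_derive_cst ((1%:M : 'M[R]_m) p q) s 1)
      (is_derive_mul (is_derive_id s 1) dl).
    by rewrite add0r mul1r !entryE.
  have dXG := is_derive_mulmx (dX s s01) dGs k l.
  have := is_deriveB (dY s s01 k l) dXG.
  have -> : E s *m A s + F s = Y s *m A s
      - (X s *m conn_form Gam (x + s *: v) v *m (1%:M + s *: G s)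
         + X s *m (G s + s *: H)).
    rewrite /E /F /defect xE -/(A s) -/(G s) -/H.
    rewrite mulmxBl -addrA; congr (_ + _).
    rewrite -!mulmxA -mulmxDr -[- (X s *m _)]mulmxN -[- (X s *m _)]mulmxN -mulmxDr.
    congr (_ *m _).
    have e1 : (1%:M + s *: G s) *m A s = A s + s *: (G s *m A s).
      by rewrite mulmxDl mul1mx scalemxAl.
    have e2 : conn_form Gam (x + s *: v) v *m (1%:M + s *: G s)
        = conn_form Gam (x + s *: v) v + s *: (conn_form Gam (x + s *: v) v *m G s).
      by rewrite mulmxDr mulmx1 -scalemxAr.
    by rewrite e1 e2; apply/matrixP => p q; rewrite !entryE; ring.
  have -> : (fun t => E t k l)
      = (fun t => Y t k l) - (fun t => (X t *m (1%:M + t *: G t)) k l).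
    by apply/funext => t; rewrite /E !entryE.
  by rewrite !entryE.
have bA (s : R) : 0 < s < 1 -> forall k l, `|A s k l| <= K + 1.
  move=> /andP[s0 s1] k l.
  have s01 : 0 <= s <= 1 by rewrite !ltW.
  have [_] := hd s s01 k l; rewrite xE -/(A s) => hA.
  have := bK (k, l) s s01; move: hA => /=.
  by rewrite ler_distl !ler_norml => /andP[? ?] /andP[? ?]; apply/andP; split; lra.
have bF (s : R) : 0 < s < 1 -> forall k l, `|F s k l| <= m%:R * (C * (e' * `|h|)).
  move=> /andP[s0 s1] k l; have s01 : 0 <= s <= 1 by rewrite !ltW.
  apply: mulmx_entry_le => p q; first exact: (bC (p, q)).
  by have [] := hd s s01 p q.
have E0 : E 0 = 0 by rewrite /E Y0 X0 mul1mx scale0r addr0 subrr.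
have z01 : 0 <= (1 : R) <= 1 by rewrite ler01 lexx.
have c0 : 0 <= m%:R * (C * (e' * `|h|)) by rewrite mulr_ge0// mulr_ge0// mulr_ge0// ltW.
have := @gronwall R m m (K + 1) _ E F A (addr_ge0 K0 ler01) c0 cE dE bA bF E0 1 z01 i j.
rewrite -/D => hE.
have -> : transport Gam x (h + y) i j
    - (transport Gam x y i j + lincomb (fun a => (transport Gam x y *m Gam y a) i j) h)
    = E 1 i j.
  rewrite TY TX /E scale1r mulmxDr mulmx1 !entryE /G /v scale1r.
  congr (_ - (_ + _)).
  rewrite addrC subrK conn_formE mulmx_sumr summxE; apply: eq_bigr => a _.
  by rewrite -scalemxAr entryE.
apply: (le_trans hE).
have -> : m%:R * (C * (e' * `|h|)) * D = (m%:R * C) * (e' * D) * `|h| by ring.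
apply: ler_wpM2r => //.
apply: (@le_trans _ _ ((m%:R * C + 1) * (e' * D))).
  by rewrite ler_wpM2r ?lerDl// ltW// mulr_gt0.
rewrite le_eqVlt; apply/orP; left; apply/eqP; rewrite /e'; field.
by rewrite !gt_eqF.
Qed.

(** By [transport_differentiable], moving the end point of T x from y to z solves the transport
    equation of that segment, with initial value T x y. *)
Lemma transport_trans x y z : B x -> B y -> B z ->
  transport Gam x y *m transport Gam y z = transport Gam x z.
Proof.
move=> Bx By Bz; have [oB cvx] := cvxB.
pose Q (s : R) := transport Gam x (y + s *: (z - y)).
have -> : transport Gam x z = Q 1 by rewrite /Q scale1r addrC subrK.
symmetry; apply: transport_unique => //.
- by rewrite /Q scale0r addr0.
- move=> s s01 i j.
  apply: (continuous_on_line (f := fun w => transport Gam x w i j)).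
  apply: differentiable_continuous.
  by have [] := transport_differentiable i j Bx (cvx y z s By Bz s01).
- move=> s /andP[s0 s1] i j; have s01 : 0 <= s <= 1 by rewrite !ltW.
  have [df e] := transport_differentiable i j Bx (cvx y z s By Bz s01).
  have := is_derive_line (diff_derivable df (v := z - y)).
  rewrite deriveE// e.
  have -> : (Q s *m conn_form Gam (y + s *: (z - y)) (z - y)) i j
     = lincomb (fun a => (Q s *m Gam (y + s *: (z - y)) a) i j) (z - y).
    rewrite conn_formE mulmx_sumr summxE; apply: eq_bigr => a _.
    by rewrite -scalemxAr entryE.
  exact.
Qed.

End InConvex.
End TransportFun.

(** * Holonomy on simply connected sets *)

Section Holonomy.
Variables (R : realType) (n m : nat).
Local Notation V := 'rV[R]_n.+1.

Lemma convex_open_ball (z : V) (r : R) : convex_open (ball z r).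
Proof.
split; first exact: ball_open.
move=> x y t; rewrite -!ball_normE /= => zx zy /andP[t0 t1].
have -> : z - (x + t *: (y - x)) = (1 - t) *: (z - x) + t *: (z - y).
  by apply/rowP => i; rewrite !mxE; ring.
rewrite (le_lt_trans (ler_normD _ _))// !normrZ !ger0_norm ?subr_ge0//.
have [->|t1'] := eqVneq t 1; first by rewrite subrr mul0r add0r mul1r.
have {}t1 : t < 1 by rewrite lt_neqAle t1'.
have h1 : (1 - t) * `|z - x| < (1 - t) * r by rewrite ltr_pM2l// subr_gt0.
have h2 : t * `|z - y| <= t * r by rewrite ler_wpM2l// ltW.
have -> : r = (1 - t) * r + t * r by ring.
exact: ltr_leD.
Qed.

Definition clamp2 (p : R * R) : R * R := (clamp p.1, clamp p.2).

(** Clamping turns continuity relative to the square into continuity on the plane, so that full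
    neighbourhoods are available at boundary points. *)
Lemma continuous_clamp2 (T : topologicalType) (H : R * R -> T) :
  {within unit_itv `*` unit_itv, continuous H} -> continuous (H \o clamp2).
Proof.
move/subspace_continuousP => cH p.
have K q : (unit_itv `*` unit_itv) (clamp2 q).
  by split; rewrite /unit_itv /= clamp_ge0 clamp_le1.
apply: (cvg_comp clamp2 H) (cH _ (K p)) => A.
rewrite /within /= => hA.
have c2 : clamp2 @ nbhs p --> clamp2 p.
  rewrite [clamp2 p in X in _ --> X]surjective_pairing.
  apply: (@cvg_pair _ _ _ (nbhs p) (nbhs (clamp p.1)) (nbhs (clamp p.2))).
    apply: (cvg_comp fst (@clamp R)) (@continuous_clamp R p.1).
    by case: (p) => a b; exact: cvg_fst.
  apply: (cvg_comp snd (@clamp R)) (@continuous_clamp R p.2).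
  by case: (p) => a b; exact: cvg_snd.
have h : \forall q \near p, (unit_itv `*` unit_itv) (clamp2 q) -> A (clamp2 q).
  exact: c2 _ hA.
by apply: (@filterS _ (nbhs p) _ _ _ _ h) => q; apply; exact: K.
Qed.

(** A Lebesgue number argument: compactness of the square yields one mesh 1 / (N + 1), and all
    corners of a grid cell at p are sent into one ball. *)
Lemma lebesgue_grid (W : set V) (H : R * R -> V) : open W -> continuous H ->
  (forall p, (unit_itv `*` unit_itv) p -> W (H p)) ->
  exists N : nat, forall p, (unit_itv `*` unit_itv) p -> exists z r,
    ball z r `<=` W /\ forall q, `|p.1 - q.1| <= N.+1%:R^-1 ->
      `|p.2 - q.2| <= N.+1%:R^-1 -> ball z r (H q).
Proof.
move=> oW cH HW.
have cK : compact (unit_itv `*` unit_itv : set (R * R)).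
  have cI : compact (unit_itv : set R).
    have -> : (unit_itv : set R) = `[0, 1]%classic.
      by apply/seteqP; split=> x; rewrite /unit_itv /= in_itv.
    exact: segment_compact.
  exact: compact_setX.
pose P (N : nat) (p : R * R) := exists z r,
    ball z r `<=` W /\ forall q, `|p.1 - q.1| <= N.+1%:R^-1 ->
      `|p.2 - q.2| <= N.+1%:R^-1 -> ball z r (H q).
have := (compact_near_coveringP _).1 cK nat \oo P _.
suff hP : forall p, (unit_itv `*` unit_itv) p ->
    \forall p' \near p & N \near \oo, P N p'.
  move=> /(_ _ hP) [N _ hN].
  by exists N => p Kp; apply: (hN N) => /=.
move=> p Kp.
have /nbhs_ballP[r r0 hr] : nbhs (H p) W by apply: open_nbhs_nbhs; split=> //; exact: HW.
have : nbhs p (fun q => ball (H p) r (H q)).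
  by apply: (cH p); apply: nbhsx_ballx.
case/nbhs_ballP => d d0 hd.
have d2 : 0 < d / 2 by rewrite divr_gt0.
have nN : \forall N \near \oo, N.+1%:R^-1 < d / 2.
  exact: near_infty_natSinv_lt (PosNum d2).
exists (ball p (d / 2), [set N | N.+1%:R^-1 < d / 2]).
  by split => //; exact: nbhsx_ballx.
move=> [[a b] N] /= [[pa pb] hN].
exists (H p), r; split=> // q h1 h2; apply: hd.
by split; apply: ball_split;
  [exact: pa|exact: le_lt_trans h1 hN|exact: pb|exact: le_lt_trans h2 hN].
Qed.
End Holonomy.

(** * Holonomy of chains of balls *)

Section ChainHolonomy.
Variables (R : realType) (n m : nat).
Local Notation V := 'rV[R]_n.+1.
Variables (W : set V) (Gam : V -> 'I_n.+1 -> 'M[R]_m).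
Hypotheses (oW : open W) (flatW : flat_potential W Gam).
Local Notation T := (transport Gam).

(** The elementary edge of a chain: its segment stays in W, and transport inside the ball is
    path-independent. *)
Definition same_ball (x y : V) : Prop :=
  exists z r, [/\ ball z r `<=` W, ball z r x & ball z r y].

Lemma same_ball_sym x y : same_ball x y -> same_ball y x.
Proof. by move=> [z [r [h1 h2 h3]]]; exists z, r. Qed.

Lemma same_ball_refl x : W x -> same_ball x x.
Proof.
move=> Wx; have /nbhs_ballP[r r0 hr] : nbhs x W by apply: open_nbhs_nbhs.
by exists x, r; split=> //; exact: ballxx.
Qed.

Lemma transportxx x : W x -> T x x = 1%:M.
Proof.
move=> /same_ball_refl[z [r [zr zx _]]].
exact: (transport_refl (convex_open_ball z r) (flat_potentialW zr flatW)).
Qed.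

Lemma transport_ball z r a b c : ball z r `<=` W -> ball z r a -> ball z r b ->
  ball z r c -> T a b *m T b c = T a c.
Proof.
move=> zr.
exact: (transport_trans (convex_open_ball z r) (flat_potentialW zr flatW)).
Qed.

Lemma transportK x y : same_ball x y -> T x y *m T y x = 1%:M.
Proof.
move=> [z [r [zr zx zy]]]; rewrite (transport_ball zr zx zy zx).
by apply: transportxx; exact: zr.
Qed.

Fixpoint holonomy (c : nat -> V) (k : nat) : 'M[R]_m :=
  if k is k'.+1 then holonomy c k' *m T (c k') (c k'.+1) else 1%:M.

Definition chain (c : nat -> V) (k : nat) : Prop :=
  forall i, (i < k)%N -> same_ball (c i) (c i.+1).

Lemma eq_holonomy c d k : (forall i, (i <= k)%N -> c i = d i) ->
  holonomy c k = holonomy d k.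
Proof.
elim: k => [//|k IH] cd.
have e : holonomy c k = holonomy d k by apply: IH => i ik; apply: cd; exact: leqW.
have := cd k (leqnSn k); have := cd k.+1 (leqnn _); rewrite /= e => -> -> //.
Qed.

Lemma holonomyD c k l :
  holonomy c (k + l) = holonomy c k *m holonomy (fun i => c (k + i)%N) l.
Proof.
elim: l => [|l IH]; first by rewrite addn0 mulmx1.
by rewrite addnS /= IH mulmxA addnS.
Qed.

Lemma holonomy_ball z r c k : ball z r `<=` W -> (forall i, (i <= k)%N -> ball z r (c i)) ->
  holonomy c k = T (c 0%N) (c k).
Proof.
move=> zr; elim: k => [|k IH] hc /=.
  by rewrite transportxx//; apply: zr; exact: hc.
rewrite IH; last by move=> i ik; apply: hc; exact: leqW.
by apply: (transport_ball zr); apply: hc.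
Qed.

Lemma holonomy_const x k : W x -> holonomy (fun=> x) k = 1%:M.
Proof. by move=> Wx; elim: k => //= k ->; rewrite mul1mx transportxx. Qed.

(** The last edge of c meets the first edge of the reversed chain in the middle of the product, and
    they cancel. *)
Lemma holonomy_rev c k : chain c k ->
  holonomy c k *m holonomy (fun i => c (k - i)%N) k = 1%:M.
Proof.
elim: k c => [|k IH] c hc; first by rewrite /= mul1mx.
rewrite -{3}[k.+1]add1n holonomyD /= mul1mx subn0 subn1 /=.
have -> : holonomy (fun i => c (k.+1 - (1 + i))%N) k = holonomy (fun i => c (k - i)%N) k.
  by apply: eq_holonomy => i _; rewrite add1n subSS.
rewrite -mulmxA [T _ _ *m (_ *m _)]mulmxA transportK; last exact: hc.
by rewrite mul1mx IH// => i ik; apply: hc; exact: leqW.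
Qed.

(* Discrete Stokes: neighbouring rows of the grid have conjugate holonomies. *)
Lemma holonomy_grid (x : nat -> nat -> V) (k l : nat) :
  (forall i j, (i < k)%N -> (j < l)%N -> exists z r, ball z r `<=` W /\
    [/\ ball z r (x i j), ball z r (x i.+1 j), ball z r (x i j.+1)
      & ball z r (x i.+1 j.+1)]) ->
  (forall i, (i <= k)%N -> x i 0%N = x 0%N 0%N) ->
  (forall i, (i <= k)%N -> x i l = x 0%N l) ->
  W (x 0%N 0%N) -> W (x 0%N l) ->
  holonomy (x 0%N) l = holonomy (x k) l.
Proof.
move=> hx x0 xl W0 Wl.
have row i : (i < k)%N -> holonomy (x i) l = holonomy (x i.+1) l.
  move=> ik.
  (* The edge between the two rows is pushed across one cell at a time, both ways round a cell
     agreeing in its ball. In the first and last columns this edge joins equal points, so its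
     transport is 1. *)
  have main j : (j <= l)%N ->
      T (x i 0%N) (x i.+1 0%N) *m holonomy (x i.+1) j
      = holonomy (x i) j *m T (x i j) (x i.+1 j).
    elim: j => [_|j IH jl] /=; first by rewrite mul1mx mulmx1.
    rewrite mulmxA IH; last exact: ltnW.
    have [z [r [zr [h1 h2 h3 h4]]]] := hx i j ik jl.
    rewrite -!mulmxA (transport_ball zr h1 h2 h4).
    by have <- := transport_ball zr h1 h3 h4.
  have := main l (leqnn l).
  rewrite !x0 ?xl ?(ltnW ik)// !transportxx// mul1mx mulmx1 => ->.
  by [].
elim: k row {hx x0 xl} => // k IH row.
by rewrite IH; [exact: row|move=> i ik; apply: row; exact: leqW].
Qed.

(* Parametrized by [0, 1], with vertex c j at time j / k. *)
Definition polygon (c : nat -> V) (k : nat) (s : R) : V :=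
  c 0%N + \sum_(j < k) clamp (k%:R * s - j%:R) *: (c j.+1 - c j).

Lemma continuous_polygon c k : continuous (polygon c k).
Proof.
move=> s; apply: (cvgD (F := nbhs s)); first exact: cvg_cst.
apply: (cvg_bigsum (F := nbhs s)) => j.
apply: (cvgZr_tmp (F := nbhs s)).
apply: (cvg_comp (fun s => k%:R * s - j%:R) (@clamp R)) (@continuous_clamp R _).
apply: cvgB; last exact: cvg_cst.
by apply: cvgM; [exact: cvg_cst|exact: cvg_id].
Qed.

(** Before index l the clamps equal 1 and the sum telescopes to c l - c 0; after l they vanish. *)
Lemma polygonE c k l s : (l < k)%N -> l%:R <= k%:R * s <= l.+1%:R ->
  polygon c k s = c l + (k%:R * s - l%:R) *: (c l.+1 - c l).
Proof.
move=> lk /andP[ls sl]; rewrite /polygon.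
rewrite -(big_mkord xpredT (fun j => clamp (k%:R * s - j%:R) *: (c j.+1 - c j))).
rewrite (big_cat_nat (n := l)) ?(ltnW lk)//= (big_ltn lk).
rewrite (@eq_big_nat _ _ _ 0%N l _ (fun j => c j.+1 - c j)); last first.
  move=> j /= jl; rewrite clamp1 ?scale1r//.
  have : j.+1%:R <= l%:R :> R by rewrite ler_nat.
  by rewrite -natr1; lra.
rewrite telescope_sumr// [X in _ + (_ + X)]big_nat_cond.
rewrite [X in _ + (_ + X)]big1 ?addr0; last first.
  move=> j /andP[/andP[lj _] _]; rewrite clamp0 ?scale0r//.
  have : l.+1%:R <= j%:R :> R by rewrite ler_nat.
  by lra.
rewrite clamp_id; last by move: sl; rewrite -natr1 => sl; apply/andP; split; lra.
by rewrite addrA [c 0%N + _]addrC subrK.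
Qed.

Lemma chain_ball c k l : chain c k -> (l < k)%N ->
  exists z r, ball z r `<=` W /\
    forall s, l%:R <= k%:R * s <= l.+1%:R -> ball z r (polygon c k s).
Proof.
move=> hc lk; have [z [r [zr h1 h2]]] := hc l lk.
exists z, r; split=> // s ls; rewrite (polygonE _ lk ls).
have [_ cvx] := convex_open_ball z r; apply: cvx => //.
by move: ls; rewrite -natr1 => /andP[? ?]; apply/andP; split; lra.
Qed.

Lemma polygon_nat c k l : (l <= k)%N -> (0 < k)%N -> polygon c k (l%:R / k%:R) = c l.
Proof.
move=> lk k0.
have kn : k%:R != 0 :> R by rewrite pnatr_eq0 -lt0n.
case: (ltngtP l k) lk => // [lk _|-> _].
  rewrite (polygonE c (l := l))//; last first.
    by rewrite mulrCA divff// mulr1 lexx ler_nat leqnSn.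
  by rewrite mulrCA divff// mulr1 subrr scale0r addr0.
(* The last vertex is read as the end of edge k - 1, there being no edge k. *)
rewrite -(prednK k0) (polygonE c (l := k.-1))//; last first.
  by rewrite divff ?mulr1 ?pnatr_eq0// ler_nat leqnSn lexx.
rewrite divff ?pnatr_eq0// mulr1 -natr1 addrAC subrr add0r scale1r.
by rewrite addrC subrK.
Qed.

Lemma polygon_in c k s : chain c k -> (0 < k)%N -> 0 <= s <= 1 -> W (polygon c k s).
Proof.
move=> hc k0 /andP[s0 s1].
have k0' : 0 < k%:R :> R by rewrite ltr0n.
have [e|ne] := eqVneq s 1.
  have [z [r [zr h]]] := chain_ball hc (l := k.-1) ltac:(by rewrite prednK).
  apply: zr; apply: h; rewrite e mulr1 prednK// lexx andbT ler_nat.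
  exact: leq_pred.
have s1' : s < 1 by rewrite lt_neqAle ne.
have ks0 : 0 <= k%:R * s by rewrite mulr_ge0.
have /andP[t1 t2] := Num.Theory.truncn_itv ks0.
have lk : (Num.truncn (k%:R * s) < k)%N.
  by rewrite -(ltr_nat R) (le_lt_trans t1)// gtr_pMr.
have [z [r [zr h]]] := chain_ball hc lk.
by apply: zr; apply: h; rewrite t1 ltW.
Qed.

(** A null homotopy of the polygon is sampled on a grid. Its first row refines the chain, its last
    row is constant, and [holonomy_grid] equates their holonomies. *)
Lemma closed_chain_holonomy c k : simply_connected W -> chain c k -> c k = c 0%N ->
  holonomy c k = 1%:M.
Proof.
move=> [_ sc] hc ck.
have [->//|k0] := posnP k.
have z1 : unit_itv (0 : R) by rewrite /unit_itv /= lexx ler01.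
have o1 : unit_itv (1 : R) by rewrite /unit_itv /= lexx ler01.
have kn : k%:R != 0 :> R by rewrite pnatr_eq0 -lt0n.
have p0 : polygon c k 0 = c 0%N by have := polygon_nat c (leq0n k) k0; rewrite mulr0n mul0r.
have p1 : polygon c k 1 = c 0%N by have := polygon_nat c (leqnn k) k0; rewrite divff// ck.
have [|||H [cH HW Hs Hu]] := sc (polygon c k).
- by apply: continuous_subspaceT; exact: continuous_polygon.
- by move=> _ [s s01 <-]; exact: polygon_in.
- by rewrite p0 p1.
pose H' := H \o @clamp2 R.
have H'E p : (unit_itv `*` unit_itv) p -> H' p = H p.
  by case: p => a b [a01 b01]; rewrite /H' /clamp2 /= !clamp_id.
have W0 : W (c 0%N) by rewrite -p0; exact: polygon_in.
have [N hN] : exists N : nat, forall p, (unit_itv `*` unit_itv) p -> exists z r,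
    ball z r `<=` W /\ forall q, `|p.1 - q.1| <= N.+1%:R^-1 ->
      `|p.2 - q.2| <= N.+1%:R^-1 -> ball z r (H' q).
  apply: lebesgue_grid => //; first exact: continuous_clamp2.
  by move=> p Kp; rewrite H'E//; apply: HW; exists p.
pose q := N.+1.
have qn : q%:R != 0 :> R by rewrite pnatr_eq0.
(* With k q columns, vertex l of the chain falls on column l q, and the column width is still at
   most 1 / q. *)
pose x i j := H' (i%:R / q%:R, j%:R / (k * q)%:R).
have I01 i l : (i <= l)%N -> unit_itv (i%:R / l%:R : R).
  move=> il; rewrite /unit_itv /= divr_ge0//=.
  have [->|l0] := posnP l; first by rewrite invr0 mulr0.
  by rewrite ler_pdivrMr ?ltr0n// mul1r ler_nat.
have kq0 : (0 < k * q)%N by rewrite muln_gt0 k0.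
have step l i : `|i%:R / l%:R - i.+1%:R / l%:R| = (l%:R)^-1 :> R.
  by rewrite -mulrBl -natr1 opprD addrA subrr add0r mulN1r normrN normfV ger0_norm.
have x0j j : (j <= k * q)%N -> x 0%N j = polygon c k (j%:R / (k * q)%:R).
  move=> jk; rewrite /x mul0r H'E; last by split=> //; exact: I01.
  by have [-> _] := Hs _ (I01 _ _ jk).
have xqj j : (j <= k * q)%N -> x q j = c 0%N.
  move=> jk; rewrite /x divff// H'E; last by split=> //; exact: I01.
  by have [_ ->] := Hs _ (I01 _ _ jk).
have xi0 i : (i <= q)%N -> x i 0%N = c 0%N.
  move=> iq; rewrite /x mul0r H'E; last by split=> //; exact: I01.
  by have [-> _] := Hu _ (I01 _ _ iq).
have xil i : (i <= q)%N -> x i (k * q)%N = c 0%N.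
  move=> iq; rewrite /x divff ?pnatr_eq0 -?lt0n// H'E; last by split=> //; exact: I01.
  by have [_ ->] := Hu _ (I01 _ _ iq).
have grid := @holonomy_grid x q (k * q)%N.
have h1 : holonomy (x 0%N) (k * q) = holonomy (x q) (k * q).
  apply: grid; [|by move=> i iq; rewrite !xi0|by move=> i iq; rewrite !xil
    |by rewrite xi0|by rewrite xil].
  move=> i j iq jk.
  have [z [r [zr h]]] := hN (i%:R / q%:R, j%:R / (k * q)%:R)
    (conj (I01 _ _ (ltnW iq)) (I01 _ _ (ltnW jk))).
  have sk : (k * q)%:R^-1 <= q%:R^-1 :> R.
    by rewrite lef_pV2 ?posrE ?ltr0n// ler_nat leq_pmull.
  exists z, r; split=> //; split; apply: h => /=; rewrite ?subrr ?normr0 ?invr_ge0//.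
  - by rewrite step.
  - by rewrite step.
  - by rewrite step.
  - by rewrite step.
have h2 : holonomy (x q) (k * q) = 1%:M.
  by rewrite (eq_holonomy (d := fun=> c 0%N)) ?holonomy_const// => i; exact: xqj.
rewrite -h2 -h1.
have xl l : (l <= k)%N -> x 0%N (l * q)%N = c l.
  move=> lk; rewrite x0j ?leq_mul2r ?lk ?orbT// !natrM -mulf_div divff// mulr1.
  exact: polygon_nat.
have block l i : (l < k)%N -> (i <= q)%N ->
    l%:R <= (k%:R * ((l * q + i)%:R / (k * q)%:R) : R) <= l.+1%:R.
  move=> lk iq.
  have -> : k%:R * ((l * q + i)%:R / (k * q)%:R) = l%:R + i%:R / q%:R :> R.
    rewrite natrD !natrM; move: qn kn; move: (q%:R : R) (k%:R : R) => Q K Q0 K0.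
    by field; rewrite Q0 K0.
  have iq1 : i%:R / q%:R <= 1 :> R by rewrite ler_pdivrMr ?ltr0n// mul1r ler_nat.
  have iq0 : 0 <= i%:R / q%:R :> R by rewrite divr_ge0.
  apply/andP; split; first by rewrite lerDl.
  by have := lerD (lexx l%:R) iq1; rewrite natr1.
(* Cutting an edge into q pieces keeps its transport: the whole edge lies in one ball, where
   [holonomy_ball] collapses the pieces. *)
have main l : (l <= k)%N -> holonomy (x 0%N) (l * q) = holonomy c l.
  elim: l => [_|l IH lk]; first by rewrite mul0n.
  rewrite mulSnr holonomyD (IH (ltnW lk)) [RHS]/=; congr (_ *m _).
  have [z [r [zr h]]] := chain_ball hc lk.
  rewrite (holonomy_ball zr) => [|i iq].
    by rewrite addn0 -mulSnr xl ?(ltnW lk)// xl.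
  rewrite x0j; first by apply: h; exact: block.
  by rewrite (leq_trans (leq_add (leqnn _) iq))// -mulSnr leq_mul2r lk orbT.
by rewrite main.
Qed.

End ChainHolonomy.

(** * Global parallel coframes *)

Section ParallelFrame.
Variables (R : realType) (n m : nat).
Local Notation V := 'rV[R]_n.+1.

Lemma continuous_path_clamp (T : topologicalType) (c : R -> T) :
  {within unit_itv, continuous c} -> continuous (c \o @clamp R).
Proof.
move/subspace_continuousP => cc s.
have K (t : R) : unit_itv (clamp t) by rewrite /unit_itv /= clamp_ge0 clamp_le1.
move=> A hA; have {}hA := cc _ (K s) A hA.
have h : \forall t \near s, unit_itv (clamp t) -> A (c (clamp t)).
  exact: (@continuous_clamp R s _ hA).
by apply: (@filterS _ (nbhs s) _ _ _ _ h) => t; apply; exact: K.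
Qed.

Lemma near_eq_differentiable (U : normedModType R) (f g : U -> R) (x : U) :
  (\forall y \near x, f y = g y) -> differentiable f x ->
  differentiable g x /\ 'd g x = 'd f x :> (U -> R).
Proof.
move=> fg df; apply: differentiable_from_le; first exact: diff_continuous.
move=> e e0.
have /eqaddoP/(_ e e0) h1 := diff_locally df.
have h2 : \forall h \near (0 : U), f (h + x) = g (h + x).
  case/nbhs_ballP: fg => d d0 hd; apply/nbhs_ballP; exists d => // h.
  rewrite -ball_normE /= sub0r normrN => hh; apply: hd.
  by rewrite -ball_normE /= opprD addrCA subrr addr0 normrN.
apply: filterS2 h1 h2 => h h1 <-.
by rewrite -(nbhs_singleton fg).
Qed.

Section OnSimplyConnected.
Variables (W : set V) (Gam : V -> 'I_n.+1 -> 'M[R]_m).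
Hypotheses (oW : open W) (scW : simply_connected W) (flatW : flat_potential W Gam).
Local Notation T := (transport Gam).
Local Notation hol := (holonomy Gam).
Local Notation chain := (chain W).

Lemma chain_exists x y : W x -> W y ->
  exists c k, [/\ chain c k, c 0%N = x & c k = y].
Proof.
move=> Wx Wy; have [pc _] := scW; have [g [cg gW g0 g1]] := pc x y Wx Wy.
(* The path is viewed as a map of the square that is constant in the first variable, so that
   [lebesgue_grid] subdivides it. *)
have cg2 : continuous ((g \o @clamp R) \o snd : R * R -> V).
  have cgc := continuous_path_clamp cg.
  move=> [a b]; apply: continuous_comp; last exact: cgc.
  exact: cvg_snd.
have [|N hN] := lebesgue_grid oW cg2.
  move=> [a b] [_ b01] /=; apply: gW; exists (clamp b) => //.
  by rewrite /unit_itv /= clamp_ge0 clamp_le1.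
pose q := N.+1; have q0 : q%:R != 0 :> R by rewrite pnatr_eq0.
exists (fun j => g (clamp (j%:R / q%:R))), q; split.
- move=> j jq.
  have j01 : unit_itv (j%:R / q%:R : R).
    by rewrite /unit_itv /= divr_ge0//= ler_pdivrMr ?ltr0n// mul1r ler_nat ltnW.
  have z01 : unit_itv (0 : R) by rewrite /unit_itv /= lexx ler01.
  have [z [r [zr h]]] := hN (0, j%:R / q%:R) (conj z01 j01).
  exists z, r; split=> //.
    by have := h (0, j%:R / q%:R); apply; rewrite /= subrr normr0 invr_ge0.
  have := h (0, j.+1%:R / q%:R); apply; rewrite /= ?subrr ?normr0 ?invr_ge0//.
  by rewrite -mulrBl -natr1 opprD addrA subrr add0r mulN1r normrN normfV ger0_norm.
- by rewrite mul0r clamp0.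
- by rewrite divff// clamp1.
Qed.

Lemma chain_cat c d k l : chain c k -> chain d l -> c k = d 0%N ->
  let e i := if (i <= k)%N then c i else d (i - k)%N in
  chain e (k + l) /\ hol e (k + l) = hol c k *m hol d l.
Proof.
move=> hc hd cd e.
have ec i : (i <= k)%N -> e i = c i by rewrite /e => ->.
have ed i : e (k + i)%N = d i.
  case: i => [|i]; first by rewrite addn0 ec.
  by rewrite /e ifF ?addKn// addnS ltnNge leq_addr.
split.
  move=> i ikl; have [ik|ki] := ltnP i k.
    by rewrite !ec ?(ltnW ik)//; exact: hc.
  rewrite -(subnKC ki) -addnS !ed; apply: hd.
  by rewrite -(ltn_add2l k) subnKC.
rewrite holonomyD; congr (_ *m _); first exact: eq_holonomy.
by apply: eq_holonomy => i _; exact: ed.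
Qed.

(** The chain c followed by d reversed is closed, hence has holonomy 1, and reversal inverts the
    holonomy of d. *)
Lemma holonomy_unique c d k l : chain c k -> chain d l -> c 0%N = d 0%N ->
  c k = d l -> hol c k = hol d l.
Proof.
move=> hc hd cd0 cdl.
pose d' i := d (l - i)%N.
have hd' : chain d' l.
  move=> i il; apply: same_ball_sym; rewrite /d'.
  have -> : (l - i)%N = (l - i.+1).+1 by rewrite subnSK.
  by apply: hd; rewrite subnSK// leq_subr.
have [ce he] := chain_cat hc hd' (etrans cdl (congr1 d (esym (subn0 l)))).
have := closed_chain_holonomy oW flatW scW ce.
rewrite /= {}he.
(* The condition holds only for l = 0, when the concatenation ends on c itself. *)
have -> : ((if (k + l <= k)%N then c (k + l)%N else d' (k + l - k)%N) = c 0%N).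
  case: leqP => [|_]; last by rewrite addKn /d' subnn cd0.
  by rewrite -{2}[k]addn0 leq_add2l leqn0 => /eqP l0; rewrite l0 addn0 cdl cd0 l0.
move=> /(_ erefl) h1.
have h2 := holonomy_rev oW flatW hd.
have := mulmx1C h1; rewrite -/d' => h3.
by rewrite -[LHS]mul1mx -h2 -mulmxA h3 mulmx1.
Qed.

(** P x is the holonomy of any chain from a base point to x. Within a ball centred at x, P is P x
    times the transport from x, which gives dP = P Gam; the reversed chain gives invertibility. *)
Theorem parallel_frame : exists P : V -> 'M[R]_m, forall x, W x ->
  [/\ P x \in unitmx, forall i j, differentiable (fun z => P z i j) x
    & forall a i j, partial a (fun z => P z i j) x = (P x *m Gam x a) i j].
Proof.
have [[x0 Wx0]|W0] := pselect (exists x, W x); last first.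
  by exists (fun=> 1%:M) => x Wx; exfalso; apply: W0; exists x.
have /choice[P hP] : forall x, exists Q : 'M[R]_m, W x ->
    exists c k, [/\ chain c k, c 0%N = x0, c k = x & hol c k = Q].
  move=> x; have [Wx|nWx] := pselect (W x); last by exists 1%:M.
  have [c [k [hc c0 ck]]] := chain_exists Wx0 Wx.
  by exists (hol c k) => _; exists c, k.
have PT z r x y : ball z r `<=` W -> ball z r x -> ball z r y -> P y = P x *m T x y.
  move=> zr zx zy.
  have [c [k [hc c0 ck <-]]] := hP x (zr _ zx).
  have [d [l [hd d0 dl <-]]] := hP y (zr _ zy).
  pose e i := if i is 0%N then x else y.
  have he : chain e 1 by case=> // _; exists z, r.
  have [hf hfE] := chain_cat hc he ck.
  have -> : T x y = hol e 1 by rewrite /= mul1mx.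
  rewrite -hfE; apply: holonomy_unique => //.
    by rewrite /= c0 d0.
  by rewrite addn1 ltnn subSnn /= dl.
exists P => x Wx.
have /nbhs_ballP[r r0 zr] : nbhs x W by apply: open_nbhs_nbhs.
have xx : ball x r x by exact: ballxx.
have D i j : differentiable (fun z => P z i j) x /\
    forall a, partial a (fun z => P z i j) x = (P x *m Gam x a) i j.
  have near_eq : \forall y \near x, (P x *m T x y) i j = P y i j.
    apply/nbhs_ballP; exists r => // y xy.
    by rewrite [in RHS](PT _ _ _ _ zr xx xy).
  have dT l : differentiable (fun z => T x z l j) x /\
      'd (fun z => T x z l j) x = lincomb (fun a => (T x x *m Gam x a) l j) :> (V -> R).
    exact: (transport_differentiable (convex_open_ball x r) (flat_potentialW zr flatW)).
  have e1 : (fun y => (P x *m T x y) i j) = \sum_l (fun y => P x i l * T x y l j).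
    by apply/funext => y; rewrite mxE fct_sumE.
  have dPT : differentiable (fun y => (P x *m T x y) i j) x.
    rewrite e1; apply: differentiable_sum => l; apply: differentiableM => //.
    by have [] := dT l.
  have [dP eP] := near_eq_differentiable near_eq dPT.
  split=> // a; rewrite /partial deriveE// eP -deriveE//.
  have dl l : is_derive x (delta_mx ord0 a) (fun y => P x i l * T x y l j)
      (P x i l * (T x x *m Gam x a) l j).
    have [dTl eT] := dT l.
    have := is_derive_mul (is_derive_cst (P x i l) x (delta_mx ord0 a))
      (derivableP (diff_derivable dTl (v := delta_mx ord0 a))).
    rewrite mul0r add0r deriveE// eT /lincomb (bigD1 a)//= mxE !eqxx mul1r.
    rewrite big1 ?addr0// => b ba; rewrite mxE (negbTE ba) andbF mul0r //.
  have e2 : (fun y => (P x *m T x y) i j) = (fun y => \sum_l P x i l * T x y l j).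
    by apply/funext => y; rewrite mxE.
  rewrite e2; have [_ ->] := is_derive_bigsum dl.
  by rewrite (transportxx oW flatW Wx) mul1mx mxE.
split; last 2 first.
- by move=> i j; have [] := D i j.
- by move=> a i j; have [_ ->] := D i j.
have [c [k [hc c0 ck <-]]] := hP x Wx.
by have /mulmx1_unit[] := holonomy_rev oW flatW hc.
Qed.
End OnSimplyConnected.
End ParallelFrame.

(** * Calculus of smooth functions *)

Section SmoothCalculus.
Variables (R : realType) (V : normedModType R).
Implicit Types (U : set V) (f g : V -> R).

(* Grading smooth_on by the number of derivatives allows induction. *)
Definition smooth_upto (k : nat) U f : Prop :=
  forall (s : seq V) (x : V), (size s <= k)%N -> U x ->
    differentiable (foldr (fun v g => 'D_v g) f s) x.

Lemma smooth_uptoP U f : smooth_on U f <-> forall k, smooth_upto k U f.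
Proof.
split; first by move=> sf k s x _ Ux; exact: sf.
by move=> sf s x Ux; exact: (sf (size s)).
Qed.

Lemma smooth_upto0 U f : smooth_upto 0 U f <-> forall x, U x -> differentiable f x.
Proof.
split; first by move=> sf x Ux; exact: (sf [::] x).
by move=> df [] // x _ Ux; exact: df.
Qed.

(** The last element of s is the derivative taken first, hence the [rcons]: peeling it off replaces
    f by its derivative. *)
Lemma smooth_uptoS k U f : smooth_upto k.+1 U f <->
  (forall x, U x -> differentiable f x) /\ forall v, smooth_upto k U ('D_v f).
Proof.
split=> [sf|[df sf] s x].
  split; first by move=> x Ux; exact: (sf [::] x).
  move=> v s x sk Ux; have := sf (rcons s v) x; rewrite size_rcons -cats1 foldr_cat.
  exact.
case/lastP: s => [_|s v]; first exact: df.
by rewrite size_rcons -cats1 foldr_cat; exact: sf.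
Qed.

Lemma smooth_uptoW k U f : smooth_upto k.+1 U f -> smooth_upto k U f.
Proof. by move=> sf s x sk; apply: sf; exact: leqW. Qed.

Lemma near_eq_derive_open U f g x v : open U -> (forall y, U y -> f y = g y) -> U x ->
  'D_v f x = 'D_v g x.
Proof.
move=> oU fg Ux; apply: near_eq_derive.
have : nbhs x U by apply: open_nbhs_nbhs.
by apply: filterS.
Qed.

Lemma eq_smooth_upto k U f g : open U -> (forall x, U x -> f x = g x) ->
  smooth_upto k U f -> smooth_upto k U g.
Proof.
move=> oU; elim: k f g => [|k IH] f g fg.
  move/smooth_upto0 => df; apply/smooth_upto0 => x Ux.
  have h : \forall y \near x, f y = g y.
    have : nbhs x U by apply: open_nbhs_nbhs.
    by apply: filterS.
  by have [] := near_eq_differentiable h (df x Ux).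
move/smooth_uptoS => [df sf]; apply/smooth_uptoS; split.
  move=> x Ux; have h : \forall y \near x, f y = g y.
    have : nbhs x U by apply: open_nbhs_nbhs.
    by apply: filterS.
  by have [] := near_eq_differentiable h (df x Ux).
move=> v; apply: IH (sf v) => x Ux; exact: near_eq_derive_open fg Ux.
Qed.

Lemma smooth_upto_cst k U (c : R) : smooth_upto k U (fun=> c).
Proof.
elim: k c => [|k IH] c; first by apply/smooth_upto0 => x _; exact: differentiable_cst.
apply/smooth_uptoS; split; first by move=> x _; exact: differentiable_cst.
move=> v; have -> : 'D_v (fun=> c) = (fun=> 0 : R).
  by apply/funext => x; rewrite derive_cst.
exact: IH.
Qed.

Lemma smooth_uptoD k U f g : open U -> smooth_upto k U f -> smooth_upto k U g ->
  smooth_upto k U (fun x => f x + g x).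
Proof.
move=> oU; elim: k f g => [|k IH] f g.
  move=> /smooth_upto0 df /smooth_upto0 dg; apply/smooth_upto0 => x Ux.
  by apply: differentiableD; [exact: df|exact: dg].
move=> /smooth_uptoS[df sf] /smooth_uptoS[dg sg]; apply/smooth_uptoS; split.
  by move=> x Ux; apply: differentiableD; [exact: df|exact: dg].
move=> v; apply: eq_smooth_upto (IH _ _ (sf v) (sg v)) => // x Ux.
by rewrite [RHS]deriveD//; apply: diff_derivable; [exact: df|exact: dg].
Qed.

Lemma smooth_uptoM k U f g : open U -> smooth_upto k U f -> smooth_upto k U g ->
  smooth_upto k U (fun x => f x * g x).
Proof.
move=> oU; elim: k f g => [|k IH] f g.
  move=> /smooth_upto0 df /smooth_upto0 dg; apply/smooth_upto0 => x Ux.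
  by apply: differentiableM; [exact: df|exact: dg].
move=> sf' sg'; have [df sf] := (smooth_uptoS _ _ _).1 sf'.
have [dg sg] := (smooth_uptoS _ _ _).1 sg'; apply/smooth_uptoS; split.
  by move=> x Ux; apply: differentiableM; [exact: df|exact: dg].
move=> v.
have h := smooth_uptoD oU (IH _ _ (sf v) (smooth_uptoW sg'))
  (IH _ _ (smooth_uptoW sf') (sg v)).
apply: eq_smooth_upto h => // x Ux.
have [_ ->] // := is_derive_mul (derivableP (diff_derivable (df x Ux) (v := v)))
  (derivableP (diff_derivable (dg x Ux) (v := v))).
Qed.

Lemma smooth_upto_sum k U (I : finType) (f : I -> V -> R) : open U ->
  (forall i, smooth_upto k U (f i)) -> smooth_upto k U (fun x => \sum_i f i x).
Proof.
move=> oU sf; elim: (index_enum I) => [|i s IH].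
  have -> : (fun x => \sum_(i <- [::]) f i x) = (fun=> 0).
    by apply/funext => x; rewrite big_nil.
  exact: smooth_upto_cst.
have -> : (fun x => \sum_(i <- i :: s) f i x)
    = (fun x => f i x + \sum_(i <- s) f i x).
  by apply/funext => x; rewrite big_cons.
by apply: smooth_uptoD.
Qed.

Lemma smooth_cst U (c : R) : smooth_on U (fun=> c).
Proof. by apply/smooth_uptoP => k; exact: smooth_upto_cst. Qed.

Lemma smoothM U f g : open U -> smooth_on U f -> smooth_on U g ->
  smooth_on U (fun x => f x * g x).
Proof.
move=> oU /smooth_uptoP sf /smooth_uptoP sg; apply/smooth_uptoP => k.
exact: smooth_uptoM.
Qed.

Lemma smooth_sum U (I : finType) (f : I -> V -> R) : open U ->
  (forall i, smooth_on U (f i)) -> smooth_on U (fun x => \sum_i f i x).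
Proof.
move=> oU sf; apply/smooth_uptoP => k.
by apply: smooth_upto_sum => // i; exact: (smooth_uptoP _ _).1.
Qed.

Lemma eq_smooth U f g : open U -> (forall x, U x -> f x = g x) ->
  smooth_on U f -> smooth_on U g.
Proof.
move=> oU fg /smooth_uptoP sf; apply/smooth_uptoP => k; exact: eq_smooth_upto (sf k).
Qed.

Lemma smoothW U U' f : U' `<=` U -> smooth_on U f -> smooth_on U' f.
Proof. by move=> UU sf s x Ux; apply: sf; exact: UU. Qed.

Lemma smooth_differentiable U f x : smooth_on U f -> U x -> differentiable f x.
Proof. by move=> sf; exact: (sf [::]). Qed.

Lemma smooth_derive U f v : smooth_on U f -> smooth_on U ('D_v f).
Proof.
move=> sf s x Ux; have := sf (rcons s v) x Ux; rewrite -cats1 foldr_cat.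
exact.
Qed.

(** Both sides have the same difference quotients, so no chain rule is involved; the equality then
    holds between functions and can be iterated. *)
Lemma derive_affine (V' : normedModType R) (phi : V' -> V) (dphi : {linear V' -> V})
    f (v x : V') :
  (forall h x, phi (h + x) = dphi h + phi x) ->
  'D_v (f \o phi) x = 'D_(dphi v) f (phi x).
Proof.
move=> phiD.
have e : (fun h : R => h^-1 *: (((f \o phi) \o shift x) (h *: v) - (f \o phi) x))
    = (fun h => h^-1 *: ((f \o shift (phi x)) (h *: dphi v) - f (phi x))).
  by apply/funext => h /=; rewrite phiD linearZ.
by rewrite /derive e.
Qed.

Lemma differentiable_affine (V' : normedModType R) (phi : V' -> V)
    (dphi : {linear V' -> V}) (C : R) (x : V') :
  (forall h, `|dphi h| <= C * `|h|) -> (forall h x, phi (h + x) = dphi h + phi x) ->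
  differentiable phi x.
Proof.
move=> bphi phiD; apply: (differentiable_from_le (df := dphi) _ _).1.
  move=> y; apply/cvgrPdist_le => e e0.
  have d0 : 0 < e / (`|C| + 1) by rewrite divr_gt0// ltr_wpDl.
  have : \forall z \near y, `|y - z| < e / (`|C| + 1).
    by apply/nbhs_ballP; exists (e / (`|C| + 1)) => // z; rewrite -ball_normE.
  apply: filterS => z; rewrite ltr_pdivlMr ?ltr_wpDl// => /ltW hz.
  rewrite -linearB (le_trans (bphi _))// (le_trans _ hz)// mulrC ler_wpM2l//.
  by rewrite (le_trans (ler_norm C))// lerDl.
move=> e e0; apply: nearW => h; rewrite phiD [phi x + _]addrC subrr normr0.
by rewrite mulr_ge0// ltW.
Qed.

Lemma smooth_affine (V' : normedModType R) (phi : V' -> V) (dphi : {linear V' -> V})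
    (C : R) (U : set V) f :
  (forall h, `|dphi h| <= C * `|h|) -> (forall h x, phi (h + x) = dphi h + phi x) ->
  smooth_on U f -> smooth_on (phi @^-1` U) (f \o phi).
Proof.
move=> bphi phiD sf.
have D f' v : 'D_v (f' \o phi) = 'D_(dphi v) f' \o phi.
  by apply/funext => x; exact: derive_affine.
move=> s x Ux.
have -> : foldr (fun (v : V') (g : V' -> R) => 'D_v g) (f \o phi) s
    = foldr (fun v g => 'D_v g) f (map dphi s) \o phi.
  by elim: s => //= v s ->; rewrite D.
apply: differentiable_comp; last exact: sf.
exact: (differentiable_affine (dphi := dphi) (C := C)).
Qed.
End SmoothCalculus.

Section SmoothRow.
Variables (R : realType) (n : nat).
Local Notation V := 'rV[R]_n.+1.

Lemma derive_coord_comp (g : R -> R) (i : 'I_n.+1) (v x : V) :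
  'D_v (fun y : V => g (y ord0 i)) x = 'D_(v ord0 i) g (x ord0 i).
Proof.
have e : (fun h : R => h^-1 *: (((fun y : V => g (y ord0 i)) \o shift x) (h *: v)
      - g (x ord0 i)))
    = (fun h => h^-1 *: ((g \o shift (x ord0 i)) (h *: v ord0 i) - g (x ord0 i))).
  by apply/funext => h /=; rewrite !mxE.
by rewrite /derive e.
Qed.

Lemma differentiable_coord_comp (g : R -> R) (i : 'I_n.+1) (x : V) :
  differentiable g (x ord0 i) -> differentiable (fun y : V => g (y ord0 i)) x.
Proof.
move=> dg; apply: (differentiable_comp (f := fun y : V => y ord0 i)) => //.
exact: differentiable_coord.
Qed.

Lemma smooth_coord (U : set V) i : smooth_on U (fun x : V => x ord0 i).
Proof.
apply/smooth_uptoP => -[|k].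
  by apply/smooth_upto0 => x _; exact: differentiable_coord.
apply/smooth_uptoS; split; first by move=> x _; exact: differentiable_coord.
move=> v; have -> : 'D_v (fun x : V => x ord0 i) = (fun=> v ord0 i).
  apply/funext => x; rewrite (derive_coord_comp id).
  exact: derive_id.
exact: smooth_upto_cst.
Qed.

(** Sine and cosine are each other's derivative up to sign, so one induction on the order treats
    both. *)
Lemma smooth_sin_cos (U : set V) i : open U ->
  smooth_on U (fun x : V => sin (x ord0 i)) /\ smooth_on U (fun x : V => cos (x ord0 i)).
Proof.
move=> oU.
have ds x : differentiable (fun y : V => sin (y ord0 i)) x.
  by apply: differentiable_coord_comp; apply/derivable1_diffP.
have dc x : differentiable (fun y : V => cos (y ord0 i)) x.
  by apply: differentiable_coord_comp; apply/derivable1_diffP.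
have D (g dg : R -> R) (v x : V) : is_derive (x ord0 i) 1 g (dg (x ord0 i)) ->
    'D_v (fun y : V => g (y ord0 i)) x = v ord0 i * dg (x ord0 i).
  move=> [dg1 dgE]; rewrite derive_coord_comp.
  have df : differentiable g (x ord0 i) by apply/derivable1_diffP.
  by rewrite deriveE// -[v ord0 i]mulr1 linearZ -deriveE// dgE mulr1.
suff H k : smooth_upto k U (fun x : V => sin (x ord0 i))
    /\ smooth_upto k U (fun x : V => cos (x ord0 i)).
  by split; apply/smooth_uptoP => k; have [] := H k.
elim: k => [|k [IHs IHc]]; first by split; apply/smooth_upto0 => x _.
split; apply/smooth_uptoS; split=> //.
- move=> v; have h := smooth_uptoM oU (@smooth_upto_cst _ _ k U (v ord0 i)) IHc.
  by apply: eq_smooth_upto h => // x _; rewrite (D _ cos).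
- move=> v; have h := smooth_uptoM oU (@smooth_upto_cst _ _ k U (- v ord0 i)) IHs.
  apply: eq_smooth_upto h => // x _.
  by rewrite (D _ (fun t => - sin t)) mulNr mulrN.
Qed.
End SmoothRow.

(** * Metrics of flat connections *)

Section FlatMetric.
Variables (R : realType) (n : nat).
Local Notation V := 'rV[R]_n.+1.
Implicit Types (U W : set V) (G : connection R n) (h : V -> 'M[R]_n.+1).

(** The upper index is the row, so that d_a P = P [connection_mx] says that the rows of P are
    parallel covectors. *)
Definition connection_mx G (x : V) (a : 'I_n.+1) : 'M[R]_n.+1 :=
  \matrix_(c, b) G x c a b.

Lemma flat_connection_mx U G : (forall c a b, smooth_on U (fun x => G x c a b)) ->
  flat_on U G -> flat_potential U (connection_mx G).
Proof.
move=> sG fG.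
have e a i j : (fun z => connection_mx G z a i j) = (fun z => G z i a j).
  by apply/funext => z; rewrite mxE.
split.
- by move=> x a i j Ux; rewrite e; exact: smooth_differentiable (sG i a j) Ux.
- move=> x a b i j Ux; rewrite e; apply: differentiable_continuous.
  exact: smooth_differentiable (smooth_derive _ (sG i a j)) Ux.
- move=> x a b i j Ux; rewrite !e -[RHS](fG x i j a b Ux) /curvature; congr (_ + _).
  by rewrite !mxE -sumrB; apply: eq_bigr => l _; rewrite !mxE.
Qed.

(** The vanishing of the covariant derivative of h. *)
Definition metric_compatible U h G : Prop := forall x a b d, U x ->
  partial a (fun z => h z b d) x
  = \sum_c (G x c a b * h x c d + G x c a d * h x b c).

(** Koszul's computation: the alternating sum of three compatibility equations is twice G with its
    upper index lowered, and the inverse of h raises it again. *)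
Lemma metrizes_compatible U h G : pseudo_metric U h ->
  (forall x c a b, U x -> G x c a b = G x c b a) ->
  metric_compatible U h G -> metrizes U h G.
Proof.
move=> [_ hsym hunit] Gsym comp x c a b Ux.
have hs i j : h x i j = h x j i by rewrite -[in LHS](hsym x Ux) mxE.
have e d : partial a (fun z => h z b d) x + partial b (fun z => h z a d) x
    - partial d (fun z => h z a b) x = 2 * \sum_l G x l a b * h x l d.
  rewrite !comp// -big_split -sumrB mulr_sumr; apply: eq_bigr => l _ /=.
  rewrite (Gsym x l b a)// (Gsym x l d a)// (Gsym x l d b)// (hs b l) (hs a l).
  ring.
rewrite /christoffel; under eq_bigr => d _ do rewrite e mulrCA.
rewrite -mulr_sumr mulrA mulVf// mul1r.
have -> : \sum_d invmx (h x) c d * (\sum_l G x l a b * h x l d)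
    = \sum_l (\sum_d invmx (h x) c d * h x d l) * G x l a b.
  under eq_bigr do rewrite mulr_sumr.
  rewrite exchange_big; apply: eq_bigr => l _; rewrite mulr_suml.
  by apply: eq_bigr => d _; rewrite (hs d l); ring.
have inv l : \sum_d invmx (h x) c d * h x d l = (c == l)%:R.
  have := mulVmx (hunit x Ux) => /matrixP/(_ c l); rewrite mxE => ->.
  by rewrite mxE.
rewrite (bigD1 c)//= inv eqxx mul1r big1 ?addr0// => l lc.
by rewrite inv eq_sym (negbTE lc) mul0r.
Qed.

Lemma eq_curvature U G G' x d c a b : open U ->
  (forall y i j k, U y -> G y i j k = G' y i j k) -> U x ->
  curvature G x d c a b = curvature G' x d c a b.
Proof.
move=> oU GG Ux; rewrite /curvature; congr (_ - _ + _).
- by apply: near_eq_derive_open oU _ Ux => y Uy; exact: GG.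
- by apply: near_eq_derive_open oU _ Ux => y Uy; exact: GG.
- by apply: eq_bigr => e _; rewrite !GG.
Qed.

(** Bootstrapping: the derivatives of P are bilinear in P and G, so each order of smoothness gives
    the next. *)
Lemma smooth_parallel_frame U G (P : V -> 'M[R]_n.+1) : open U ->
  (forall c a b, smooth_on U (fun x => G x c a b)) ->
  (forall x i j, U x -> differentiable (fun z => P z i j) x) ->
  (forall x a i j, U x ->
     partial a (fun z => P z i j) x = (P x *m connection_mx G x a) i j) ->
  forall i j, smooth_on U (fun x => P x i j).
Proof.
move=> oU sG dP pP i j; apply/smooth_uptoP => k; move: i j.
elim: k => [|k IH] i j; first by apply/smooth_upto0 => x Ux; exact: dP.
apply/smooth_uptoS; split; first by move=> x Ux; exact: dP.
move=> v.
have h : smooth_upto k U (fun x => \sum_a v ord0 a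
    * (\sum_l P x i l * G x l a j)).
  apply: smooth_upto_sum => // a; apply: smooth_uptoM => //.
    exact: smooth_upto_cst.
  apply: smooth_upto_sum => // l; apply: smooth_uptoM => //.
  exact: (smooth_uptoP _ _).1.
apply: eq_smooth_upto h => // x Ux.
rewrite derive_lincomb; last exact: dP.
by apply: eq_bigr => a _; rewrite pP// mxE; congr (_ * _);
  apply: eq_bigr => l _; rewrite mxE.
Qed.

(* The coframe P is parallel, so P^T P is a parallel (positive definite) metric. *)
Theorem flat_connection_metric W G : open W -> simply_connected W ->
  torsion_free_connection W G -> flat_on W G ->
  exists h, pseudo_metric W h /\ metric_compatible W h G.
Proof.
move=> oW scW [sG Gsym] fG.
have [P hP] := parallel_frame oW scW (flat_connection_mx sG fG).
have sP : forall i j, smooth_on W (fun x => P x i j).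
  apply: (smooth_parallel_frame oW sG).
    by move=> x i j Wx; have [_ + _] := hP x Wx.
  by move=> x a i j Wx; have [_ _] := hP x Wx.
pose h x := (P x)^T *m P x.
have hE x b d : h x b d = \sum_i P x i b * P x i d.
  by rewrite mxE; apply: eq_bigr => i _; rewrite mxE.
exists h; split; first split.
- move=> a b.
  have -> : (fun x => h x a b) = (fun x => \sum_i P x i a * P x i b).
    by apply/funext => x; rewrite hE.
  by apply: smooth_sum => // i; apply: smoothM.
- by move=> x Wx; rewrite /h trmx_mul trmxK.
- by move=> x Wx; rewrite /h unitmx_mul unitmx_tr; have [-> _ _] := hP x Wx.
- move=> x a b d Wx.
  have -> : (fun z => h z b d) = (fun z => \sum_i P z i b * P z i d).
    by apply/funext => z; rewrite hE.
  have [_ dP pP] := hP x Wx.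
  have dP' i j : is_derive x (delta_mx ord0 a) (fun z => P z i j)
      ((P x *m connection_mx G x a) i j).
    by rewrite -pP; apply: derivableP; apply: diff_derivable; exact: dP.
  rewrite /partial.
  have [_ ->] := is_derive_bigsum (fun i => is_derive_mul (dP' i b) (dP' i d)).
  rewrite big_split [RHS]big_split /=; congr (_ + _).
    rewrite (eq_bigr (fun i => \sum_c P x i c * G x c a b * P x i d)); last first.
      by move=> i _; rewrite mxE mulr_suml; apply: eq_bigr => c _; rewrite mxE.
    rewrite exchange_big; apply: eq_bigr => c _; rewrite hE mulr_sumr.
    by apply: eq_bigr => i _ /=; ring.
  rewrite (eq_bigr (fun i => \sum_c P x i b * (P x i c * G x c a d))); last first.
    by move=> i _; rewrite mxE mulr_sumr; apply: eq_bigr => c _; rewrite mxE.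
  rewrite exchange_big; apply: eq_bigr => c _; rewrite hE mulr_sumr.
  by apply: eq_bigr => i _ /=; ring.
Qed.
End FlatMetric.

(** * Quadratic Finsler functions *)

Section QuadraticMetric.
Variables (R : realType) (n : nat).
Local Notation V := 'rV[R]_n.+1.
Local Notation TV := (V * V)%type.

Definition quadratic_form (a : V -> 'M[R]_n.+1) (p : TV) : R :=
  \sum_i \sum_j a p.1 i j * p.2 ord0 i * p.2 ord0 j.

Lemma is_derive_fst (f : V -> R) (p v : TV) : derivable f p.1 v.1 ->
  is_derive p v (fun q : TV => f q.1) ('D_(v.1) f p.1).
Proof.
have e : (fun h : R => h^-1 *: (((fun q : TV => f q.1) \o shift p) (h *: v) - f p.1))
    = (fun h : R => h^-1 *: ((f \o shift p.1) (h *: v.1) - f p.1)) by [].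
by move=> d; split; rewrite ?/derivable /derive e.
Qed.

Lemma is_derive_snd_coord (p v : TV) i :
  is_derive p v (fun q : TV => q.2 ord0 i) (v.2 ord0 i).
Proof.
have e : (fun h : R => h^-1 *: (((fun q : TV => q.2 ord0 i) \o shift p) (h *: v)
      - p.2 ord0 i))
    = (fun h : R => h^-1 *: ((id \o shift (p.2 ord0 i)) (h *: v.2 ord0 i) - p.2 ord0 i)).
  by apply/funext => h /=; rewrite !mxE.
have [d dE] := is_derive_id (p.2 ord0 i) (v.2 ord0 i).
by split; [move: d; rewrite /derivable e|move: dE; rewrite /derive e].
Qed.

Lemma smooth_fst (U : set V) (f : V -> R) : smooth_on U f ->
  smooth_on (fst @^-1` U) (fun p : TV => f p.1).
Proof.
apply: (@smooth_affine R V TV fst fst 1); last by [].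
by move=> h; rewrite mul1r prod_normE le_max lexx.
Qed.

Lemma smooth_snd (U : set V) (f : V -> R) : smooth_on U f ->
  smooth_on (snd @^-1` U) (fun p : TV => f p.2).
Proof.
apply: (@smooth_affine R V TV snd snd 1); last by [].
by move=> h; rewrite mul1r prod_normE le_max lexx orbT.
Qed.

Variable a : V -> 'M[R]_n.+1.
Let L := quadratic_form a.

Lemma is_derive_quadratic (p v : TV) : (forall i j, derivable (fun x => a x i j) p.1 v.1) ->
  is_derive p v L (\sum_i \sum_j
    (('D_(v.1) (fun x => a x i j) p.1 * p.2 ord0 i + a p.1 i j * v.2 ord0 i)
       * p.2 ord0 j + a p.1 i j * p.2 ord0 i * v.2 ord0 j)).
Proof.
move=> da; apply: is_derive_bigsum => i; apply: is_derive_bigsum => j.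
apply: is_derive_mul; last exact: is_derive_snd_coord.
apply: is_derive_mul; last exact: is_derive_snd_coord.
exact: (is_derive_fst (f := fun x => a x i j)).
Qed.

Lemma delta_row (b j : 'I_n.+1) : (delta_mx ord0 b : V) ord0 j = (j == b)%:R.
Proof. by rewrite mxE eqxx. Qed.

Lemma sum_delta (b : 'I_n.+1) (F : 'I_n.+1 -> R) : \sum_j (j == b)%:R * F j = F b.
Proof.
rewrite (bigD1 b)//= eqxx mul1r big1 ?addr0// => j jb.
by rewrite (negbTE jb) mul0r.
Qed.

Lemma dv_quadratic b : dv b L = fun p => \sum_j (a p.1 b j + a p.1 j b) * p.2 ord0 j.
Proof.
apply/funext => p; rewrite /dv.
(* A fibre direction has base part 0, along which the coefficients are trivially derivable; the
   formula is thus an equality of functions on the whole space. *)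
have [_ ->] := is_derive_quadratic (p := p) (v := fibre_dir R b)
  (fun i j => @derivable0 _ _ _ (fun x => a x i j) p.1).
rewrite (eq_bigr (fun i => \sum_j ((i == b)%:R * (a p.1 i j * p.2 ord0 j)
   + (j == b)%:R * (a p.1 i j * p.2 ord0 i)))); last first.
  move=> i _; apply: eq_bigr => j _.
  rewrite /= derive0 !delta_row; ring.
rewrite (eq_bigr (fun i => (i == b)%:R * (\sum_j a p.1 i j * p.2 ord0 j)
    + a p.1 i b * p.2 ord0 i)); last first.
  by move=> i _; rewrite big_split /= sum_delta -mulr_sumr.
rewrite big_split /= sum_delta -big_split /=; apply: eq_bigr => j _.
by rewrite mulrDl.
Qed.

Lemma is_derive_dv (p v : TV) b : (forall i j, derivable (fun x => a x i j) p.1 v.1) ->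
  is_derive p v (dv b L) (\sum_j
    (('D_(v.1) (fun x => a x b j) p.1 + 'D_(v.1) (fun x => a x j b) p.1) * p.2 ord0 j
     + (a p.1 b j + a p.1 j b) * v.2 ord0 j)).
Proof.
move=> da; rewrite dv_quadratic; apply: is_derive_bigsum => j.
apply: is_derive_mul; last exact: is_derive_snd_coord.
have h i k := is_derive_fst (f := fun x => a x i k) (da i k).
exact: (is_deriveD (h b j) (h j b)).
Qed.

Lemma fundamental_tensor_quadratic (p : TV) : (a p.1)^T = a p.1 ->
  fundamental_tensor L p = a p.1.
Proof.
move=> asym; apply/matrixP => i b; rewrite mxE /dv -/(dv b L).
have [_ ->] := is_derive_dv (p := p) (v := fibre_dir R i) b
  (fun i j => @derivable0 _ _ _ (fun x => a x i j) p.1).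
rewrite (eq_bigr (fun j => (j == i)%:R * (a p.1 b j + a p.1 j b))); last first.
  by move=> j _; rewrite /= !derive0 delta_row; ring.
rewrite sum_delta; have -> : a p.1 b i = a p.1 i b by rewrite -[in LHS]asym mxE.
by field.
Qed.

Variable M : set V.
Hypotheses (oM : open M) (metric_a : pseudo_metric M a).

Lemma derivable_metric x v i j : M x -> derivable (fun z => a z i j) x v.
Proof.
move=> Mx; have [sa _ _] := metric_a; apply: diff_derivable.
exact: smooth_differentiable (sa i j) Mx.
Qed.

Lemma conic_slit_tangent : conic_subbundle M (slit_tangent M).
Proof.
split=> //.
- have -> : slit_tangent M = (fst @^-1` M) `&` (snd @^-1` [set~ 0]).
    by apply/seteqP; split=> p [h1 h2]; split=> //; apply/eqP.
  apply: openI.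
    by apply: open_comp => // p _; exact: cvg_fst.
  apply: open_comp; first by move=> p _; exact: cvg_snd.
  apply: closed_openC; apply: accessible_closed_set1.
  by apply: hausdorff_accessible; exact: norm_hausdorff.
- move=> x Mx; exists (const_mx 1); split=> //=.
  by apply/eqP => /rowP/(_ ord0)/eqP; rewrite !mxE oner_eq0.
- move=> x y c c0 [Mx y0]; split=> //=.
  by rewrite scaler_eq0 negb_or gt_eqF.
Qed.

Lemma finsler_quadratic : finsler M (slit_tangent M) L.
Proof.
have [sa asym aunit] := metric_a.
have [oS _ _ _] := conic_slit_tangent.
have smooth_y i : smooth_on (slit_tangent M) (fun p : TV => p.2 ord0 i).
  apply: (smoothW (U := setT)) => //.
  apply: (smooth_snd (U := setT) (f := fun y => y ord0 i)).
  exact: smooth_coord.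
split; first exact: conic_slit_tangent.
- apply: smooth_sum => // i; apply: smooth_sum => // j.
  do 2![apply: smoothM => //].
  apply: smoothW (smooth_fst (sa i j)).
  by move=> p [].
- move=> x y c c0 _; rewrite /L /quadratic_form mulr_sumr; apply: eq_bigr => i _.
  rewrite mulr_sumr; apply: eq_bigr => j _ /=; rewrite !mxE; ring.
- move=> p [Mp _]; rewrite fundamental_tensor_quadratic; first exact: aunit.
  exact: asym.
Qed.

Lemma pseudo_riemannian_quadratic : pseudo_riemannian M (slit_tangent M) L.
Proof. by split; [exact: finsler_quadratic|exists a]. Qed.

(** Compatibility rewrites the derivatives of a through G. The terms with b as a lower index of G
    cancel, the rest is 2 a g with g the quadratic form of G, and the inverse fundamental tensor
    removes a. *)
Lemma berwald_quadratic G : torsion_free_connection M G ->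
  metric_compatible M a G -> berwald_with M (slit_tangent M) L G.
Proof.
move=> tG comp; split=> //; first exact: finsler_quadratic.
move=> x y c [/= Mx y0]; have [sa asym aunit] := metric_a; have [_ Gsym] := tG.
have as_ i j : a x i j = a x j i by rewrite -[in LHS](asym x Mx) mxE.
pose g d := \sum_i \sum_j G x d i j * y ord0 i * y ord0 j.
rewrite -/(g c) /spray fundamental_tensor_quadratic; last exact: asym.
have main b : \sum_i y ord0 i * dx i (dv b L) (x, y) - dx b L (x, y)
    = 2 * \sum_d a x b d * g d.
  have -> : dx b L (x, y) = 2 * \sum_i \sum_j \sum_d
      G x d b i * a x d j * y ord0 i * y ord0 j.
    rewrite /dx; have [_ ->] := is_derive_quadratic (p := (x, y))
      (v := base_dir R b) (fun i j => @derivable_metric x _ i j Mx).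
    rewrite (eq_bigr (fun i => \sum_j (\sum_d G x d b i * a x d j * y ord0 i * y ord0 j)
        + \sum_j \sum_d G x d b j * a x d i * y ord0 j * y ord0 i)); last first.
      move=> i _; rewrite -big_split; apply: eq_bigr => j _ /=.
      rewrite -/(partial b (fun z => a z i j) x) comp// !mxE !mulr0 addr0 addr0.
      rewrite -big_split !mulr_suml; apply: eq_bigr => d _ /=.
      by rewrite (as_ d i); ring.
    by rewrite big_split /= [X in _ + X]exchange_big /= -mulr2n mulr_natl.
  have -> : \sum_i y ord0 i * dx i (dv b L) (x, y)
     = 2 * (\sum_i \sum_j \sum_d G x d b i * a x d j * y ord0 i * y ord0 j
       + \sum_i \sum_j \sum_d a x b d * (G x d i j * y ord0 i * y ord0 j)).
    rewrite -big_split mulr_sumr; apply: eq_bigr => i _ /=.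
    rewrite /dx; have [_ ->] := is_derive_dv (p := (x, y))
      (v := base_dir R i) b (fun k j => @derivable_metric x _ k j Mx).
    rewrite -big_split !mulr_sumr; apply: eq_bigr => j _ /=.
    rewrite -/(partial i (fun z => a z b j) x) -/(partial i (fun z => a z j b) x).
    rewrite !comp// !mxE mulr0 addr0 -!big_split mulr_suml !mulr_sumr.
    apply: eq_bigr => d _ /=.
    by rewrite (Gsym x d i b)// (as_ j d) (as_ d b); ring.
  rewrite mulrDr addrAC subrr add0r; congr (_ * _).
  rewrite exchange_big /=.
  under eq_bigr do rewrite exchange_big /=.
  rewrite exchange_big /=; apply: eq_bigr => d _; rewrite /g mulr_sumr.
  rewrite exchange_big; apply: eq_bigr => i _; rewrite mulr_sumr.
  by [].
under eq_bigr => b _ do rewrite main mulrCA.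
rewrite -mulr_sumr.
have -> : \sum_b invmx (a x) c b * (\sum_d a x b d * g d)
    = \sum_d (\sum_b invmx (a x) c b * a x b d) * g d.
  under eq_bigr do rewrite mulr_sumr.
  rewrite exchange_big; apply: eq_bigr => d _; rewrite mulr_suml.
  by apply: eq_bigr => b _; rewrite mulrA.
rewrite (eq_bigr (fun d => (d == c)%:R * g d)); last first.
  move=> d _; have := mulVmx (aunit x Mx) => /matrixP/(_ c d).
  by rewrite mxE => ->; rewrite mxE eq_sym.
by rewrite sum_delta; field.
Qed.
End QuadraticMetric.

(** * Horizontal vector fields *)

Section VectorFields.
Variables (R : realType) (n : nat).
Local Notation V := 'rV[R]_n.+1.
Local Notation TV := (V * V)%type.

Lemma is_derive_pair (U V1 V2 : normedModType R) (f : U -> V1) (g : U -> V2) (x v : U)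
    df dg : is_derive x v f df -> is_derive x v g dg ->
  is_derive x v (fun z => (f z, g z)) (df, dg).
Proof.
move=> [cf ef] [cg eg].
have c : (fun h : R => h^-1 *: (((fun z => (f z, g z)) \o shift x) (h *: v)
    - (f x, g x))) @ 0^' --> (df, dg).
  apply: (@cvg_pair _ _ _ (0^' : set_system R) (nbhs df) (nbhs dg)).
    by rewrite -ef; exact: cf.
  by rewrite -eg; exact: cg.
by split; [apply/cvg_ex; exists (df, dg)|apply: cvg_lim].
Qed.

Lemma is_derive_mx (U : normedModType R) (p q : nat) (X : U -> 'M[R]_(p, q)) (x v : U)
    (dX : 'M[R]_(p, q)) :
  (forall i j, is_derive x v (fun z => X z i j) (dX i j)) -> is_derive x v X dX.
Proof.
move=> h; have d : derivable X x v by apply/derivable_mxP => i j; have [] := h i j.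
split=> //; rewrite derive_mx//; apply/matrixP => i j; rewrite mxE.
by have [] := h i j.
Qed.

Variables (M : set V) (G : connection R n).
Hypothesis sG : forall c a b, smooth_on M (fun x => G x c a b).

Lemma is_derive_hor (p v : TV) a : M p.1 -> is_derive p v (hor G a)
  (0, - \row_c \sum_b ('D_(v.1) (fun x => G x c a b) p.1 * p.2 ord0 b
                       + G p.1 c a b * v.2 ord0 b)).
Proof.
move=> Mp; apply: (is_derive_pair (f := fun=> delta_mx ord0 a)
  (is_derive_cst (delta_mx ord0 a : V) p v)).
apply: is_deriveN; apply: is_derive_mx => i c; rewrite mxE.
have -> : (fun z : TV => (\row_c' (\sum_b G z.1 c' a b * z.2 ord0 b)) i c)
    = (fun z => \sum_b G z.1 c a b * z.2 ord0 b).
  by apply/funext => z; rewrite mxE.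
apply: is_derive_bigsum => b; apply: is_derive_mul; last exact: is_derive_snd_coord.
apply: (is_derive_fst (f := fun x => G x c a b)).
by apply: diff_derivable; exact: smooth_differentiable (sG c a b) Mp.
Qed.

Lemma lie_hor (p : TV) a b : M p.1 -> lie (hor G a) (hor G b) p
  = (0, - \row_c \sum_e curvature G p.1 c e a b * p.2 ord0 e).
Proof.
move=> Mp; rewrite /lie.
have [_ ->] := is_derive_hor (hor G a p) b Mp.
have [_ ->] := is_derive_hor (hor G b p) a Mp.
congr (_, _); first by rewrite /= subrr.
(* The motion of the velocity along [hor] produces the quadratic terms of the curvature. *)
have hv (a' b' c : 'I_n.+1) : \sum_e G p.1 c b' e * (hor G a' p).2 ord0 e
    = - \sum_e (\sum_f G p.1 c b' f * G p.1 f a' e) * p.2 ord0 e.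
  under eq_bigr do rewrite !mxE mulrN.
  rewrite sumrN; congr (- _); under eq_bigr do rewrite mulr_sumr.
  rewrite exchange_big; apply: eq_bigr => e _ /=; rewrite mulr_suml.
  by apply: eq_bigr => f _; rewrite mulrA.
apply/rowP => c; rewrite [LHS]mxE [X in _ + X = _]mxE.
rewrite !mxE -opprD; congr (- _).
rewrite !big_split !hv /= -!sumrN -!big_split -sumrB; apply: eq_bigr => e _ /=.
rewrite /curvature sumrB /partial /=; ring.
Qed.

(** The outcome is the horizontal covariant derivative of the vertical field z. *)
Lemma lie_hor_vertical (p : TV) a (z : 'I_n.+1 -> TV -> R) (dz : 'I_n.+1 -> R) : M p.1 ->
  (forall c, is_derive p (hor G a p) (z c) (dz c)) ->
  lie (hor G a) (fun q => (0, \row_c z c q)) p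
  = (0, \row_c (dz c + \sum_b G p.1 c a b * z b p)).
Proof.
move=> Mp hz; rewrite /lie.
have [_ ->] := is_derive_hor ((0, \row_c z c p) : TV) a Mp.
have dZ : is_derive p (hor G a p) (fun q : TV => (0, \row_c z c q) : TV)
    (0, \row_c dz c).
  apply: (is_derive_pair (f := fun=> 0) (is_derive_cst (0 : V) p _)).
  apply: is_derive_mx => i c; rewrite mxE.
  have -> : (fun q : TV => (\row_c' z c' q) i c) = z c.
    by apply/funext => q; rewrite mxE.
  exact: hz.
have [_ ->] := dZ.
congr (_, _); first by rewrite /= subrr.
apply/rowP => c; rewrite /= !mxE opprK; congr (_ + _).
by apply: eq_bigr => b _; rewrite derive0 mul0r add0r mxE.
Qed.
End VectorFields.

(** * The spherical connection *)

Section LinearSubstitution.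
Variable R : realType.

Lemma mx_norm_le (p q : nat) (X : 'M[R]_(p, q)) (e : R) : 0 <= e ->
  (forall i j, `|X i j| <= e) -> `|X| <= e.
Proof.
move=> e0 h; rewrite [leLHS]/Num.Def.normr /= mx_normrE.
by apply: bigmax_le => // -[i j] _; exact: h.
Qed.

Lemma mulmxr_le (p q : nat) (E : 'M[R]_(p.+1, q)) :
  exists C : R, forall h : 'rV[R]_p.+1, `|h *m E| <= C * `|h|.
Proof.
have [C hC] := finite_bound (fun ij : 'I_p.+1 * 'I_q => E ij.1 ij.2).
exists (p.+1%:R * `|C|) => h; apply: mx_norm_le => [|i j]; first by rewrite !mulr_ge0.
rewrite mulrAC -mulrA; apply: mulmx_entry_le => k l; first exact: norm_entry_le.
by rewrite (le_trans (hC (k, l)))// ler_norm.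
Qed.

Section AffineRow.
Variables (p q : nat) (E : 'M[R]_(p.+1, q.+1)) (phi : 'rV[R]_p.+1 -> 'rV[R]_q.+1).
Hypothesis phiD : forall h x, phi (h + x) = h *m E + phi x.

Lemma smooth_mulmxr (U : set 'rV[R]_q.+1) (f : 'rV[R]_q.+1 -> R) :
  smooth_on U f -> smooth_on (phi @^-1` U) (f \o phi).
Proof.
by have [C hC] := mulmxr_le E; exact: (smooth_affine (dphi := mulmxr E) hC).
Qed.

Lemma continuous_mulmxr : continuous phi.
Proof.
move=> x; apply: differentiable_continuous; have [C hC] := mulmxr_le E.
exact: (differentiable_affine (dphi := mulmxr E) x hC).
Qed.

Lemma derive_mulmxr (f : 'rV[R]_q.+1 -> R) v x :
  'D_v (f \o phi) x = 'D_(v *m E) f (phi x).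
Proof. by rewrite (derive_affine (dphi := mulmxr E)). Qed.
End AffineRow.
End LinearSubstitution.

Section SphericalConnection.
Variable R : realType.
Local Notation V := 'rV[R]_4.

Lemma ord4_case (P : 'I_4 -> Prop) : P it -> P ir -> P ith -> P iph -> forall i, P i.
Proof.
move=> p0 p1 p2 p3 [[|[|[|[|//]]]] hi].
- by have -> : Ordinal hi = it by exact: val_inj.
- by have -> : Ordinal hi = ir by exact: val_inj.
- by have -> : Ordinal hi = ith by exact: val_inj.
- by have -> : Ordinal hi = iph by exact: val_inj.
Qed.

Lemma sum_ord4 (W : nmodType) (F : 'I_4 -> W) :
  \sum_i F i = F it + F ir + F ith + F iph.
Proof.
rewrite !big_ord_recl big_ord0 addr0 !addrA.
by congr (F _ + F _ + F _ + F _); exact: val_inj.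
Qed.

Definition tr_index : 'I_2 -> 'I_4 := widen_ord (isT : 2 <= 4)%N.

Lemma tr_index0 : tr_index 0 = it. Proof. exact: val_inj. Qed.
Lemma tr_index1 : tr_index 1 = ir. Proof. exact: val_inj. Qed.

Lemma ord2_case (P : 'I_2 -> Prop) : P 0 -> P 1 -> forall i, P i.
Proof.
move=> p0 p1 [[|[|//]] hi].
- by have -> : Ordinal hi = 0 by exact: val_inj.
- by have -> : Ordinal hi = 1 by exact: val_inj.
Qed.

Lemma sum_ord2 (W : nmodType) (F : 'I_2 -> W) : \sum_i F i = F 0 + F 1.
Proof.
rewrite !big_ord_recl big_ord0 addr0.
by congr (F _ + F _); exact: val_inj.
Qed.

(** Writing the projection as a matrix product brings it under the affine substitution lemmas. *)
Definition tr_mx : 'M[R]_(4, 2) := \matrix_(i, j) (i == tr_index j)%:R.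

Lemma tr_projE (x : V) : tr_proj x = x *m tr_mx.
Proof.
apply/rowP => j; rewrite !mxE.
under eq_bigr => i _ do rewrite mxE mulrC.
by rewrite sum_delta.
Qed.

Lemma tr_projD (h x : V) : tr_proj (h + x) = h *m tr_mx + tr_proj x.
Proof. by rewrite !tr_projE mulmxDl. Qed.

Lemma delta_tr_mx a : (delta_mx ord0 a : V) *m tr_mx = \row_j (a == tr_index j)%:R.
Proof. by rewrite -rowE; apply/rowP => j; rewrite !mxE. Qed.

Lemma partial_tr_proj (f : 'rV[R]_2 -> R) (a : 'I_2) (x : V) :
  partial (tr_index a) (f \o @tr_proj R) x = partial a f (tr_proj x).
Proof.
rewrite /partial (derive_mulmxr tr_projD) delta_tr_mx; congr ('D_ _ f _).
by apply/rowP => j; rewrite !mxE eqxx /= eq_sym; move: a j; do 2!elim/ord2_case.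
Qed.

Lemma partial_tr_proj_angle (f : 'rV[R]_2 -> R) (a : 'I_4) (x : V) : (1 < a)%N ->
  partial a (f \o @tr_proj R) x = 0.
Proof.
move=> a1; rewrite /partial (derive_mulmxr tr_projD) delta_tr_mx.
have -> : \row_j ((a == tr_index j)%:R : R) = 0; last exact: derive0.
apply/rowP => j; rewrite !mxE; case: eqP => // e.
by move: a1; rewrite e /= ltnNge -ltnS ltn_ord.
Qed.

Lemma partial_coord_comp (g : R -> R) (i a : 'I_4) (x : V) : a != i ->
  partial a (fun z : V => g (z ord0 i)) x = 0.
Proof.
move=> ai; rewrite /partial derive_coord_comp mxE eqxx eq_sym (negbTE ai).
exact: derive0.
Qed.

Lemma partial_coord_comp_eq (g : R -> R) dg (i : 'I_4) (x : V) :
  is_derive (x ord0 i) 1 g dg -> partial i (fun z : V => g (z ord0 i)) x = dg.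
Proof. by move=> [_ e]; rewrite /partial derive_coord_comp mxE !eqxx. Qed.

(* spherical_connection with k_7 = k_8 = k_9 = k_10 = 0: the product of the
   connection in (t, r) and of that of the round sphere. *)
Definition product_connection (k : nat -> 'rV[R]_2 -> R) : connection R 3 :=
  fun x c a b =>
    let u := tr_proj x in
    let th := x ord0 ith in
    match val c, minn a b, maxn a b with
    | 0, 0, 0 => k 1 u
    | 0, 0, 1 => k 2 u
    | 0, 1, 1 => k 3 u
    | 1, 0, 0 => k 4 u
    | 1, 1, 1 => k 5 u
    | 1, 0, 1 => k 6 u
    | 2, 3, 3 => (- (sin th * cos th))%R
    | 3, 2, 3 => (cos th / sin th)%R
    | _, _, _ => 0%R
    end%N.

Lemma spherical_product_connection k x c a b :
  k 7%N (tr_proj x) = 0 -> k 8%N (tr_proj x) = 0 -> k 9%N (tr_proj x) = 0 ->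
  k 10%N (tr_proj x) = 0 ->
  spherical_connection k x c a b = product_connection k x c a b.
Proof.
move=> h7 h8 h9 h10; rewrite /spherical_connection h7 h8 h9 h10 !mul0r /product_connection.
by case: (val c) => [|[|[|[|?]]]]; case: (minn a b) => [|[|[|[|?]]]];
  case: (maxn a b) => [|[|[|[|?]]]].
Qed.

Lemma product_connection_tr k x c a b :
  product_connection k x (tr_index c) (tr_index a) (tr_index b)
  = tr_connection k (tr_proj x) c a b.
Proof. by move: c a b; do 3!elim/ord2_case. Qed.

Definition angular (i : 'I_4) := (1 < i)%N.

Lemma product_connection_mixed k x c a b :
  ~~ ((angular c == angular a) && (angular c == angular b)) ->
  product_connection k x c a b = 0.
Proof. by move: c a b; do 3!elim/ord4_case. Qed.

(** As a function of theta alone, it makes the partials in other directions vanish by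
    [partial_coord_comp]. *)
Definition angular_connection (th : R) (c a b : 'I_4) : R :=
  match val c, minn a b, maxn a b with
  | 2, 3, 3 => (- (sin th * cos th))%R
  | 3, 2, 3 => (cos th / sin th)%R
  | _, _, _ => 0%R
  end%N.

Lemma product_connection_angular k x c a b : angular c ->
  product_connection k x c a b = angular_connection (x ord0 ith) c a b.
Proof. by move: c a b; do 3!elim/ord4_case. Qed.

Lemma angularPn i : ~~ angular i -> exists j, i = tr_index j.
Proof.
rewrite /angular -leqNgt -ltnS => i2; exists (Ordinal i2); exact: val_inj.
Qed.
End SphericalConnection.

(** * Descent to the (t, r) factor and the product metric *)

Section FlatSpherical.
Variable R : realType.
Local Notation V := 'rV[R]_4.
Variables (M : set V) (A : set (V * V)) (G : connection R 3) (k : nat -> 'rV[R]_2 -> R).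
Hypotheses (oM : open M) (conicA : conic_subbundle M A)
  (torsionG : torsion_free_connection M G)
  (GS : forall x c a b, M x -> G x c a b = product_connection k x c a b)
  (flatA : forall p, A p -> lie (hor G it) (hor G ir) p = 0).

Let sG := (proj1 torsionG).

(** The bracket is linear in the velocity and vanishes on an open set of velocities; comparing y
    with a small shift along the e-th axis isolates one coefficient. *)
Lemma curvature_tr_zero x c e : M x -> curvature G x c e it ir = 0.
Proof.
move=> Mx; have [oA subA fibA _] := conicA; have [y Axy] := fibA x Mx.
have zero z : A (x, z) -> \sum_d curvature G x c d it ir * z ord0 d = 0.
  move=> Axz; have := flatA Axz; rewrite (lie_hor sG _ _ (p := (x, z)) Mx) => -[].
  move/rowP/(_ c); rewrite !mxE => /eqP; rewrite oppr_eq0 => /eqP.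
  exact.
have /nbhs_ballP[d d0 hd] : nbhs (x, y) A by apply: open_nbhs_nbhs.
have d2 : 0 < d / 2 by rewrite divr_gt0.
have Az : A (x, y + (d / 2) *: delta_mx ord0 e).
  apply: hd; split=> /=; first exact: ballxx.
  rewrite -ball_normE /= opprD addrA subrr add0r normrN normrZ gtr0_norm//.
  apply: (@le_lt_trans _ _ (d / 2 * 1)); last first.
    by rewrite mulr1 ltr_pdivrMr// ltr_pMr// ltr1n.
  rewrite ler_wpM2l ?(ltW d2)//; apply: mx_norm_le => // i j.
  by rewrite mxE; case: eqP => _ /=; [case: eqP => _ /=|]; rewrite ?normr1 ?normr0.
have := zero _ Az.
under eq_bigr do rewrite 2!mxE mulrDr.
rewrite big_split /= zero// add0r.
rewrite (eq_bigr (fun j => (j == e)%:R * (curvature G x c j it ir * (d / 2)))); last first.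
  by move=> j _; rewrite mxE eqxx /=; ring.
rewrite sum_delta => /eqP; rewrite mulf_eq0 (gt_eqF d2) orbF.
by move/eqP.
Qed.

Lemma curvature_antisym (n : nat) (H : connection R n) y d c a b :
  curvature H y d c b a = - curvature H y d c a b.
Proof.
rewrite /curvature opprD opprB -sumrN; congr (_ + _).
by apply: eq_bigr => e _; rewrite opprB.
Qed.

Lemma curvature_tr x c e a b : M x ->
  curvature G x (tr_index c) (tr_index e) (tr_index a) (tr_index b)
  = curvature (tr_connection k) (tr_proj x) c e a b.
Proof.
move=> Mx; rewrite (eq_curvature _ _ _ _ oM GS Mx).
have P (a' b' : 'I_2) : partial (tr_index a') (fun z =>
      product_connection k z (tr_index c) (tr_index b') (tr_index e)) x
    = partial a' (fun u => tr_connection k u c b' e) (tr_proj x).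
  have -> : (fun z => product_connection k z (tr_index c) (tr_index b') (tr_index e))
      = (fun u => tr_connection k u c b' e) \o @tr_proj R.
    by apply/funext => z; exact: product_connection_tr.
  exact: partial_tr_proj.
rewrite /curvature !P; congr (_ + _).
rewrite sum_ord4 sum_ord2 -tr_index0 -tr_index1 !product_connection_tr.
have z i j l : angular i -> product_connection k x (tr_index j) (tr_index l) i = 0.
  by move=> ai; apply: product_connection_mixed; rewrite ai; move: j l; do 2!elim/ord2_case.
by rewrite !z// !mul0r !subrr !addr0.
Qed.

(** In dimension two, antisymmetry leaves only the pair (t, r). *)
Lemma tr_connection_flat x c e a b : M x ->
  curvature (tr_connection k) (tr_proj x) c e a b = 0.
Proof.
move=> Mx; rewrite -curvature_tr//.
have self i : curvature G x (tr_index c) (tr_index e) i i = 0.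
  by have := curvature_antisym G x (tr_index c) (tr_index e) i i; lra.
move: a b; do 2!elim/ord2_case; rewrite ?tr_index0 ?tr_index1 ?self//.
  exact: curvature_tr_zero.
by rewrite curvature_antisym curvature_tr_zero// oppr0.
Qed.

Section OverOpen.
Variable W : set 'rV[R]_2.
Hypotheses (oW : open W) (WM : W `<=` [set tr_proj x | x in M]).

(** Smoothness descends from M: [iota] is an affine section of [tr_proj] through a preimage x0 of
    the given point, and G pulled back along it is the (t, r) connection. *)
Lemma smooth_tr_connection c a b : smooth_on W (fun u => tr_connection k u c a b).
Proof.
move=> s u0 /WM[x0 Mx0 e0].
pose E := tr_mx R; pose iota (u : 'rV[R]_2) : V := x0 + (u - u0) *m E^T.
have EE : E^T *m E = 1%:M.
  apply/matrixP => i j; rewrite !mxE; under eq_bigr do rewrite !mxE.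
  rewrite sum_ord4; move: i j; do 2!elim/ord2_case;
    by rewrite /= !mulr0 ?mulr1 ?mul0r ?mul1r ?addr0 ?add0r.
have trK u : tr_proj (iota u) = u.
  by rewrite tr_projE mulmxDl -mulmxA EE mulmx1 -tr_projE e0 addrC subrK.
have iotaD h u : iota (h + u) = h *m E^T + iota u.
  by rewrite /iota -addrA mulmxDl addrCA.
have si := smooth_mulmxr iotaD (sG (tr_index c) (tr_index a) (tr_index b)).
have oU : open (iota @^-1` M).
  by apply: open_comp => // u _; exact: (continuous_mulmxr iotaD).
have : smooth_on (iota @^-1` M) (fun u => tr_connection k u c a b).
  apply: eq_smooth si => // u Mu /=.
  by rewrite GS// product_connection_tr trK.
apply; rewrite /= /iota subrr mul0mx addr0; exact: Mx0.
Qed.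

Lemma tr_connection_torsion_free : torsion_free_connection W (tr_connection k).
Proof.
split; first exact: smooth_tr_connection.
by move=> u c a b _; rewrite /tr_connection minnC maxnC.
Qed.

Lemma tr_connection_flat_on : flat_on W (tr_connection k).
Proof. by move=> u d c a b /WM[x Mx <-]; exact: tr_connection_flat. Qed.

Variable h : 'rV[R]_2 -> 'M[R]_2.
Hypotheses (metric_h : pseudo_metric W h)
  (compat_h : metric_compatible W h (tr_connection k)).
Hypothesis thM : forall x, M x -> sin (x ord0 ith) != 0.
Variable eps : R.
Hypothesis eps0 : eps != 0.

Let MW := M `&` [set x | W (tr_proj x)].

(* Both off-diagonal entries are h_01, so that the quadratic form is
   product_metric even where h is not symmetric. *)
Definition product_mx (x : V) : 'M[R]_4 := \matrix_(i, j)
  match val i, val j with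
  | 0, 0 => (h (tr_proj x) 0 0)%R
  | 0, 1 | 1, 0 => (h (tr_proj x) 0 1)%R
  | 1, 1 => (h (tr_proj x) 1 1)%R
  | 2, 2 => eps
  | 3, 3 => (eps * sin (x ord0 ith) ^+ 2)%R
  | _, _ => 0%R
  end%N.

Definition angular_metric (th : R) (i j : 'I_4) : R :=
  match val i, val j with
  | 2, 2 => eps
  | 3, 3 => (eps * sin th ^+ 2)%R
  | _, _ => 0%R
  end%N.

Lemma product_metricE : product_metric h eps = quadratic_form product_mx.
Proof.
apply/funext => p; rewrite /quadratic_form sum_ord4 !sum_ord4 !mxE /= /product_metric.
ring.
Qed.

Lemma open_MW : open MW.
Proof.
apply: openI => //; apply: open_comp => // x _.
exact: (continuous_mulmxr (@tr_projD R)).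
Qed.

Lemma pseudo_metric_product : pseudo_metric MW product_mx.
Proof.
have [sh hsym hunit] := metric_h.
have oMW := open_MW.
split.
- have sW i j : smooth_on MW (fun x => h (tr_proj x) i j).
    apply: smoothW (smooth_mulmxr (@tr_projD R) (sh i j)).
    by move=> x [].
  have [ss _] := smooth_sin_cos ith oMW.
  move=> a b; have -> : (fun x => product_mx x a b) = (fun x =>
    match val a, val b with
    | 0, 0 => (h (tr_proj x) 0 0)%R
    | 0, 1 | 1, 0 => (h (tr_proj x) 0 1)%R
    | 1, 1 => (h (tr_proj x) 1 1)%R
    | 2, 2 => eps
    | 3, 3 => (eps * sin (x ord0 ith) ^+ 2)%R
    | _, _ => 0%R
    end%N) by apply/funext => x; rewrite mxE.
  have sin2 : smooth_on MW (fun x => eps * sin (x ord0 ith) ^+ 2).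
    apply: smoothM => //; first exact: smooth_cst.
    by under eq_fun do rewrite expr2; exact: smoothM.
  by move: a b; do 2!elim/ord4_case => /=; try exact: sW; try exact: smooth_cst.
- by move=> x _; apply/matrixP => i j; rewrite !mxE; move: i j; do 2!elim/ord4_case.
- move=> x [Mx Wx]; set hu := h (tr_proj x); set s := sin (x ord0 ith).
  have s0 : s != 0 by exact: thM.
  pose B : 'M[R]_4 := \matrix_(i, j)
    match val i, val j with
    | 0, 0 => (invmx hu 0 0)%R
    | 0, 1 => (invmx hu 0 1)%R
    | 1, 0 => (invmx hu 1 0)%R
    | 1, 1 => (invmx hu 1 1)%R
    | 2, 2 => (eps^-1)%R
    | 3, 3 => ((eps * s ^+ 2)^-1)%R
    | _, _ => 0%R
    end%N.
  have hs : hu 1 0 = hu 0 1 by rewrite /hu -[in LHS](hsym _ Wx) mxE.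
  have inv i j := congr1 (fun X : 'M[R]_2 => X i j) (mulmxV (hunit _ Wx)).
  have inv' i j : hu i 0 * invmx hu 0 j + hu i 1 * invmx hu 1 j = (i == j)%:R.
    by have := inv i j; rewrite /= mxE sum_ord2 mxE => ->.
  suff /mulmx1_unit[] : product_mx x *m B = 1%:M by [].
  apply/matrixP => i j; rewrite mxE sum_ord4 !mxE; move: i j.
  have := inv' 0 0; have := inv' 0 1; have := inv' 1 0; have := inv' 1 1.
  rewrite /= hs => i11 i10 i01 i00.
  do 2!elim/ord4_case; rewrite /= -/hu -/s ?mul0r ?mulr0 ?addr0 ?add0r //.
    exact: mulfV.
  by rewrite mulfV// mulf_neq0// expf_neq0.
Qed.

Lemma product_mx_mixed x i j : angular i != angular j -> product_mx x i j = 0.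
Proof. by rewrite mxE; move: i j; do 2!elim/ord4_case. Qed.

Lemma product_mx_tr x i j : MW x ->
  product_mx x (tr_index i) (tr_index j) = h (tr_proj x) i j.
Proof.
have [_ hsym _] := metric_h; move=> [_ Wx].
have hs : h (tr_proj x) 1 0 = h (tr_proj x) 0 1 by rewrite -[in LHS](hsym _ Wx) mxE.
by rewrite mxE; move: i j; do 2!elim/ord2_case.
Qed.

Lemma angular_tr i : angular (tr_index i) = false.
Proof. by move: i; elim/ord2_case. Qed.

(** The blocks decouple: the (t, r) block reduces to the compatibility of h, mixed entries give 0 on
    both sides, and the angular block is the metric of the round sphere up to the factor eps. *)
Lemma product_mx_compatible : metric_compatible MW product_mx G.
Proof.
move=> x a b d MWx; have [Mx Wx] := MWx.
rewrite (eq_bigr (fun c => product_connection k x c a b * product_mx x c d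
    + product_connection k x c a d * product_mx x b c)); last first.
  by move=> c _; rewrite !GS.
have mixed c i j : ~~ ((angular c == angular i) && (angular c == angular j)) ->
    product_connection k x c i j = 0 by exact: product_connection_mixed.
have [bJ|bI] := boolP (angular b); have [dJ|dI] := boolP (angular d); last first.
- have [b' eb] := angularPn bI; have [d' ed] := angularPn dI.
  rewrite eb ed.
  have -> : partial a (fun z => product_mx z (tr_index b') (tr_index d')) x
      = partial a ((fun u => h u b' d') \o @tr_proj R) x.
    by apply: near_eq_derive_open open_MW _ MWx => y MWy; rewrite product_mx_tr.
  rewrite sum_ord4 (mixed ith) ?angular_tr ?andbF// (mixed ith) ?angular_tr ?andbF//.
  rewrite (mixed iph) ?angular_tr ?andbF// (mixed iph) ?angular_tr ?andbF//.
  rewrite !mul0r !addr0.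
  have [aJ|aI] := boolP (angular a).
    rewrite partial_tr_proj_angle// !mixed ?angular_tr ?aJ ?andbF//.
    by rewrite !mul0r !addr0.
  have [a' ->] := angularPn aI.
  rewrite partial_tr_proj compat_h// sum_ord2 -tr_index0 -tr_index1.
  by rewrite !product_connection_tr !product_mx_tr.
- have [b' eb] := angularPn bI.
  have -> : (fun z => product_mx z b d) = (fun=> 0).
    by apply/funext => z; rewrite product_mx_mixed// dJ (negbTE bI).
  rewrite /partial derive_cst big1// => c _.
  have [cJ|cI] := boolP (angular c).
    rewrite (mixed c a b) ?cJ ?(negbTE bI) ?andbF// mul0r add0r.
    by rewrite (product_mx_mixed x (i := b)) ?mulr0// cJ (negbTE bI).
  rewrite (mixed c a d) ?dJ ?(negbTE cI) ?andbF// mul0r addr0.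
  by rewrite (product_mx_mixed x (i := c)) ?mulr0// dJ (negbTE cI).
- have -> : (fun z => product_mx z b d) = (fun=> 0).
    by apply/funext => z; rewrite product_mx_mixed// bJ (negbTE dI).
  rewrite /partial derive_cst big1// => c _.
  have [cJ|cI] := boolP (angular c).
    rewrite (mixed c a d) ?cJ ?(negbTE dI) ?andbF// mul0r addr0.
    by rewrite (product_mx_mixed x (i := c)) ?mulr0// cJ (negbTE dI).
  rewrite (mixed c a b) ?bJ ?(negbTE cI) ?andbF// mul0r add0r.
  by rewrite (product_mx_mixed x (i := b)) ?mulr0// bJ (negbTE cI).
- have s0 := thM Mx.
  have -> : (fun z => product_mx z b d) = (fun z => angular_metric (z ord0 ith) b d).
    by apply/funext => z; rewrite mxE; elim/ord4_case: b bJ => // _; elim/ord4_case: d dJ.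
  have [aJ|aI] := boolP (angular a); last first.
    rewrite (partial_coord_comp (fun t => angular_metric t b d)); last first.
      by apply: contra aI => /eqP ->.
    have bb c' b' : angular b' -> product_connection k x c' a b' = 0.
      by move=> b'J; apply: mixed; rewrite (negbTE aI) b'J; case: (angular c').
    by rewrite big1 => // c _; rewrite !bb// !mul0r addr0.
  have dsin2 (t : R) : is_derive t 1 (fun u => eps * sin u ^+ 2) (eps * (2 * sin t * cos t)).
    have hs : is_derive t (1 : R) (fun u => sin u) (cos t) by exact: is_derive_sin.
    have := is_derive_mul (is_derive_cst eps t 1) (is_derive_mul hs hs).
    rewrite mul0r add0r; under eq_fun do rewrite -expr2.
    by have -> : cos t * sin t + sin t * cos t = 2 * sin t * cos t by ring.
  set s := sin (x ord0 ith); set c0 := cos (x ord0 ith).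
  rewrite sum_ord4 !mxE; elim/ord4_case: a aJ => // _; elim/ord4_case: b bJ => // _;
    elim/ord4_case: d dJ => // _.
  all: rewrite ?(partial_coord_comp (fun t => angular_metric t _ _) (a := iph))//.
  all: rewrite /product_connection /= -/s -/c0 ?mul0r ?mulr0 ?addr0 ?add0r //.
  all: try by apply: (partial_coord_comp_eq (g := fun=> _)); exact: is_derive_cst.
  all: try by field.
  (* What remains is the theta-derivative of the phi-phi entry. *)
  rewrite (partial_coord_comp_eq (dsin2 _)) -/s -/c0; field.
  exact: s0.
Qed.
End OverOpen.
End FlatSpherical.

(** * The vertical distribution *)

Section VerticalDistribution.
Variable R : realType.
Local Notation V := 'rV[R]_4.
Local Notation TV := (V * V)%type.

Lemma is_derive_coord_comp (n : nat) (g : R -> R) (dg : R) (i : 'I_n.+1)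
    (x v : 'rV[R]_n.+1) : is_derive (x ord0 i) 1 g dg ->
  is_derive x v (fun z : 'rV[R]_n.+1 => g (z ord0 i)) (v ord0 i * dg).
Proof.
move=> [d e]; have df : differentiable g (x ord0 i) by apply/derivable1_diffP.
split; first by apply: diff_derivable; exact: differentiable_coord_comp.
by rewrite derive_coord_comp deriveE// -[v ord0 i]mulr1 linearZ -deriveE// e mulr1.
Qed.

Lemma is_derive_cot (t : R) : sin t != 0 ->
  is_derive t 1 (fun u => cos u / sin u) (- (sin t ^+ 2)^-1).
Proof.
move=> s0.
have ds : is_derive t (1 : R) (fun u => (sin u)^-1) (- cos t / sin t ^+ 2).
  have := is_deriveV s0 (is_derive_sin t).
  by rewrite /GRing.scale /= mulNr [_^-1 * _]mulrC -mulNr.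
have := is_derive_mul (is_derive_cos t) ds.
have -> // : - sin t * (sin t)^-1 + cos t * (- cos t / sin t ^+ 2) = - (sin t ^+ 2)^-1.
have e := cos2Dsin2 t.
have -> : - sin t * (sin t)^-1 + cos t * (- cos t / sin t ^+ 2)
   = - (cos t ^+ 2 + sin t ^+ 2) / sin t ^+ 2 by field.
by rewrite e mulN1r.
Qed.

(* (al sin + be cos) J, where J rotates the angular velocity by a right angle in
   the orthonormal frame of the round sphere. J is parallel, so bracketing with
   delta_theta differentiates the coefficient and the other delta_a kill it. *)
Definition rotation (al be : R) : TV -> TV := fun q => (0, \row_c
  match val c with
  | 2%N => (al * sin (q.1 ord0 ith) + be * cos (q.1 ord0 ith)) * sin (q.1 ord0 ith)
           * q.2 ord0 iph
  | 3%N => - (al + be * (cos (q.1 ord0 ith) / sin (q.1 ord0 ith))) * q.2 ord0 ith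
  | _ => 0
  end).

Variables (M : set V) (A : set TV) (G : connection R 3) (k : nat -> 'rV[R]_2 -> R).
Hypotheses (oM : open M) (conicA : conic_subbundle M A)
  (torsionG : torsion_free_connection M G)
  (GS : forall x c a b, M x -> G x c a b = product_connection k x c a b)
  (flatA : forall p, A p -> lie (hor G it) (hor G ir) p = 0)
  (thM : forall x, M x -> sin (x ord0 ith) != 0).

Let sG := (proj1 torsionG).

(** Differentiating al sin + be cos sends the coefficients (al, be) to (-be, al). *)
Lemma lie_hor_rotation a al be p : M p.1 ->
  lie (hor G a) (rotation al be) p
  = if a == ith then rotation (- be) al p else 0.
Proof.
move=> Mp; have s0 := thM Mp.
set s := sin (p.1 ord0 ith) in s0; set co := cos (p.1 ord0 ith).
pose F (t : R) := (al * sin t + be * cos t) * sin t.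
pose H (t : R) := - (al + be * (cos t / sin t)).
pose z (c : 'I_4) (q : TV) := match val c with
  | 2%N => F (q.1 ord0 ith) * q.2 ord0 iph
  | 3%N => H (q.1 ord0 ith) * q.2 ord0 ith
  | _ => 0 end.
have -> : rotation al be = fun q => (0, \row_c z c q) by [].
pose dF := (al * co - be * s) * s + (al * s + be * co) * co.
pose dH := be / s ^+ 2.
have hF : is_derive (p.1 ord0 ith) 1 F dF.
  have h1 := is_derive_mul (is_derive_cst al (p.1 ord0 ith) 1) (is_derive_sin (p.1 ord0 ith)).
  have h2 := is_derive_mul (is_derive_cst be (p.1 ord0 ith) 1) (is_derive_cos (p.1 ord0 ith)).
  have := is_derive_mul (is_deriveD h1 h2) (is_derive_sin (p.1 ord0 ith)).
  have -> // : (0 * sin (p.1 ord0 ith) + al * cos (p.1 ord0 ith)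
    + (0 * cos (p.1 ord0 ith) + be * - sin (p.1 ord0 ith))) * sin (p.1 ord0 ith)
    + (al * sin (p.1 ord0 ith) + be * cos (p.1 ord0 ith)) * cos (p.1 ord0 ith) = dF.
  by rewrite /dF -/s -/co; ring.
have hH : is_derive (p.1 ord0 ith) 1 H dH.
  have h2 := is_derive_mul (is_derive_cst be (p.1 ord0 ith) 1) (is_derive_cot s0).
  have := is_deriveN (is_deriveD (is_derive_cst al (p.1 ord0 ith) 1) h2).
  have -> // : - (0 + (0 * (cos (p.1 ord0 ith) / sin (p.1 ord0 ith))
     + be * - (sin (p.1 ord0 ith) ^+ 2)^-1)) = dH.
  by rewrite /dH -/s; ring.
pose v := hor G a p.
pose dz (c : 'I_4) := match val c with
  | 2%N => v.1 ord0 ith * dF * p.2 ord0 iph + F (p.1 ord0 ith) * v.2 ord0 iph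
  | 3%N => v.1 ord0 ith * dH * p.2 ord0 ith + H (p.1 ord0 ith) * v.2 ord0 ith
  | _ => 0 end.
have hz c : is_derive p v (z c) (dz c).
  have hF' := is_derive_coord_comp v.1 hF; have hH' := is_derive_coord_comp v.1 hH.
  elim/ord4_case: c; rewrite /z /dz /=; try exact: is_derive_cst.
    apply: is_derive_mul; last exact: is_derive_snd_coord.
    have [d e] := hF'; rewrite -e.
    exact: (is_derive_fst (f := fun x : V => F (x ord0 ith))).
  apply: is_derive_mul; last exact: is_derive_snd_coord.
  have [d e] := hH'; rewrite -e.
  exact: (is_derive_fst (f := fun x : V => H (x ord0 ith))).
rewrite (lie_hor_vertical sG Mp hz).
have e2 i : v.2 ord0 i = - \sum_b product_connection k p.1 i a b * p.2 ord0 b.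
  by rewrite /v /= !mxE; congr (- _); apply: eq_bigr => b _; rewrite GS.
have e1 : v.1 ord0 ith = (ith == a)%:R by rewrite /v /= mxE eqxx.
have -> : (\row_c (dz c + \sum_b G p.1 c a b * z b p) : V)
   = \row_c (dz c + \sum_b product_connection k p.1 c a b * z b p).
  by apply/rowP => c; rewrite !mxE; congr (_ + _); apply: eq_bigr => b _; rewrite GS.
have -> : (if a == ith then rotation (- be) al p else 0)
    = (0, if a == ith then (rotation (- be) al p).2 else 0) by case: eqP.
congr (_, _); apply/rowP => c; rewrite mxE sum_ord4.
rewrite /dz !e2 e1 !sum_ord4; elim/ord4_case: a v {hz dz e1 e2} => v;
  elim/ord4_case: c; rewrite /z /product_connection /= ?mxE /=.
all: rewrite /F /H -/s -/co ?mul0r ?mulr0 ?mul1r ?addr0 ?add0r ?oppr0 ?mulr0 ?addr0 //.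
- by rewrite /dF; field.
- have -> : dH = be * (co ^+ 2 + s ^+ 2) / s ^+ 2 by rewrite /co /s cos2Dsin2 mulr1.
  by field.
- by field.
- by field.
Qed.

Lemma curvature_self (n : nat) (H : connection R n) y d c a : curvature H y d c a a = 0.
Proof. by have := curvature_antisym H y d c a a; lra. Qed.

(** Each block of the connection depends only on its own variables and mixed coefficients vanish,
    which kills both the derivative terms and the products. *)
Lemma curvature_mixed x c e a b : M x -> ~~ angular a -> angular b ->
  curvature G x c e a b = 0.
Proof.
move=> Mx aI bJ; rewrite (eq_curvature _ _ _ _ oM GS Mx) /curvature.
have zero (f : V -> R) i : (forall z, f z = 0) -> partial i f x = 0.
  by move=> f0; have -> : f = (fun=> 0) by [apply/funext]; rewrite /partial derive_cst.
have ai : a != ith by apply: contra aI => /eqP ->.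
have bi j : b != tr_index j by apply: contraTneq bJ => ->; rewrite angular_tr.
have mixed := @product_connection_mixed R k.
have p1 : partial a (fun z => product_connection k z c b e) x = 0.
  have [cJ|cI] := boolP (angular c).
    have -> : (fun z => product_connection k z c b e)
        = (fun z : V => angular_connection (z ord0 ith) c b e).
      by apply/funext => z; exact: product_connection_angular.
    exact: (partial_coord_comp (fun t => angular_connection t c b e)).
  by apply: zero => z; apply: mixed; rewrite (negbTE cI) bJ.
have p2 : partial b (fun z => product_connection k z c a e) x = 0.
  have [cJ|cI] := boolP (angular c).
    by apply: zero => z; apply: mixed; rewrite (negbTE aI) cJ.
  have [eJ|eI] := boolP (angular e).
    by apply: zero => z; apply: mixed; rewrite eJ (negbTE cI) andbF.
  have [c' ->] := angularPn cI; have [a' ->] := angularPn aI.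
  have [e' ->] := angularPn eI.
  have -> : (fun z => product_connection k z (tr_index c') (tr_index a') (tr_index e'))
      = (fun u => tr_connection k u c' a' e') \o @tr_proj R.
    by apply/funext => z; exact: product_connection_tr.
  exact: partial_tr_proj_angle.
rewrite p1 p2 subrr add0r big1// => f _.
have [fJ|fI] := boolP (angular f).
  rewrite (mixed x c a f) ?mul0r ?sub0r; last by rewrite fJ (negbTE aI); case: (angular c).
  by rewrite (mixed x f a e) ?mulr0 ?oppr0// fJ (negbTE aI).
rewrite (mixed x f b e) ?mulr0 ?sub0r; last by rewrite (negbTE fI) bJ.
rewrite (mixed x c b f) ?mul0r ?oppr0//.
by rewrite (negbTE fI) bJ; case: (angular c).
Qed.

(** These are the curvature components of the unit sphere. *)
Lemma curvature_angular x c e : M x -> curvature G x c e ith iph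
  = match val c, val e with
    | 2%N, 3%N => sin (x ord0 ith) ^+ 2
    | 3%N, 2%N => -1
    | _, _ => 0
    end.
Proof.
move=> Mx; rewrite (eq_curvature _ _ _ _ oM GS Mx) /curvature.
have s0 := thM Mx; set s := sin (x ord0 ith) in s0 *; set co := cos (x ord0 ith).
have cs : co ^+ 2 + s ^+ 2 = 1 by exact: cos2Dsin2.
have zero (f : V -> R) i : (forall z, f z = 0) -> partial i f x = 0.
  by move=> f0; have -> : f = (fun=> 0) by [apply/funext]; rewrite /partial derive_cst.
have p2 : partial iph (fun z => product_connection k z c ith e) x = 0.
  have [cJ|cI] := boolP (angular c); last first.
    by apply: zero => z; apply: product_connection_mixed; rewrite (negbTE cI).
  have -> : (fun z => product_connection k z c ith e)
      = (fun z : V => angular_connection (z ord0 ith) c ith e).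
    by apply/funext => z; exact: product_connection_angular.
  exact: (partial_coord_comp (fun t => angular_connection t c ith e)).
have dsc : is_derive (x ord0 ith) 1 (fun t => - (sin t * cos t)) (s ^+ 2 - co ^+ 2).
  have := is_deriveN (is_derive_mul (is_derive_sin (x ord0 ith)) (is_derive_cos (x ord0 ith))).
  have -> // : - (cos (x ord0 ith) * cos (x ord0 ith) + sin (x ord0 ith) * - sin (x ord0 ith))
    = s ^+ 2 - co ^+ 2 by rewrite -/s -/co; ring.
have p1 : partial ith (fun z => product_connection k z c iph e) x
    = match val c, val e with
      | 2%N, 3%N => s ^+ 2 - co ^+ 2
      | 3%N, 2%N => - (s ^+ 2)^-1
      | _, _ => 0
      end.
  elim/ord4_case: c {p2}; elim/ord4_case: e; try by apply: zero => z.
  - exact: (partial_coord_comp_eq dsc).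
  - exact: (partial_coord_comp_eq (is_derive_cot s0)).
rewrite p1 p2 subr0 sum_ord4; elim/ord4_case: c {p1 p2}; elim/ord4_case: e;
  rewrite /product_connection /= -/s -/co.
all: try by ring.
- by field.
- have -> : (s ^+ 2)^-1 = (co ^+ 2 + s ^+ 2) / s ^+ 2 by rewrite cs mul1r.
  by field.
Qed.

Lemma rotation0 p : rotation 0 0 p = 0.
Proof.
congr (_, _); apply/rowP => c; rewrite !mxE.
by case: (val c) => [|[|[|[|?]]]] //; rewrite !mul0r addr0 ?oppr0 ?mul0r.
Qed.

(** Division by sin theta, nonzero on M, shows that all these fields are pointwise proportional;
    this is why the vertical part is at most a line. *)
Lemma rotationE al be p : M p.1 ->
  rotation al be p = (al + be * (cos (p.1 ord0 ith) / sin (p.1 ord0 ith))) *: rotation 1 0 p.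
Proof.
move=> Mp; have s0 := thM Mp; congr (_, _); first by rewrite scaler0.
apply/rowP => c; rewrite !mxE; case: (val c) => [|[|[|[|?]]]]; rewrite ?mulr0 //.
- by field.
- by ring.
Qed.

Lemma conic_base p : A p -> M p.1.
Proof. by have [_ sub _ _] := conicA; move/sub => []. Qed.

(** Only theta and phi give a nonzero bracket, with al = -1 or 1 according to their order. The
    flatness assumption covers t and r, and the product structure covers the mixed pairs. *)
Lemma lie_hor_hor a b : exists al, forall p, A p ->
  lie (hor G a) (hor G b) p = rotation al 0 p.
Proof.
have zero : (forall x c e, M x -> curvature G x c e a b = 0) -> exists al, forall p, A p ->
    lie (hor G a) (hor G b) p = rotation al 0 p.
  move=> cz; exists 0 => p Ap; have Mp := conic_base Ap.
  rewrite (lie_hor sG)// rotation0; congr (_, _); apply/rowP => c; rewrite !mxE big1 ?oppr0//.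
  by move=> e _; rewrite cz// mul0r.
have [aJ|aI] := boolP (angular a); have [bJ|bI] := boolP (angular b).
- move: zero; elim/ord4_case: a aJ => // _; elim/ord4_case: b bJ => // _ zero.
  + by apply: zero => x c e Mx; exact: curvature_self.
  + exists (-1) => p Ap; have Mp := conic_base Ap.
    rewrite (lie_hor sG)//; congr (_, _); apply/rowP => c.
    rewrite !mxE sum_ord4 !curvature_angular//.
    by elim/ord4_case: c; rewrite /=; ring.
  + exists 1 => p Ap; have Mp := conic_base Ap.
    rewrite (lie_hor sG)//; congr (_, _); apply/rowP => c.
    rewrite !mxE sum_ord4 ![curvature _ _ _ _ iph ith]curvature_antisym !curvature_angular//.
    by elim/ord4_case: c; rewrite /=; ring.
  + by apply: zero => x c e Mx; exact: curvature_self.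
- by apply: zero => x c e Mx; rewrite curvature_antisym curvature_mixed ?oppr0.
- by apply: zero => x c e Mx; exact: curvature_mixed.
- have tr0 := curvature_tr_zero conicA torsionG flatA.
  apply: zero => x c e Mx; have [a' ->] := angularPn aI; have [b' ->] := angularPn bI.
  elim/ord2_case: a'; elim/ord2_case: b'; rewrite ?tr_index0 ?tr_index1 ?curvature_self//.
    exact: tr0.
  by rewrite curvature_antisym tr0// oppr0.
Qed.

(** Inner brackets are identified on A only; since A is open, this determines their derivatives
    there. *)
Lemma eq_lie (X Y Y' : TV -> TV) p : A p -> (forall q, A q -> Y q = Y' q) ->
  lie X Y p = lie X Y' p.
Proof.
have [oA _ _ _] := conicA; move=> Ap YY.
have e : 'D_(X p) Y p = 'D_(X p) Y' p.
  apply: near_eq_derive; have : nbhs p A by apply: open_nbhs_nbhs.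
  by apply: filterS.
have eY := YY p Ap.
by rewrite /lie e eY.
Qed.

(** The coefficients do not depend on p, because the induction differentiates the inner bracket. *)
Lemma hor_bracket_rotation s c : s != [::] -> exists al be, forall p, A p ->
  hor_bracket G s c p = rotation al be p.
Proof.
elim: s => // a [|b s] IH _.
  by have [al h] := lie_hor_hor a c; exists al, 0 => p /h.
have [//|al [be h]] := IH.
have e p : A p -> hor_bracket G [:: a, b & s] c p
    = if a == ith then rotation (- be) al p else 0.
  move=> Ap; rewrite -lie_hor_rotation; last exact: conic_base.
  exact: eq_lie.
case: eqP e => [_|_] e; first by exists (- be), al.
by exists 0, 0 => p Ap; rewrite e// rotation0.
Qed.

(** Brackets of length two already span the line of [rotation 1 0], and longer ones stay in it.
    Where the angular speed is 0 this field vanishes and the dimension drops to 0. *)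
Theorem vertical_distribution_dim p : A p -> angular_speed p != 0 ->
  has_dim (VDH G p) 1.
Proof.
move=> Ap w0; have Mp := conic_base Ap; have s0 := thM Mp.
set v0 := rotation 1 0 p.
have v0n : v0 != 0.
  apply: contra w0 => /eqP v00; rewrite /angular_speed.
  have e i : v0.2 ord0 i = 0 by rewrite v00 mxE.
  have /eqP := e ith; rewrite mxE /= mul1r mul0r addr0 !mulf_eq0 (negbTE s0) /=.
  move/eqP => ->.
  have /eqP := e iph; rewrite mxE /= mul0r addr0 mulN1r oppr_eq0 => /eqP ->.
  by rewrite !expr0n /= mul0r addr0 sqrtr0.
exists <[v0]>%VS; split; last by rewrite dim_vline v0n.
move=> v; split.
- case/vlineP => c ->; split; last by rewrite /= scaler0.
  have hb : hor_bracket G [:: ith] iph p = - v0.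
    rewrite /= (lie_hor sG)// -[- v0]scaleN1r.
    congr (_, _); first by rewrite scaler0.
    apply/rowP => i; rewrite !mxE sum_ord4 !curvature_angular//.
    by elim/ord4_case: i; rewrite /=; ring.
  exists [:: - v0]; split.
    by move=> u; rewrite inE => /eqP ->; exists [:: ith], iph.
  by rewrite span_seq1; apply/vlineP; exists (- c); rewrite scalerN scaleNr opprK.
- case=> -[vs [hvs vspan]] v1.
  (* A bracket is either a [hor] field itself, when s is empty, or a multiple of [v0]. *)
  pose U := (<[v0]> + \sum_(a < 4) <[hor G a p]>)%VS.
  have /subvP/(_ _ vspan) : (<<vs>> <= U)%VS.
    apply/span_subvP => u /hvs[s [c ->]].
    have [->|s1] := eqVneq s [::].
      apply: (subvP (addvSr _ _)); apply: (subvP (sumv_sup c _ (subvv _))) => //.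
      exact: memv_line.
    have [al [be h]] := hor_bracket_rotation c s1.
    apply: (subvP (addvSl _ _)); rewrite h// rotationE//.
    exact/memvZ/memv_line.
  case/memv_addP => u /vlineP[c ->] [w /memv_sumP[ws hws ->]] ev.
  have /choice[r hr] : forall a, exists r, ws a = r *: hor G a p.
    by move=> a; exact/vlineP/hws.
  (* The base part of [hor G a] is the a-th basis vector, so a vertical combination has no
     horizontal coefficient. *)
  have r0 a : r a = 0.
    move: v1; rewrite /= ev /= scaler0 add0r => /rowP/(_ a).
    have -> : (\sum_(i < 4) ws i).1 = \sum_i r i *: (delta_mx ord0 i : V).
      by rewrite raddf_sum; apply: eq_bigr => i _; rewrite hr.
    rewrite summxE (eq_bigr (fun i => (i == a)%:R * r i)) ?sum_delta ?mxE// => i _.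
    by rewrite !mxE eqxx /= eq_sym mulrC.
  rewrite ev big1 ?addr0; last by move=> a _; rewrite hr r0 scale0r.
  by apply/vlineP; exists c.
Qed.
End VerticalDistribution.

(** * Assembly over each simply connected W *)

Theorem lemma13 (R : realType) (M : set 'rV[R]_4)
    (A : set ('rV[R]_4 * 'rV[R]_4)) (L : 'rV[R]_4 * 'rV[R]_4 -> R)
    (G : connection R 3) (k : nat -> 'rV[R]_2 -> R)
    (hM : spherical_domain M)
    (hL : berwald_with M A L G)
    (hsym : spherically_symmetric A L)
    (hG : forall x c a b, M x -> G x c a b = spherical_connection k x c a b)
    (hflat : forall p, A p -> lie (hor G it) (hor G ir) p = 0)
    (hk : forall x, M x ->
       [/\ k 7%N (tr_proj x) = 0, k 8%N (tr_proj x) = 0,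
           k 9%N (tr_proj x) = 0 & k 10%N (tr_proj x) = 0]) :
  (forall W : set 'rV[R]_2,
     open W -> simply_connected W -> W `<=` [set tr_proj x | x in M] ->
     exists h : 'rV[R]_2 -> 'M[R]_2,
       [/\ pseudo_metric W h,
           flat_on W (christoffel h),
           metrizes W h (tr_connection k)
         & forall b : bool,
             let MW := M `&` [set x | W (tr_proj x)] in
             let AW := A `&` [set p | W (tr_proj p.1)] in
             let LA := product_metric h ((-1) ^+ b) in
             pseudo_riemannian MW (slit_tangent MW) LA /\
             affinely_equivalent MW AW L (slit_tangent MW) LA]) /\
  (forall p, A p -> angular_speed p != 0 -> has_dim (VDH G p) 1).
Proof.
have [oM domM] := hM.
have [[conicA sL homL fundL] torsionG sprayL] := hL.
have GS x c a b : M x -> G x c a b = product_connection k x c a b.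
  by move=> Mx; rewrite hG//; have [*] := hk x Mx; exact: spherical_product_connection.
have thM x : M x -> sin (x ord0 ith) != 0.
  by move=> /domM[_ ?]; rewrite gt_eqF// sin_gt0_pi.
split; last first.
  exact: (vertical_distribution_dim oM conicA torsionG GS hflat thM).
move=> W oW scW WM.
have tcon := tr_connection_torsion_free oM torsionG GS WM.
have tflat := tr_connection_flat_on oM conicA torsionG GS hflat WM.
have [h [metric_h compat_h]] := flat_connection_metric oW scW tcon tflat.
have met : metrizes W h (tr_connection k).
  by apply: metrizes_compatible => // x c a b; exact: tcon.2.
exists h; split=> //.
  (* Flatness passes to the Levi-Civita connection of h because the two connections agree on the
     open set W, hence also in their derivatives. *)
  move=> u d c a b Wu; rewrite (eq_curvature (G' := tr_connection k) _ _ _ _ oW _ Wu).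
    exact: tflat.
  by move=> *; rewrite -met.
move=> b MW AW LA; rewrite /LA product_metricE.
have eps0 : (-1) ^+ b != 0 :> R by rewrite expf_neq0// oppr_eq0 oner_eq0.
have oMW := open_MW oM oW.
have metricMW := pseudo_metric_product oM oW metric_h thM eps0.
have compatMW := product_mx_compatible oM GS oW metric_h compat_h thM ((-1) ^+ b).
split; first exact: pseudo_riemannian_quadratic.
(* Both metrics share G itself; for L, the Berwald property merely restricts to the part of A above
   W. *)
have torsionMW : torsion_free_connection MW G.
  split; first by move=> c i j; apply: smoothW (torsionG.1 c i j) => x [].
  by move=> x c i j [Mx _]; exact: torsionG.2.
exists G; split; last exact: berwald_quadratic.
have [oA subA fibA coneA] := conicA.
split=> //; last by move=> x y c [Axy _]; exact: sprayL.
split.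
- split.
  + apply: openI => //; apply: open_comp => //.
    move=> p _; apply: continuous_comp; first exact: cvg_fst.
    exact: (continuous_mulmxr (@tr_projD R)).
  + by move=> p [/subA[Mp p0] Wp].
  + by move=> x [Mx Wx]; have [y Axy] := fibA x Mx; exists y.
  + by move=> x y c c0 [Axy Wx]; split=> //; exact: coneA.
- by apply: smoothW sL => p [].
- by move=> x y c c0 [Axy _]; exact: homL.
- by move=> p [Ap _]; exact: fundL.
Qed.
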